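(* Let $f$ be a conformal map of $\mathbb{D}$ onto an unbounded convex domain, normalized by $f(0)=0$, $f'(0)=1$, with second Taylor coefficient $a_2=f''(0)/2\neq 0$, and let $f^{*}=\dfrac{f}{1+a_2f}$. Then $$|a_2f^{*}(z)|<1,\qquad z\in\mathbb{D},$$ and $|a_2f^{*}(\zeta)|=1$ at some $\zeta\in\partial\mathbb{D}$. More precisely: (i) if $f$ is not a halfplane mapping, a sector mapping or a parallel strip mapping, then $|a_2f^{*}(\zeta)|=1$ holds at a unique point $\zeta\in\partial\mathbb{D}$, corresponding to the point at $\infty$ on $\partial f(\mathbb{D})$; (ii) if $f$ is a non-symmetric parallel strip mapping, there are exactly two solutions $\zeta\in\partial\mathbb{D}$ of $|a_2f^{*}(\zeta)|=1$, corresponding to each end of the strip at $\infty$; (iii) if $f$ is a sector mapping, there are exactly two solutions $\zeta\in\partial\mathbb{D}$ of $|a_2f^{*}(\zeta)|=1$, corresponding to the vertex and to the point at $\infty$; (iv) if $f$ is a halfplane mapping, the equation $|a_2f^{*}(\zeta)|=1$ holds on the entire unit circle.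
   Context: $\mathbb{D}$ is the open unit disk in $\mathbb{C}$. A conformal map $f$ of $\mathbb{D}$ onto a convex domain extends to a map $\overline{\mathbb{D}}\to\hat{\mathbb{C}}=\mathbb{C}\cup\{\infty\}$ that is continuous in the spherical metric; $f(\zeta)$ for $\zeta\in\partial\mathbb{D}$ denotes the value of this extension, and $f^{*}(\zeta)=f(\zeta)/(1+a_2f(\zeta))$ with $f^{*}(\zeta)=1/a_2$ when $f(\zeta)=\infty$. A solution $\zeta$ ''corresponds'' to a boundary point of $f(\mathbb{D})$ if $f(\zeta)$ is that point (for the strip, the two ends are the two points $\zeta$ with $f(\zeta)=\infty$). A halfplane, sector, or parallel strip mapping is one for which $f(\mathbb{D})$ is, respectively, a halfplane, an infinite convex sector (a region bounded by two rays from a common finite vertex, with opening angle in $(0,\pi)$), or a region between two parallel lines. A parallel strip mapping is non-symmetric if $f(0)$ does not lie on the axis of symmetry of the strip; equivalently, if $a_2\neq0$. *)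

(* Defs.v *)
From HB Require Import structures.
From mathcomp Require Import all_boot all_order all_algebra.
From mathcomp Require Import complex.
From mathcomp Require Import all_classical all_reals all_analysis.
Set Implicit Arguments.
Unset Strict Implicit.
Unset Printing Implicit Defensive.
Import Order.TTheory GRing.Theory Num.Theory.
Import numFieldNormedType.Exports.
Local Open Scope classical_set_scope.
Local Open Scope ring_scope.
Local Open Scope complex_scope.

(* The complex plane as a normed space over itself, so that [derivable _ z 1]
   and [derive1] are complex differentiability and the complex derivative. *)
Notation CC R := ((R[i])^o).

(* The one-point compactification carries the topology of the spherical metric;
   finite points are [Some w] and the point at infinity is [None]. *)
Notation sphere R := (one_point_compactification (CC R)).

Section Definitions.
Variable R : realType.
Implicit Types (f : CC R -> CC R) (F : CC R -> sphere R) (A : set (CC R)).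

Definition disk : set (CC R) := [set z | `|z| < 1].

Definition closed_disk : set (CC R) := [set z | `|z| <= 1].

Definition circle : set (CC R) := [set z | `|z| = 1].

(* Maps are total functions; only their values on [disk] matter. *)
Definition conformal_on_disk f :=
  (forall z, disk z -> derivable f z 1) /\ {in disk &, injective f}.

(* Scalars of [convex_set] range over R[i], but 0 <= t <= 1 in R[i] forces t to
   be real, so this is ordinary convexity. *)
Definition unbounded_convex_domain A :=
  [/\ open A, A !=set0, convex_set (A : set (convex_lmodType (CC R)))
    & ~ bounded_set A].

Definition taylor2 f : CC R := derive1n 2 f 0 / 2.

Definition halfplane (c : CC R) (b : R) : set (CC R) :=
  [set w | b < complex.Re (c * w)].

Definition strip (c : CC R) (b1 b2 : R) : set (CC R) :=
  [set w | b1 < complex.Re (c * w) < b2].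

(* Vertex v, opening angle alpha; the bounding rays have arguments theta and
   theta + alpha. *)
Definition sector (v : CC R) (theta alpha : R) : set (CC R) :=
  [set w | exists r t : R, [/\ 0 < r, theta < t < theta + alpha
    & w = v + r%:C * (cos t +i* sin t)]].

Definition halfplane_mapping f :=
  exists (c : CC R) (b : R), c != 0 /\ f @` disk = halfplane c b.

Definition strip_mapping f :=
  exists (c : CC R) (b1 b2 : R),
    [/\ c != 0, b1 < b2 & f @` disk = strip c b1 b2].

(* The axis of symmetry of [strip c b1 b2] is the line Re (c w) = (b1+b2)/2. *)
Definition nonsymmetric_strip_mapping f :=
  exists (c : CC R) (b1 b2 : R),
    [/\ c != 0, b1 < b2, f @` disk = strip c b1 b2
      & complex.Re (c * f 0) != (b1 + b2) / 2].

Definition sector_mapping_with_vertex f (v : CC R) :=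
  exists theta alpha : R, 0 < alpha < pi /\ f @` disk = sector v theta alpha.

Definition sector_mapping f := exists v, sector_mapping_with_vertex f v.

(* Such an F is unique on [closed_disk]: [disk] is dense in [closed_disk] and
   the sphere is Hausdorff. *)
Definition spherical_extension f F :=
  {in disk, forall z, F z = Some (f z)} /\ {within closed_disk, continuous F}.

(* The value of w / (1 + a w), read as 1 / a at infinity.  At the pole
   1 + a w = 0 this takes the value 0, since x / 0 = 0. *)
Definition star (a : CC R) (w : sphere R) : CC R :=
  if w is Some u then u / (1 + a * u) else a^-1.

Definition unimodular_points f F : set (CC R) :=
  [set zeta | circle zeta /\ `|taylor2 f * star (taylor2 f) (F zeta)| = 1].

End Definitions.

Arguments disk {R}.
Arguments closed_disk {R}.
Arguments circle {R}.

(* Main.v *)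
Require Import Defs.
From mathcomp Require Import all_boot all_order all_algebra.
From mathcomp Require Import complex.
From mathcomp Require Import all_classical all_reals all_analysis.
From mathcomp Require Import ring lra zify.
Import Order.TTheory GRing.Theory Num.Theory.
Import numFieldNormedType.Exports.
Local Open Scope classical_set_scope.
Local Open Scope ring_scope.
Local Open Scope complex_scope.
Set Implicit Arguments.
Unset Strict Implicit.
Unset Printing Implicit Defensive.

(* With W = f(D), |a_2 f*| < 1 at w in W says 1 + 2 Re(a_2 w) > 0.  Let rho be
   the conformal radius of W, so rho(f z) = |f'(z)| (1 - |z|^2).  If
   h_t : D -> W is holomorphic with h_t(0) = t w and h_t'(0) = 1 + t kappa, the
   Schwarz-Pick inequality h_t'(0) <= rho(t w) = 1 + 2 t Re(a_2 w) + o(t) gives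
   kappa <= 2 Re(a_2 w).  By convexity h_t = (1 - t) f + t (f o phi) is allowed
   for every automorphism phi of D, and it yields 1 + 2 Re(a_2 w) >= rho(w) > 0.

   At a finite boundary point u, 1 + 2 Re(a_2 u) = 0 forces equality in the
   Schwarz-Pick inequality for (1 - t) f + t u, so this map is onto W and W is a
   cone with vertex u; conversely the vertex of a cone is critical, by taking
   both (1 - t) f + t v and (1 + t) f - t v.  An open convex cone in a halfplane
   is a halfplane or a sector.

   The remaining question is how many boundary points go to a given value p.  If
   zeta_1 and zeta_2 both do, a chord separating them is a crosscut on which F
   stays away from p, provided F is not p on a whole arc; so two points of W near
   zeta_1 and zeta_2 cannot be joined by a segment close to p.  At infinity such
   segments exist unless W contains a line, that is, unless W is a strip or a
   halfplane.

   Cauchy's theorem enters only through the mean value property, which is proved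
   by Goursat's subdivision of Riemann sums in logarithmic polar coordinates. *)

(** * Modulus and complex differentiability *)

(** The expansion of rho holds because f(z) = t w gives z = t w + o(t) and f'(z) = 1 + 2 a_2 z +
    o(z), while 1 - |z|^2 differs from 1 only to second order; differentiability of f' thus enters
    at 0 alone. It is extracted from a_2 != 0, since a derivative that fails to exist is 0 by
    convention.

    The obstacle is that a quotient such as f(z)/z is holomorphic only off its exceptional points.
    The maximum principle is therefore applied to the j-th power of the quotient times a fixed
    weight with double zeros there; the product is differentiable everywhere. The outcome is a
    Schwarz-Pick inequality for bounded holomorphic functions on the punctured disk, and from it a
    Lipschitz bound valid up to the puncture.

    That bound also shows f' != 0 for injective f: at a zero of f' the inverse would be bounded and
    holomorphic off one point, hence Lipschitz, whereas f' = 0 makes the inverse steeper than any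
    Lipschitz constant. *)

Section Modulus.
Variable R : realType.
Local Notation C := (CC R).
Implicit Types (z w : C) (x y e : R).

(** The norm of a complex number is itself an element of [R[i]]; the real-valued [modulus] puts all
    estimates in the ordered field [R], where [lra] and [nra] apply. *)
Definition modulus (z : C) : R := Normc.normc z.
Local Notation N := modulus.
Local Notation Re := complex.Re.
Local Notation Im := complex.Im.

Lemma normE z : `|z| = (N z)%:C.
Proof. by rewrite normc_def; case: z. Qed.

Lemma norm_ltE z x : (`|z| < x%:C) = (N z < x).
Proof. by rewrite normE ltcR. Qed.

Lemma norm_leE z x : (`|z| <= x%:C) = (N z <= x).
Proof. by rewrite normE lecR. Qed.

Lemma modulus_ge0 z : 0 <= N z.
Proof. by case: z => a b; rewrite /modulus /= sqrtr_ge0. Qed.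

Lemma modulus_sq z : N z ^+ 2 = Re z ^+ 2 + Im z ^+ 2.
Proof. by case: z => a b; rewrite /modulus /= sqr_sqrtr // addr_ge0 ?sqr_ge0. Qed.

Lemma modulusM z w : N (z * w) = N z * N w.
Proof. exact: Normc.normcM. Qed.

Lemma modulusV z : N z^-1 = (N z)^-1.
Proof. exact: Normc.normcV. Qed.

Lemma modulusN z : N (- z) = N z.
Proof. exact: normcN. Qed.

Lemma modulus0 : N 0 = 0.
Proof. exact: Normc.normc0. Qed.

Lemma modulus1 : N 1 = 1.
Proof. exact: Normc.normc1. Qed.

Lemma modulus_eq0 z : (N z == 0) = (z == 0).
Proof.
by apply/eqP/eqP => [/Normc.eq0_normc //|->]; exact: modulus0.
Qed.

Lemma modulus_gt0 z : (0 < N z) = (z != 0).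
Proof. by rewrite lt_def modulus_ge0 andbT modulus_eq0. Qed.

Lemma modulusX z n : N (z ^+ n) = N z ^+ n.
Proof. by elim: n => [|n ih]; rewrite ?expr0 ?modulus1 // !exprS modulusM ih. Qed.

Lemma modulusD z w : N (z + w) <= N z + N w.
Proof. exact: le_normcD. Qed.

Lemma modulus_distC z w : N (z - w) = N (w - z).
Proof. by rewrite -modulusN opprB. Qed.

Lemma modulusB z w : N (z - w) <= N z + N w.
Proof. by rewrite -(modulusN w) modulusD. Qed.

Lemma modulus_tri (u z w : C) : N (z - w) <= N (z - u) + N (u - w).
Proof. by rewrite -{1}(subrK u z) -addrA modulusD. Qed.

Lemma modulusBr z w : N z - N w <= N (z - w).
Proof. by rewrite lerBlDr -{1}(subrK w z) modulusD. Qed.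

Lemma modulusDr z w : N z - N w <= N (z + w).
Proof. by rewrite -{2}(opprK w) -(modulusN w) modulusBr. Qed.

Lemma modulus_real x : N x%:C = `|x|.
Proof. by rewrite /modulus /= expr0n addr0 sqrtr_sqr. Qed.

Lemma modulus_posreal x : 0 <= x -> N x%:C = x.
Proof. by move=> x0; rewrite modulus_real ger0_norm. Qed.

Lemma modulus_conj z : N z^* = N z.
Proof. by case: z => a b; rewrite /modulus /= sqrrN. Qed.

Lemma mul_conj z : z * z^* = (N z ^+ 2)%:C :> C.
Proof.
by rewrite modulus_sq; case: z => a b; apply/eqP; rewrite eq_complex /=;
  apply/andP; split; apply/eqP; ring.
Qed.

Lemma Re_le_modulus z : Re z <= N z.
Proof.
rewrite (le_trans (ler_norm _)) // -(@ler_pXn2r _ 2) ?nnegrE ?modulus_ge0 //.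
by rewrite modulus_sq -normrX ger0_norm ?sqr_ge0 // lerDl sqr_ge0.
Qed.

Lemma Im_le_modulus z : Im z <= N z.
Proof.
rewrite (le_trans (ler_norm _)) // -(@ler_pXn2r _ 2) ?nnegrE ?modulus_ge0 //.
by rewrite modulus_sq -normrX ger0_norm ?sqr_ge0 // lerDr sqr_ge0.
Qed.

Lemma normRe_le_modulus z : `|Re z| <= N z.
Proof.
rewrite ler_norml Re_le_modulus andbT lerNl -(modulusN z).
by case: z => a b; exact: Re_le_modulus (- (a +i* b)).
Qed.

Lemma normIm_le_modulus z : `|Im z| <= N z.
Proof.
rewrite ler_norml Im_le_modulus andbT lerNl -(modulusN z).
by case: z => a b; exact: Im_le_modulus (- (a +i* b)).
Qed.

Lemma modulus_le_ReIm z : N z <= `|Re z| + `|Im z|.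
Proof.
rewrite -(@ler_pXn2r _ 2) ?nnegrE ?modulus_ge0 ?addr_ge0 //.
rewrite modulus_sq sqrrD !real_normK ?num_real // lerD2r lerDl.
by rewrite mulrn_wge0 // mulr_ge0.
Qed.

Lemma complexP z w :
  Re z = Re w -> Im z = Im w -> z = w.
Proof. by case: z w => a b [c d] /= -> ->. Qed.

Lemma ReD z w : Re (z + w) = Re z + Re w.
Proof. by case: z w => a b [c d]. Qed.

Lemma ReN z : Re (- z) = - Re z.
Proof. by case: z. Qed.

Lemma ReB z w : Re (z - w) = Re z - Re w.
Proof. by rewrite ReD ReN. Qed.

Lemma ReZ x z : Re (x%:C * z) = x * Re z.
Proof. by case: z => a b /=; rewrite mul0r subr0. Qed.

Lemma realC_nat n : (n%:R : R)%:C = n%:R :> C.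
Proof. exact: (rmorph_nat (real_complex R) n). Qed.

Lemma realCD x y : (x + y)%:C = x%:C + y%:C :> C.
Proof. exact: (rmorphD (real_complex R)). Qed.

Lemma realCM x y : (x * y)%:C = x%:C * y%:C :> C.
Proof. exact: (rmorphM (real_complex R)). Qed.

Lemma realCN x : (- x)%:C = - x%:C :> C.
Proof. exact: (rmorphN (real_complex R)). Qed.

Lemma realCB x y : (x - y)%:C = x%:C - y%:C :> C.
Proof. exact: (rmorphB (real_complex R)). Qed.

Lemma realCV x : (x^-1)%:C = x%:C^-1 :> C.
Proof. exact: (fmorphV (real_complex R)). Qed.

Lemma half_gt0 x : 0 < x -> 0 < x / 2.
Proof. by move=> x0; rewrite divr_gt0. Qed.

Lemma diskE z : disk z <-> N z < 1.
Proof. by rewrite /disk /= -[1]/(1%:C) norm_ltE. Qed.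

Lemma closed_diskE z : closed_disk z <-> N z <= 1.
Proof. by rewrite /closed_disk /= -[1]/(1%:C) norm_leE. Qed.

Lemma circleE z : circle z <-> N z = 1.
Proof. by rewrite /circle /= normE; split => [[]|->]. Qed.

Lemma nbhs_modulusP z (A : set C) :
  nbhs z A <-> exists2 e, 0 < e & forall w, N (w - z) < e -> A w.
Proof.
split.
  move/nbhs_normP => [[a b] /=]; rewrite ltcE /= => /andP[/eqP b0 a0] h.
  exists a => // w wz; apply: h => /=.
  by move: b0 => ->; rewrite distrC complexr0 norm_ltE.
case=> e e0 h; apply/(@nbhs_normP _ (CC R)); exists (e%:C) => /=; first by rewrite ltcR.
by move=> w /=; rewrite distrC norm_ltE; exact: h.
Qed.

Definition ccont (f : C -> C) z :=
  forall e, 0 < e -> exists2 d, 0 < d & forall w, N (w - z) < d -> N (f w - f z) < e.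

Lemma open_modulusP (A : set C) :
  open A <-> forall z, A z -> exists2 e, 0 < e & forall w, N (w - z) < e -> A w.
Proof.
rewrite openE; split=> h z Az; first by apply/nbhs_modulusP; exact: h.
by apply/nbhs_modulusP; exact: h.
Qed.

Lemma open_disk : forall z, N z < 1 -> exists2 e, 0 < e & forall w, N (w - z) < e -> N w < 1.
Proof.
move=> z z1; exists (1 - N z); first by rewrite subr_gt0.
by move=> w wz; have := modulusD (w - z) z; rewrite subrK; lra.
Qed.

End Modulus.

(** * Calculus of complex derivatives at a point *)

Section Differentiability.
Variable R : realType.
Local Notation C := (CC R).
Local Notation N := (@modulus R).
Implicit Types (f g phi : C -> C) (z w l : C).

Lemma ccont_cst (c z : C) : ccont (fun=> c) z.
Proof. by move=> e e0; exists 1 => // w _; rewrite subrr modulus0. Qed.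

Lemma ccont_id z : ccont (fun w => w) z.
Proof. by move=> e e0; exists e. Qed.

Lemma ccontD f g z : ccont f z -> ccont g z -> ccont (fun w => f w + g w) z.
Proof.
move=> cf cg e e0; have [d1 d10 h1] := cf _ (half_gt0 e0).
have [d2 d20 h2] := cg _ (half_gt0 e0).
exists (Num.min d1 d2); first by rewrite lt_min d10.
move=> w; rewrite lt_min => /andP[/h1 a1 /h2 a2].
have -> : f w + g w - (f z + g z) = (f w - f z) + (g w - g z) by ring.
by have := modulusD (f w - f z) (g w - g z); lra.
Qed.

Lemma ccontN f z : ccont f z -> ccont (fun w => - f w) z.
Proof.
move=> cf e /cf[d d0 h]; exists d => // w /h.
by rewrite -opprD modulusN.
Qed.

Lemma ccontM f g z : ccont f z -> ccont g z -> ccont (fun w => f w * g w) z.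
Proof.
move=> cf cg e e0.
pose K := N (f z) + N (g z) + 1.
have f0 := modulus_ge0 (f z); have g0 := modulus_ge0 (g z).
have K0 : 0 < K by rewrite /K; lra.
have eK : 0 < Num.min 1 (e / (2 * K)) by rewrite lt_min ltr01 divr_gt0 // mulr_gt0.
have [d1 d10 h1] := cf _ eK.
have [d2 d20 h2] := cg _ (half_gt0 (divr_gt0 e0 K0)).
exists (Num.min d1 d2); first by rewrite lt_min d10.
move=> w; rewrite lt_min => /andP[/h1 a1 /h2 a2].
move: a1; rewrite lt_min => /andP[a1 a1'].
have -> : f w * g w - f z * g z = (f w - f z) * g z + f w * (g w - g z) by ring.
apply: (le_lt_trans (modulusD _ _)); rewrite !modulusM.
have fw : N (f w) <= K by have := modulusD (f w - f z) (f z); rewrite subrK /K; lra.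
have b1 : N (f w - f z) * N (g z) <= e / 2.
  have gK : N (g z) <= K by rewrite /K; lra.
  have := ler_pM (modulus_ge0 _) g0 (ltW a1') gK.
  have -> : e / (2 * K) * K = e / 2 by field; rewrite gt_eqF.
  by [].
have b2 : N (f w) * N (g w - g z) <= K * N (g w - g z).
  by rewrite ler_wpM2r ?modulus_ge0.
have b3 : K * N (g w - g z) < e / 2.
  rewrite -ltr_pdivlMl // (lt_le_trans a2) // le_eqVlt; apply/orP; left.
  by apply/eqP; field; rewrite gt_eqF.
lra.
Qed.

Lemma ccontV f z : f z != 0 -> ccont f z -> ccont (fun w => (f w)^-1) z.
Proof.
move=> fz0 cf e e0; have F0 : 0 < N (f z) by rewrite modulus_gt0.
have e1 : 0 < Num.min (N (f z) / 2) (e * N (f z) ^+ 2 / 2).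
  by rewrite lt_min half_gt0 //= half_gt0 // mulr_gt0 // exprn_gt0.
have [d d0 h] := cf _ e1; exists d => // w /h; rewrite lt_min => /andP[a1 a2].
have fw : N (f z) / 2 < N (f w).
  by have := modulusBr (f z) (f w); rewrite modulus_distC; lra.
have fw0 : f w != 0 by rewrite -modulus_gt0; lra.
have -> : (f w)^-1 - (f z)^-1 = - (f w - f z) / (f w * f z).
  by field; rewrite ?fw0 ?fz0.
rewrite modulusM modulusV modulusN modulusM ltr_pdivrMr ?mulr_gt0 //; last by lra.
rewrite (lt_le_trans a2) // -mulrA ler_pM2l // expr2.
by nra.
Qed.

Lemma ccont_comp f g z : ccont f z -> ccont g (f z) -> ccont (fun w => g (f w)) z.
Proof.
move=> cf cg e /cg[d d0 h]; have [d' d'0 h'] := cf _ d0.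
by exists d' => // w /h' /h.
Qed.

(* Caratheodory's form of complex differentiability: no division and no
   exclusion of the point itself. *)
Definition has_derivative f z l :=
  exists2 phi, ccont phi z & phi z = l /\
    forall w, f w = f z + phi w * (w - z).

(** Differentiability at one point only. Holomorphy on a set is assumed pointwise, with no
    continuity of the derivative, which is the setting of Goursat's argument. *)
Definition holo_at f z := exists l, has_derivative f z l.

Lemma has_derivative_cont f z l : has_derivative f z l -> ccont f z.
Proof.
case=> phi cphi [_ fE].
have -> : f = (fun w => f z + phi w * (w - z)) by apply: funext.
apply: ccontD; first exact: ccont_cst.
apply: ccontM => //; apply: ccontD; first exact: ccont_id.
exact: ccont_cst.
Qed.

Lemma holo_cont f z : holo_at f z -> ccont f z.
Proof. by case=> l /has_derivative_cont. Qed.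

Lemma has_derivativeP f z l : has_derivative f z l <->
  forall e : R, 0 < e -> exists2 d, 0 < d &
    forall w, N (w - z) < d -> N (f w - f z - l * (w - z)) <= e * N (w - z).
Proof.
split=> [[phi cphi [<- fE]] e e0|h].
  have [d d0 hd] := cphi e e0; exists d => // w wz.
  have -> : f w - f z - phi z * (w - z) = (phi w - phi z) * (w - z).
    by rewrite (fE w); ring.
  by rewrite modulusM ler_wpM2r ?modulus_ge0 // ltW // hd.
exists (fun w => if w == z then l else (f w - f z) / (w - z)); last first.
  rewrite eqxx; split=> // w; case: eqVneq => [->|wz]; first by rewrite subrr mulr0 addr0.
  by rewrite mulfVK ?subr_eq0 // addrC subrK.
move=> e e0; have [d d0 hd] := h (e / 2) (half_gt0 e0).
exists d => // w wz /=; rewrite eqxx; have [_|nwz] := eqVneq w z.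
  by rewrite subrr modulus0.
have wz0 : w - z != 0 by rewrite subr_eq0.
have -> : (f w - f z) / (w - z) - l = (f w - f z - l * (w - z)) / (w - z).
  by field.
rewrite modulusM modulusV ltr_pdivrMr ?modulus_gt0 //.
rewrite (le_lt_trans (hd w wz)) // ltr_pM2r ?modulus_gt0 //.
by rewrite ltr_pdivrMr // mulr_natr mulr2n ltrDl.
Qed.

Lemma has_derivative_near f g z l (e : R) : 0 < e ->
  (forall w, N (w - z) < e -> f w = g w) ->
  has_derivative f z l -> has_derivative g z l.
Proof.
move=> e0 fg /has_derivativeP h; apply/has_derivativeP => e1 e10.
have [d d0 hd] := h e1 e10; exists (Num.min d e); first by rewrite lt_min d0.
move=> w; rewrite lt_min => /andP[wd we]; rewrite -!fg //; first exact: hd.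
by rewrite subrr modulus0.
Qed.

Lemma has_derivative_unique f z l1 l2 :
  has_derivative f z l1 -> has_derivative f z l2 -> l1 = l2.
Proof.
move=> /has_derivativeP h1 /has_derivativeP h2; apply/eqP; rewrite -subr_eq0.
rewrite -modulus_eq0; apply/eqP/le_anti; rewrite modulus_ge0 andbT.
apply/ler_addgt0Pl => e e0; rewrite addr0.
have [d1 d10 H1] := h1 (e / 2) (half_gt0 e0).
have [d2 d20 H2] := h2 (e / 2) (half_gt0 e0).
pose d := Num.min d1 d2 / 2.
have d0 : 0 < d by rewrite divr_gt0 // lt_min d10 d20.
have dd : d < Num.min d1 d2 by rewrite /d in d0 *; lra.
move: dd; rewrite lt_min => /andP[dd1 dd2].
have E : z + d%:C - z = d%:C by rewrite addrC addKr.
have ND : N d%:C = d by rewrite modulus_posreal // ltW.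
have := H1 (z + d%:C); rewrite E ND => /(_ dd1) A1.
have := H2 (z + d%:C); rewrite E ND => /(_ dd2) A2.
have := modulusB (f (z + d%:C) - f z - l2 * d%:C) (f (z + d%:C) - f z - l1 * d%:C).
have -> : f (z + d%:C) - f z - l2 * d%:C - (f (z + d%:C) - f z - l1 * d%:C) =
  (l1 - l2) * d%:C by ring.
rewrite modulusM ND => H; rewrite -(ler_pM2r d0); apply: (le_trans H); lra.
Qed.

Lemma derivable_has_derivative f z :
  derivable f z 1 -> has_derivative f z (derive1 f z).
Proof.
move=> df; apply/has_derivativeP => e e0; rewrite derive1E.
have hD : nbhs ('D_1 f z : C) [set w : C | N (w - 'D_1 f z) <= e].
  by apply/nbhs_modulusP; exists e => // w /ltW.
have /nbhs_modulusP[d d0 hd] := df _ hD; exists d => // w wz.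
have [->|nwz] := eqVneq w z; first by rewrite !subrr mulr0 subr0 modulus0 mulr0.
have wz0 : w - z != 0 by rewrite subr_eq0.
have := hd (w - z); rewrite subr0 => /(_ wz wz0) /=.
rewrite /shift /= [(w - z) *: 1]mulr1 subrK => H.
have -> : f w - f z - 'D_1 f z * (w - z) = ((w - z)^-1 * (f w - f z) - 'D_1 f z) * (w - z).
  by field.
by rewrite modulusM ler_wpM2r ?modulus_ge0.
Qed.

Lemma has_derivative_cst (c z : C) : has_derivative (fun=> c) z 0.
Proof.
exists (fun=> 0); first exact: ccont_cst.
by split=> // w; rewrite mul0r addr0.
Qed.

Lemma has_derivative_id z : has_derivative id z 1.
Proof.
exists (fun=> 1); first exact: ccont_cst.
by split=> // w; rewrite mul1r addrC subrK.
Qed.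

Lemma has_derivativeD f g z l1 l2 : has_derivative f z l1 ->
  has_derivative g z l2 -> has_derivative (fun w => f w + g w) z (l1 + l2).
Proof.
move=> [p cp [<- pE]] [q cq [<- qE]]; exists (fun w => p w + q w); first exact: ccontD.
by split=> // w; rewrite pE qE; ring.
Qed.

Lemma has_derivativeM f g z l1 l2 : has_derivative f z l1 ->
  has_derivative g z l2 -> has_derivative (fun w => f w * g w) z (l1 * g z + f z * l2).
Proof.
move=> hf hg; have cg := has_derivative_cont hg.
case: hf hg => [p cp [<- pE]] [q cq [<- qE]].
exists (fun w => p w * g w + f z * q w).
  by apply: ccontD; apply: ccontM => //; exact: ccont_cst.
by split=> // w; rewrite (pE w) (qE w); ring.
Qed.

Lemma has_derivativeV f z l : f z != 0 -> has_derivative f z l ->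
  has_derivative (fun w => (f w)^-1) z (- l / f z ^+ 2).
Proof.
move=> fz0 hf; have cf := has_derivative_cont hf.
have F0 : 0 < N (f z) by rewrite modulus_gt0.
have [d d0 hd] := cf _ F0.
case: hf => [p cp [pl pE]].
have nz w : N (w - z) < d -> f w != 0.
  move=> /hd; apply: contraTneq => ->; rewrite sub0r modulusN; lra.
(* The factor [- p w / (f w * f z)] does not satisfy the global identity of [has_derivative] where
   [f] vanishes. These points are away from [z]; [g] is redefined there so that a simple factor
   works everywhere. *)
pose g w := if f w == 0 then (f z)^-1 - p w / f z ^+ 2 * (w - z) else (f w)^-1.
apply: (@has_derivative_near g _ _ _ d) => // [w /nz|].
  by rewrite /g => /negbTE ->.
exists (fun w => if f w == 0 then - p w / f z ^+ 2 else - p w / (f w * f z)); last first.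
  rewrite (negbTE fz0) pl; split; first by rewrite expr2.
  move=> w; rewrite /g (negbTE fz0); case: eqVneq => [fw0|fw0]; first by ring.
  rewrite (pE w) in fw0 *; field; by rewrite ?fw0 ?fz0.
have c1 : ccont (fun w => - p w / (f w * f z)) z.
  apply: ccontM; first exact: ccontN.
  apply: ccontV; first by rewrite mulf_neq0.
  by apply: ccontM; [done|exact: ccont_cst].
move=> e e0.
have [d1 d10 h1] := c1 e e0; exists (Num.min d d1); first by rewrite lt_min d0.
move=> w; rewrite lt_min => /andP[/nz/negbTE -> w1]; rewrite (negbTE fz0).
exact: h1.
Qed.

Lemma has_derivative_comp f g z l1 l2 : has_derivative f z l1 ->
  has_derivative g (f z) l2 -> has_derivative (fun w => g (f w)) z (l2 * l1).
Proof.
move=> hf; have cf := has_derivative_cont hf.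
case: hf => [p cp [<- pE]] [q cq [<- qE]].
exists (fun w => q (f w) * p w).
  by apply: ccontM => //; exact: ccont_comp.
by split=> // w; rewrite (qE (f w)) {2}(pE w); ring.
Qed.

Lemma holo_cst (c z : C) : holo_at (fun=> c) z.
Proof. by exists 0; exact: has_derivative_cst. Qed.

Lemma holo_id z : holo_at (fun w => w) z.
Proof. by exists 1; exact: has_derivative_id. Qed.

Lemma holoD f g z : holo_at f z -> holo_at g z -> holo_at (fun w => f w + g w) z.
Proof. by move=> [l h] [l' h']; eexists; exact: has_derivativeD h h'. Qed.

Lemma holoM f g z : holo_at f z -> holo_at g z -> holo_at (fun w => f w * g w) z.
Proof. by move=> [l h] [l' h']; eexists; exact: has_derivativeM h h'. Qed.

Lemma holoN f z : holo_at f z -> holo_at (fun w => - f w) z.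
Proof.
move=> h; have := holoM (holo_cst (-1) z) h.
by rewrite (_ : (fun w => -1 * f w) = (fun w => - f w)) //; apply: funext => w; rewrite mulN1r.
Qed.

Lemma holoB f g z : holo_at f z -> holo_at g z -> holo_at (fun w => f w - g w) z.
Proof. by move=> hf hg; apply: holoD => //; exact: holoN. Qed.

Lemma holoV f z : f z != 0 -> holo_at f z -> holo_at (fun w => (f w)^-1) z.
Proof. by move=> fz [l h]; eexists; exact: has_derivativeV h. Qed.

Lemma holo_div f g z : g z != 0 -> holo_at f z -> holo_at g z -> holo_at (fun w => f w / g w) z.
Proof. by move=> gz hf hg; apply: holoM => //; exact: holoV. Qed.

Lemma holoX f z n : holo_at f z -> holo_at (fun w => f w ^+ n) z.
Proof.
move=> hf; elim: n => [|n ih]; first exact: holo_cst.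
rewrite (_ : (fun w => f w ^+ n.+1) = (fun w => f w * f w ^+ n)); first exact: holoM.
by apply: funext => w; rewrite exprS.
Qed.

Lemma holo_comp f g z : holo_at f z -> holo_at g (f z) -> holo_at (fun w => g (f w)) z.
Proof. by move=> [l h] [l' h']; eexists; exact: has_derivative_comp h h'. Qed.

End Differentiability.

(** * Goursat's subdivision argument *)

Section Goursat.
Variable R : realType.
Local Notation C := (CC R).
Local Notation N := (@modulus R).

Lemma modulus_sum n (u : 'I_n -> C) (M : R) :
  (forall k, N (u k) <= M) -> N (\sum_(k < n) u k) <= n%:R * M.
Proof.
move=> h; have : N (\sum_(k < n) u k) <= \sum_(k < n) M.
  elim/big_ind2 : _ => // [|x1 x2 y1 y2 h1 h2]; first by rewrite modulus0.
  by rewrite (le_trans (modulusD _ _)) // lerD.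
by rewrite sumr_const card_ord mulr_natl.
Qed.

(* Left Riemann sums over the boundary of the [L] by [L] block with corner
   [(i, j)] in a grid with steps [p] and [q]. *)
Definition boundary_sum (p q : C) (u : nat -> nat -> C) (i j L : nat) : C :=
  p * (\sum_(k < L) u (i + k)%N j - \sum_(k < L) u (i + k)%N (j + L)%N) +
  q * (\sum_(k < L) u (i + L)%N (j + k)%N - \sum_(k < L) u i (j + k)%N).

(** Each interior side is shared by two quarter blocks with opposite orientations and cancels. *)
Lemma boundary_sum_split p q u i j L :
  boundary_sum p q u i j (L + L) =
  boundary_sum p q u i j L + boundary_sum p q u (i + L) j L +
  boundary_sum p q u i (j + L) L + boundary_sum p q u (i + L) (j + L) L.
Proof.
rewrite /boundary_sum !big_split_ord /=.
under [X in _ - (_ + X)]eq_bigr do rewrite addnA.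
under [X in p * (_ + X - _)]eq_bigr do rewrite addnA.
under [X in q * (_ + X - _)]eq_bigr do rewrite (addnA j).
under [X in q * (_ - (_ + X))]eq_bigr do rewrite addnA.
rewrite !addnA; ring.
Qed.

(** On an affine function the left Riemann sums cancel exactly: opposite sides differ by the
    constants [l * q * L] and [l * p * L], which enter with opposite signs. So only the deviation
    from the affine function counts, and there is no discretization error. *)
Lemma boundary_sum_affine (p q : C) (u : nat -> nat -> C) (i j L : nat) (A l : C) (M : R) :
  (forall x y, (i <= x <= i + L)%N -> (j <= y <= j + L)%N ->
     N (u x y - (A + l * (p * x%:R + q * y%:R))) <= M) ->
  N (boundary_sum p q u i j L) <= L%:R * (N p + N q) * (2 * M).
Proof.
move=> h; pose v x y := u x y - (A + l * (p * x%:R + q * y%:R)).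
have -> : boundary_sum p q u i j L =
    p * (\sum_(k < L) (v (i + k)%N j - v (i + k)%N (j + L)%N)) +
    q * (\sum_(k < L) (v (i + L)%N (j + k)%N - v i (j + k)%N)).
  have E1 : \sum_(k < L) (v (i + k)%N j - v (i + k)%N (j + L)%N) =
      \sum_(k < L) u (i + k)%N j - \sum_(k < L) u (i + k)%N (j + L)%N + l * q * L%:R * L%:R.
    have -> : l * q * L%:R * L%:R = \sum_(k < L) (l * q * L%:R) :> C.
      by rewrite sumr_const card_ord -[RHS]mulr_natr.
    rewrite -sumrB -big_split /=; apply: eq_bigr => k _; rewrite /v !natrD; ring.
  have E2 : \sum_(k < L) (v (i + L)%N (j + k)%N - v i (j + k)%N) =
      \sum_(k < L) u (i + L)%N (j + k)%N - \sum_(k < L) u i (j + k)%N - l * p * L%:R * L%:R.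
    have -> : l * p * L%:R * L%:R = \sum_(k < L) (l * p * L%:R) :> C.
      by rewrite sumr_const card_ord -[RHS]mulr_natr.
    rewrite -!sumrB; apply: eq_bigr => k _; rewrite /v !natrD; ring.
  rewrite E1 E2 /boundary_sum; ring.
rewrite (le_trans (modulusD _ _)) // !modulusM mulrDr mulrDl.
have vM x y : (i <= x <= i + L)%N -> (j <= y <= j + L)%N -> N (v x y) <= M by exact: h.
have b1 : N (\sum_(k < L) (v (i + k)%N j - v (i + k)%N (j + L)%N)) <= L%:R * (2 * M).
  apply: modulus_sum => k; rewrite (le_trans (modulusB _ _)) // mulr_natl mulr2n.
  by have := ltn_ord k; move=> kL; rewrite lerD // vM //; lia.
have b2 : N (\sum_(k < L) (v (i + L)%N (j + k)%N - v i (j + k)%N)) <= L%:R * (2 * M).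
  apply: modulus_sum => k; rewrite (le_trans (modulusB _ _)) // mulr_natl mulr2n.
  by have := ltn_ord k; move=> kL; rewrite lerD // vM //; lia.
rewrite lerD //.
  by rewrite [L%:R * _]mulrC -mulrA ler_wpM2l ?modulus_ge0.
by rewrite [L%:R * _]mulrC -mulrA ler_wpM2l ?modulus_ge0.
Qed.

(** The hypothesis says that the closed dyadic interval of level [m.+1] is a half of that of level
    [m]; the supremum of the left ends lies in all of them. *)
Lemma nested_dyadic (i : nat -> nat) :
  (forall m, (2 * i m <= i m.+1 <= (2 * i m).+1)%N) ->
  exists x : R, forall m, (i m)%:R / 2 ^+ m <= x <= (i m).+1%:R / 2 ^+ m.
Proof.
move=> hi; have p2 m : 0 < 2 ^+ m :> R by rewrite exprn_gt0.
have up m n : (i m)%:R / 2 ^+ m <= (i (m + n)%N)%:R / 2 ^+ (m + n) :> R.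
  elim: n => [|n ih]; first by rewrite addn0.
  rewrite (le_trans ih) // addnS exprS invfM mulrA ler_pM2r ?invr_gt0 //.
  rewrite ler_pdivlMr // -natrM ler_nat; have := hi (m + n)%N; lia.
have down m n : (i (m + n)%N).+1%:R / 2 ^+ (m + n) <= (i m).+1%:R / 2 ^+ m :> R.
  elim: n => [|n ih]; first by rewrite addn0.
  rewrite (le_trans _ ih) // addnS exprS invfM mulrA ler_pM2r ?invr_gt0 //.
  rewrite ler_pdivrMr // -natrM ler_nat; have := hi (m + n)%N; lia.
have cross m n : (i m)%:R / 2 ^+ m <= (i n).+1%:R / 2 ^+ n :> R.
  have [mn|/ltnW nm] := leqP m n.
    rewrite (le_trans (up m (n - m)%N)) // subnKC // ler_pM2r ?invr_gt0 //.
    by rewrite ler_nat.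
  rewrite (le_trans _ (down n (m - n)%N)) // subnKC // ler_pM2r ?invr_gt0 //.
  by rewrite ler_nat.
pose S : set R := [set x | exists m, x = (i m)%:R / 2 ^+ m].
have S0 : has_sup S.
  split; first by exists ((i 0%N)%:R / 2 ^+ 0), 0%N.
  by exists ((i 0%N).+1%:R / 2 ^+ 0) => _ [m ->]; exact: cross.
exists (sup S) => m; apply/andP; split.
  by apply: ub_le_sup; [exact: S0.2|exists m].
by apply: ge_sup; [exact: S0.1|move=> _ [n ->]; exact: cross].
Qed.

(** Complex differentiability in the variable [s +i* t], in real coordinates adapted to a
    rectangle. *)
Definition planar_diff (g : R -> R -> C) s0 t0 := exists l : C, forall e, 0 < e ->
  exists2 d, 0 < d & forall s t, `|s - s0| < d -> `|t - t0| < d ->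
    N (g s t - g s0 t0 - l * ((s - s0) +i* (t - t0))) <= e * (`|s - s0| + `|t - t0|).

Section Rectangle.
Variables (g : R -> R -> C) (a c wx wy : R).
Hypothesis wx0 : 0 < wx.
Hypothesis wy0 : 0 < wy.
Hypothesis gdiff : forall s t, a <= s <= a + wx -> c <= t <= c + wy -> planar_diff g s t.

Definition grid n (i j : nat) : C := g (a + wx * (i%:R / 2 ^+ n)) (c + wy * (j%:R / 2 ^+ n)).

Definition cell_sum n (i j L : nat) : C :=
  boundary_sum (wx / 2 ^+ n)%:C (0 +i* (wy / 2 ^+ n)) (grid n) i j L.

(** The subrectangle [(i, j)] of level [m] is bad if its Riemann sums are large on arbitrarily fine
    grids [n]. This stands in for a large contour integral, the convergence of the sums being
    unknown. *)
Let bad (delta : R) m i j := forall n0, exists n, [/\ (n0 <= n)%N, (m <= n)%N &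
  delta / 4 ^+ m <= N (cell_sum n (i * 2 ^ (n - m)) (j * 2 ^ (n - m)) (2 ^ (n - m)))].

(** If the four quarters were good beyond [n1], ..., [n4], then on any finer grid their sums would
    add up to less than [4 * (delta / 4 ^+ m.+1)]. *)
Lemma bad_child delta m i j : bad delta m i j -> exists i' j',
  [/\ (2 * i <= i' <= (2 * i).+1)%N, (2 * j <= j' <= (2 * j).+1)%N & bad delta m.+1 i' j'].
Proof.
move=> hbad; apply: contrapT => none.
have nb i' j' : (2 * i <= i' <= (2 * i).+1)%N -> (2 * j <= j' <= (2 * j).+1)%N ->
    exists n0, forall n, (n0 <= n)%N -> (m.+1 <= n)%N ->
    N (cell_sum n (i' * 2 ^ (n - m.+1)) (j' * 2 ^ (n - m.+1)) (2 ^ (n - m.+1))) < delta / 4 ^+ m.+1.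
  move=> hi hj; apply: contrapT => hn; apply: none; exists i', j'; split => // n0.
  apply: contrapT => hn0; apply: hn; exists n0 => n n0n mn.
  by rewrite ltNge; apply/negP => le; apply: hn0; exists n.
have [| |n1 h1] := nb (2 * i)%N (2 * j)%N; [lia..|].
have [| |n2 h2] := nb (2 * i).+1 (2 * j)%N; [lia..|].
have [| |n3 h3] := nb (2 * i)%N (2 * j).+1; [lia..|].
have [| |n4 h4] := nb (2 * i).+1 (2 * j).+1; [lia..|].
have [n [n0n mn]] := hbad (n1 + n2 + n3 + n4 + m.+1)%N.
have [e1 e2 e3 e4 e5] : [/\ n1 <= n, n2 <= n, n3 <= n, n4 <= n & m.+1 <= n]%N by split; lia.
move: (h1 n e1 e5) (h2 n e2 e5) (h3 n e3 e5) (h4 n e4 e5).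
set L := (2 ^ (n - m.+1))%N => b1 b2 b3 b4.
have LE : (2 ^ (n - m) = L + L)%N by rewrite /L addnn -mul2n -expnS; congr (_ ^ _)%N; lia.
rewrite leNgt => /negP; apply.
rewrite LE /cell_sum boundary_sum_split -/(cell_sum _ _ _ _).
have -> : (i * (L + L) = 2 * i * L)%N by lia.
have -> : (j * (L + L) = 2 * j * L)%N by lia.
have -> : (2 * i * L + L = (2 * i).+1 * L)%N by lia.
have -> : (2 * j * L + L = (2 * j).+1 * L)%N by lia.
rewrite (le_lt_trans (modulusD _ _)) //.
have T := modulusD (cell_sum n (2 * i * L) (2 * j * L) L) (cell_sum n ((2 * i).+1 * L) (2 * j * L) L).
have T' := modulusD (cell_sum n (2 * i * L) (2 * j * L) L +
  cell_sum n ((2 * i).+1 * L) (2 * j * L) L) (cell_sum n (2 * i * L) ((2 * j).+1 * L) L).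
have E : delta / 4 ^+ m = 4 * (delta / 4 ^+ m.+1).
  by rewrite exprS; field; rewrite expf_neq0.
rewrite E; move: T T' b1 b2 b3 b4; rewrite -/(cell_sum _ _ _ _); lra.
Qed.

(** A large sum produces nested bad subrectangles shrinking to a point; differentiability at that
    point makes [g] nearly affine on them and their sums too small. *)
Lemma goursat_rectangle delta : 0 < delta ->
  exists n0, forall n, (n0 <= n)%N -> N (cell_sum n 0 0 (2 ^ n)) < delta.
Proof.
move=> d0; apply: contrapT => none.
have bad0 : bad delta 0 0 0.
  move=> n0; apply: contrapT => h; apply: none; exists n0 => n n0n.
  rewrite ltNge; apply/negP => le; apply: h; exists n; split => //.
  by rewrite subn0 !mul0n expr0 divr1.
pose T := {x : nat * nat * nat | bad delta x.1.1 x.1.2 x.2}.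
have step (x : T) : {y : T | [/\ (sval y).1.1 = (sval x).1.1.+1,
    (2 * (sval x).1.2 <= (sval y).1.2 <= (2 * (sval x).1.2).+1)%N &
    (2 * (sval x).2 <= (sval y).2 <= (2 * (sval x).2).+1)%N]}.
  apply: cid; case: x => [[[m i] j] /= hb].
  have [i' [j' [hi hj hb']]] := bad_child hb.
  by exists (exist (fun x : nat * nat * nat => bad delta x.1.1 x.1.2 x.2) (m.+1, i', j') hb').
pose st0 : T := exist (fun x : nat * nat * nat => bad delta x.1.1 x.1.2 x.2) (0, 0, 0)%N bad0.
pose st m := iter m (fun x => sval (step x)) st0.
pose i m := (sval (st m)).1.2; pose j m := (sval (st m)).2.
have stm m : (sval (st m)).1.1 = m.
  by elim: m => // m ih; rewrite /st /= -/(st m); case: (step _) => y [/= -> _ _]; rewrite ih.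
have badm m : bad delta m (i m) (j m).
  by rewrite -{1}(stm m) /i /j; case: (st m).
have hi m : (2 * i m <= i m.+1 <= (2 * i m).+1)%N.
  by rewrite /i /st /= -/(st m); case: (step _) => y [].
have hj m : (2 * j m <= j m.+1 <= (2 * j m).+1)%N.
  by rewrite /j /st /= -/(st m); case: (step _) => y [].
have [x hx] := nested_dyadic hi; have [y hy] := nested_dyadic hj.
have x01 : a <= a + wx * x <= a + wx.
  have := hx 0%N; rewrite /i /= expr0 !divr1 => /andP[x0 x1].
  by rewrite lerDl lerD2l -{3}(mulr1 wx) ler_pM2l // x1 mulr_ge0 // ltW.
have y01 : c <= c + wy * y <= c + wy.
  have := hy 0%N; rewrite /j /= expr0 !divr1 => /andP[y0 y1].
  by rewrite lerDl lerD2l -{3}(mulr1 wy) ler_pM2l // y1 mulr_ge0 // ltW.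
have [l hl] := gdiff x01 y01.
pose w := wx + wy; have w0 : 0 < w by rewrite addr_gt0.
(* With this error rate the affine estimate is [2 * e * w ^+ 2 / 4 ^+ m], that is half of the
   threshold [delta / 4 ^+ m]. *)
have e0 : 0 < delta / (4 * w ^+ 2) by rewrite divr_gt0 // mulr_gt0 // exprn_gt0.
have [d dp hd] := hl _ e0.
have [m hm] : exists m, w / 2 ^+ m < d.
  exists (Num.bound (w / d)).
  rewrite ltr_pdivrMr ?exprn_gt0 // mulrC -ltr_pdivrMr //.
  have wd0 : 0 <= w / d by rewrite divr_ge0 // ltW.
  rewrite (lt_le_trans (archi_boundP wd0)) // -natrX ler_nat.
  exact/ltnW/ltn_expl.
have p2 k : 0 < 2 ^+ k :> R by rewrite exprn_gt0.
have [n [_ mn]] := badm m 0%N.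
set L := (2 ^ (n - m))%N; rewrite leNgt => /negP; apply.
have Ln : L%:R / 2 ^+ n = 1 / 2 ^+ m :> R.
  have -> : 2 ^+ n = L%:R * 2 ^+ m :> R by rewrite natrX -exprD subnK.
  by field; rewrite !gt_eqF // ltr0n expn_gt0.
have close (z : R) (v : nat) (k : nat) : v%:R / 2 ^+ m <= z <= v.+1%:R / 2 ^+ m ->
    (v * L <= k <= v * L + L)%N -> `|k%:R / 2 ^+ n - z| <= 1 / 2 ^+ m.
  move=> /andP[z1 z2] /andP[k1 k2].
  have E v' : v'%:R / 2 ^+ m = (v' * L)%:R / 2 ^+ n :> R.
    by rewrite natrM -mulrA Ln mul1r.
  have f1 : v%:R / 2 ^+ m <= k%:R / 2 ^+ n :> R.
    by rewrite E ler_pM2r ?invr_gt0 // ler_nat.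
  have f2 : k%:R / 2 ^+ n <= v.+1%:R / 2 ^+ m :> R.
    by rewrite E ler_pM2r ?invr_gt0 // ler_nat mulSn addnC.
  rewrite ler_norml; move: z1 z2 f1 f2; rewrite -(natr1 v) mulrDl.
  by clear => z1 z2 f1 f2; apply/andP; split; lra.
pose A := g (a + wx * x) (c + wy * y) - l * ((wx * x) +i* (wy * y)).
pose e := delta / (4 * w ^+ 2).
have B := @boundary_sum_affine (wx / 2 ^+ n)%:C (0 +i* (wy / 2 ^+ n)) (grid n)
  (i m * L) (j m * L) L A l (e * (w / 2 ^+ m)).
rewrite /cell_sum; apply: le_lt_trans (B _) _.
  move=> k1 k2 hk1 hk2.
  have c1 := close _ _ _ (hx m) hk1; have c2 := close _ _ _ (hy m) hk2.
  rewrite /grid; set s := a + _; set t := c + _.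
  have b1 : `|s - (a + wx * x)| <= wx / 2 ^+ m.
    rewrite /s (_ : _ - _ = wx * (k1%:R / 2 ^+ n - x)); last by ring.
    by rewrite normrM gtr0_norm // ler_pM2l // (le_trans c1) // div1r.
  have b2 : `|t - (c + wy * y)| <= wy / 2 ^+ m.
    rewrite /t (_ : _ - _ = wy * (k2%:R / 2 ^+ n - y)); last by ring.
    by rewrite normrM gtr0_norm // ler_pM2l // (le_trans c2) // div1r.
  have bw : wx / 2 ^+ m + wy / 2 ^+ m = w / 2 ^+ m by rewrite -mulrDl.
  have q1 : 0 < wx / 2 ^+ m by rewrite divr_gt0.
  have q2 : 0 < wy / 2 ^+ m by rewrite divr_gt0.
  have := hd s t; rewrite (le_lt_trans b1) ?(le_lt_trans b2); [|by clear -q1 q2 bw hm; lra..].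
  move=> /(_ isT isT) H.
  have -> : A + l * ((wx / 2 ^+ n)%:C * k1%:R + (0 +i* (wy / 2 ^+ n)) * k2%:R) =
    g (a + wx * x) (c + wy * y) + l * ((s - (a + wx * x)) +i* (t - (c + wy * y))).
    have -> : ((wx / 2 ^+ n)%:C : C) * k1%:R = (wx / 2 ^+ n * k1%:R)%:C.
      by rewrite [RHS]realCM realC_nat.
    have -> : (0 +i* (wy / 2 ^+ n) : C) * k2%:R = 0 +i* (wy / 2 ^+ n * k2%:R).
      have -> : k2%:R = (k2%:R)%:C :> C by rewrite realC_nat.
      by apply: complexP => /=; ring.
    have -> : (s - (a + wx * x)) +i* (t - (c + wy * y)) = (wx / 2 ^+ n * k1%:R)%:C +
        (0 +i* (wy / 2 ^+ n * k2%:R)) - ((wx * x) +i* (wy * y)) :> C.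
      by apply: complexP; rewrite /s /t /=; ring.
    by rewrite /A; ring.
  rewrite opprD addrA (le_trans H) // ler_pM2l // -bw lerD //.
rewrite modulus_posreal ?divr_ge0 ?ltW //.
have -> : N (0 +i* (wy / 2 ^+ n)) = wy / 2 ^+ n.
  by rewrite /modulus /= expr0n add0r sqrtr_sqr ger0_norm // divr_ge0 // ltW.
have -> : L%:R * (wx / 2 ^+ n + wy / 2 ^+ n) = w * (L%:R / 2 ^+ n) by rewrite /w; ring.
rewrite Ln /e.
have -> : w * (1 / 2 ^+ m) * (2 * (delta / (4 * w ^+ 2) * (w / 2 ^+ m))) = delta / 2 / 4 ^+ m.
  have -> : 4 ^+ m = 2 ^+ m * 2 ^+ m :> R by rewrite -exprMn; congr (_ ^+ _); ring.
  by field; rewrite !gt_eqF.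
by rewrite ltr_pM2r ?invr_gt0 ?exprn_gt0 // ltr_pdivrMr // ltr_pMr // ltr1n.
Qed.

End Rectangle.
End Goursat.

(** * The maximum principle *)

Section CircleMeans.
Variable R : realType.
Local Notation C := (CC R).
Local Notation N := (@modulus R).
Implicit Types (s t r : R).

Lemma is_derive_eps (f : R -> R) (x l : R) : is_derive x 1 f l ->
  forall e, 0 < e -> exists2 d, 0 < d &
    forall h, `|h| < d -> `|f (x + h) - f x - l * h| <= e * `|h|.
Proof.
move=> [df <-] e e0.
have hD : nbhs ('D_1 f x : R) [set w : R | `|'D_1 f x - w| < e].
  by apply/nbhs_normP; exists e.
have /nbhs_normP[d /= d0 hd] := df _ hD; exists d => // h hh.
have [->|h0] := eqVneq h 0; first by rewrite addr0 mulr0 subr0 subrr normr0 mulr0.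
have := hd h; rewrite /= sub0r normrN => /(_ hh h0) /ltW.
rewrite /shift /= [h *: 1]mulr1 [h + x]addrC => H.
have -> : f (x + h) - f x - 'D_1 f x * h = - ('D_1 f x - h^-1 * (f (x + h) - f x)) * h.
  by field.
by rewrite normrM normrN ler_wpM2r.
Qed.

Definition cis t : C := cos t +i* sin t.

Lemma modulus_cis t : N (cis t) = 1.
Proof. by rewrite /modulus /= cos2Dsin2 sqrtr1. Qed.

Lemma cisD s t : cis (s + t) = cis s * cis t.
Proof. by apply: complexP; rewrite /= ?cosD ?sinD //; ring. Qed.

(** The complex exponential of [s +i* t]. *)
Definition polar s t : C := (expR s)%:C * cis t.

Lemma modulus_polar s t : N (polar s t) = expR s.
Proof. by rewrite modulusM modulus_cis mulr1 modulus_posreal // expR_ge0. Qed.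

Lemma polarD s t s' t' : polar (s + s') (t + t') = polar s t * polar s' t'.
Proof. by rewrite /polar cisD expRD realCM; ring. Qed.

Lemma polar_diff0 e : 0 < e -> exists2 d, 0 < d & forall s t, `|s| < d -> `|t| < d ->
  N (polar s t - 1 - (s +i* t)) <= e * (`|s| + `|t|).
Proof.
move=> e0; have e1 : 0 < Num.min (e / 4) (1 / 2) by rewrite lt_min divr_gt0 //= divr_gt0.
have [d1 d10 h1] := is_derive_eps (is_derive_expR 0) e1.
have [d2 d20 h2] := is_derive_eps (is_derive_cos 0) e1.
have [d3 d30 h3] := is_derive_eps (is_derive_sin 0) e1.
have e2 : 0 < Num.min (e / 8) (1 / 2) by rewrite lt_min divr_gt0 //= divr_gt0.
exists (Num.min (Num.min d1 d2) (Num.min d3 (Num.min (e / 8) (1 / 2)))).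
  by rewrite !lt_min d10 d20 d30 /= divr_gt0 //= divr_gt0.
move=> s t; rewrite !lt_min => /andP[/andP[s1 s2] /andP[s3 /andP[s4 s5]]].
move=> /andP[/andP[t1 t2] /andP[t3 /andP[t4 t5]]].
have := h1 s s1; rewrite add0r expR0 mul1r.
have := h2 t t2; rewrite add0r cos0 sin0 oppr0 mul0r subr0.
have := h3 t t3; rewrite add0r sin0 cos0 mul1r subr0.
have m1 : Num.min (e / 4) (1 / 2) <= e / 4 by rewrite ge_min lexx.
have m2 : Num.min (e / 4) (1 / 2) <= 1 / 2 by rewrite ge_min lexx orbT.
set m := Num.min _ _ in e1 m1 m2 *; clearbody m.
move=> H3 H2 H1.
have s0 := normr_ge0 s; have t0 := normr_ge0 t.
have -> : polar s t - 1 - (s +i* t) =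
   (expR s - 1 - s)%:C * cis t + s%:C * (cis t - 1) + (cis t - 1 - (0 +i* t)).
  have -> : s +i* t = s%:C + (0 +i* t) :> C by apply: complexP; rewrite /= ?addr0 ?add0r.
  rewrite /polar !realCB; ring.
have B1 : N (cis t - 1 - (0 +i* t)) <= 2 * m * `|t|.
  rewrite (le_trans (modulus_le_ReIm _)) //= !subr0; clear -H2 H3; lra.
have B2 : N (cis t - 1) <= 4 * `|t|.
  rewrite (le_trans (modulus_le_ReIm _)) //= !subr0.
  have : `|sin t| <= `|sin t - t| + `|t| by rewrite -{1}(subrK t (sin t)) ler_normD.
  have : m * `|t| <= 1 / 2 * `|t| by rewrite ler_wpM2r.
  by clear -H2 H3 m2 t0; lra.
have B3 : N ((expR s - 1 - s)%:C * cis t) <= m * `|s|.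
  by rewrite modulusM modulus_cis mulr1 modulus_real.
have B4 : N (s%:C * (cis t - 1)) <= (e / 8) * (4 * `|t|).
  by rewrite modulusM modulus_real ler_pM ?modulus_ge0 // ltW.
have B5 := modulusD ((expR s - 1 - s)%:C * cis t + s%:C * (cis t - 1)) (cis t - 1 - (0 +i* t)).
have B6 := modulusD ((expR s - 1 - s)%:C * cis t) (s%:C * (cis t - 1)).
have B7 : m * `|t| <= e / 4 * `|t| by rewrite ler_wpM2r.
have B8 : m * `|s| <= e / 4 * `|s| by rewrite ler_wpM2r.
have B9 : 0 <= e * `|s| by rewrite mulr_ge0 // ltW.
have B10 : 0 <= e * `|t| by rewrite mulr_ge0 // ltW.
by clear -B1 B2 B3 B4 B5 B6 B7 B8 B9 B10; lra.
Qed.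

Lemma planar_diff_polar (f : C -> C) s0 t0 :
  holo_at f (polar s0 t0) -> planar_diff (fun s t => f (polar s t)) s0 t0.
Proof.
case=> l /has_derivativeP hf; set P := polar s0 t0 in hf *.
(* The exponential is its own derivative, so the chain rule gives [l * P]. *)
exists (l * P) => e e0.
have P0 := modulus_ge0 P; have l0 := modulus_ge0 l.
pose K := 2 * N P + N l * N P + 1.
have K0 : 0 < K by rewrite /K; nra.
have eK : 0 < e / K by rewrite divr_gt0.
have [d1 d10 h1] := hf _ eK.
have m0 : 0 < Num.min 1 (e / K) by rewrite lt_min ltr01.
have [d2 d20 h2] := polar_diff0 m0.
exists (Num.min d2 (d1 / (4 * (N P + 1)))).
  by rewrite lt_min d20 divr_gt0 // mulr_gt0 // ltr_wpDl.
move=> s t; rewrite !lt_min => /andP[s1 s2] /andP[t1 t2].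
set ds := s - s0; set dt := t - t0; rewrite -/ds -/dt in s1 s2 t1 t2.
have := h2 ds dt s1 t1; set m := Num.min _ _ in m0 *.
have m1 : m <= 1 by rewrite ge_min lexx.
have m2 : m <= e / K by rewrite ge_min lexx orbT.
have E : polar s t = P * polar ds dt by rewrite -polarD /ds /dt ![_ + (_ - _)]addrC !subrK.
set u := `|ds| + `|dt| => H.
have u0 : 0 <= u by rewrite addr_ge0.
have Nst : N (ds +i* dt) <= u by rewrite (le_trans (modulus_le_ReIm _)).
have A1 : N (polar s t - P) <= N P * (2 * u).
  have -> : polar s t - P = P * ((polar ds dt - 1 - (ds +i* dt)) + (ds +i* dt)).
    by rewrite E; ring.
  rewrite modulusM ler_wpM2l // (le_trans (modulusD _ _)) //.
  have : m * u <= 1 * u by rewrite ler_wpM2r.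
  lra.
have A2 : N (polar s t - P) < d1.
  rewrite (le_lt_trans A1) //.
  have : u < 2 * (d1 / (4 * (N P + 1))) by rewrite /u; lra.
  rewrite (_ : 2 * (d1 / (4 * (N P + 1))) = d1 / (2 * (N P + 1))); last first.
    by field; rewrite gt_eqF // ltr_wpDl.
  rewrite ltr_pdivlMr ?mulr_gt0 ?ltr_wpDl // => ?; nra.
have := h1 _ A2 => A3.
have -> : f (polar s t) - f P - l * P * (ds +i* dt) =
  (f (polar s t) - f P - l * (polar s t - P)) + l * P * (polar ds dt - 1 - (ds +i* dt)).
  by rewrite E; ring.
rewrite (le_trans (modulusD _ _)) // (modulusM (l * P)) (modulusM l).
have A4 : e / K * N (polar s t - P) <= e / K * (N P * (2 * u)) by rewrite ler_wpM2l // ltW.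
have A5 : N l * N P * N (polar ds dt - 1 - (ds +i* dt)) <= N l * N P * (e / K * u).
  rewrite ler_wpM2l ?mulr_ge0 // (le_trans H) // ler_wpM2r //.
have -> : e * u = e / K * (K * u) by field; rewrite gt_eqF.
apply: (le_trans (lerD (le_trans A3 A4) A5)).
have : 0 <= e / K * u by rewrite mulr_ge0 // ltW.
rewrite /K; lra.
Qed.

Definition circle_sum (f : C -> C) n r : C :=
  \sum_(k < 2 ^ n) f (r%:C * cis (2 * pi * (k%:R / 2 ^+ n))).

(** In logarithmic polar coordinates the annulus is a rectangle of height [2 * pi]. By periodicity
    the two radial sides cancel, and the remaining two sides are the Riemann sums over the two
    circles. *)
Lemma circle_sum_annulus (f : C -> C) (r0 r1 : R) : 0 < r0 -> r0 < r1 ->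
  (forall z, r0 <= N z <= r1 -> holo_at f z) ->
  forall e, 0 < e -> exists n0, forall n, (n0 <= n)%N ->
    N (circle_sum f n r1 - circle_sum f n r0) <= e * 2 ^+ n.
Proof.
move=> r00 r01 hf e e0; have r10 : 0 < r1 by exact: lt_trans r01.
have wx0 : 0 < ln r1 - ln r0 by rewrite subr_gt0 ltr_ln.
have wy0 : 0 < 2 * pi :> R by rewrite mulr_gt0 // pi_gt0.
have gd s t : ln r0 <= s <= ln r0 + (ln r1 - ln r0) -> 0 <= t <= 0 + 2 * pi ->
    planar_diff (fun s t => f (polar s t)) s t.
  move=> /andP[s1 s2] _; apply: planar_diff_polar; apply: hf.
  rewrite modulus_polar; apply/andP; split.
    by rewrite -(lnK r00) ler_expR.
  by rewrite -(lnK r10) ler_expR (le_trans s2) // addrC subrK.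
have [n0 h] := goursat_rectangle wx0 wy0 gd (mulr_gt0 wy0 e0).
exists n0 => n /h; rewrite /cell_sum /boundary_sum.
have p2 : 2 ^+ n != 0 :> R by rewrite expf_neq0.
have gridE i j : grid (fun s t => f (polar s t)) (ln r0) 0 (ln r1 - ln r0) (2 * pi) n i j =
   f (polar (ln r0 + (ln r1 - ln r0) * (i%:R / 2 ^+ n)) (2 * pi * (j%:R / 2 ^+ n))).
  by rewrite /grid add0r.
have per i : grid (fun s t => f (polar s t)) (ln r0) 0 (ln r1 - ln r0) (2 * pi) n i (0 + 2 ^ n) =
   grid (fun s t => f (polar s t)) (ln r0) 0 (ln r1 - ln r0) (2 * pi) n i 0.
  rewrite !gridE add0n natrX divff // mulr1 mul0r mulr0 /polar; congr (f (_ * _)).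
  by rewrite /cis mulr_natl cos2pi sin2pi cos0 sin0.
under [X in _ * (_ - X) + _]eq_bigr do rewrite per.
rewrite subrr mulr0 add0r.
have -> : \sum_(k < 2 ^ n) grid (fun s t => f (polar s t)) (ln r0) 0 (ln r1 - ln r0) (2 * pi) n
   (0 + 2 ^ n) (0 + k) = circle_sum f n r1.
  apply: eq_bigr => k _; rewrite gridE !add0n natrX divff // mulr1.
  by rewrite addrC subrK /polar lnK.
have -> : \sum_(k < 2 ^ n) grid (fun s t => f (polar s t)) (ln r0) 0 (ln r1 - ln r0) (2 * pi) n
   0 (0 + k) = circle_sum f n r0.
  apply: eq_bigr => k _; rewrite gridE add0n mul0r mulr0 addr0.
  by rewrite /polar lnK.
rewrite modulusM.
have -> : N (0 +i* (2 * pi / 2 ^+ n)) = 2 * pi / 2 ^+ n.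
  have q0 : 0 <= 2 * pi / 2 ^+ n :> R by rewrite divr_ge0 ?exprn_ge0 // ltW.
  by rewrite /modulus /= expr0n add0r sqrtr_sqr ger0_norm.
move=> H; apply/ltW; rewrite mulrC -ltr_pdivrMl ?exprn_gt0 // -(ltr_pM2l wy0).
by rewrite mulrA.
Qed.

(** The mean over the circle of radius [r] is nearly the mean over a tiny circle, which is nearly
    [f 0] by continuity. Differentiability is asked off the centre only. *)
Lemma max_modulus_center (f : C -> C) (r M : R) : 0 < r ->
  (forall z, 0 < N z <= r -> holo_at f z) -> ccont f 0 ->
  (forall z, N z = r -> N (f z) <= M) -> N (f 0) <= M.
Proof.
move=> r0 hf c0 hM; apply/ler_addgt0Pl => e e0.
have [d d0 hd] := c0 _ (half_gt0 e0).
pose s := Num.min (d / 2) (r / 2).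
have s0 : 0 < s by rewrite lt_min !half_gt0.
have sd : s < d by rewrite gt_min; apply/orP; left; lra.
have sr : s < r by rewrite gt_min; apply/orP; right; lra.
have hol z : s <= N z <= r -> holo_at f z.
  by move=> /andP[z1 z2]; apply: hf; rewrite z2 andbT (lt_le_trans s0).
have [n0 h] := circle_sum_annulus s0 sr hol (half_gt0 e0).
have := h n0 (leqnn _); set S1 := circle_sum f n0 r; set S0 := circle_sum f n0 s => H.
have p2 : 0 < 2 ^+ n0 :> R by rewrite exprn_gt0.
have B1 : N S1 <= 2 ^+ n0 * M.
  rewrite -natrX; apply: modulus_sum => k; apply: hM.
  by rewrite modulusM modulus_cis mulr1 modulus_posreal // ltW.
have B0 : N (S0 - 2 ^+ n0 * f 0) <= 2 ^+ n0 * (e / 2).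
  have -> : S0 - 2 ^+ n0 * f 0 =
      \sum_(k < 2 ^ n0) (f (s%:C * cis (2 * pi * (k%:R / 2 ^+ n0))) - f 0).
    by rewrite sumrB sumr_const card_ord -natrX mulr_natl.
  rewrite -natrX; apply: modulus_sum => k; apply/ltW/hd.
  by rewrite subr0 modulusM modulus_cis mulr1 modulus_posreal // ltW.
rewrite -(ler_pM2l p2).
have -> : 2 ^+ n0 * N (f 0) = N (2 ^+ n0 * f 0).
  by rewrite modulusM modulusX -[2]/(2%:R) -realC_nat modulus_posreal.
have -> : 2 ^+ n0 * f 0 = S1 - (S1 - S0) - (S0 - 2 ^+ n0 * f 0) by ring.
have := modulusB (S1 - (S1 - S0)) (S0 - 2 ^+ n0 * f 0).
have := modulusB S1 (S1 - S0).
lra.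
Qed.

End CircleMeans.

(** * Schwarz-Pick inequalities *)

Section SchwarzPick.
Variable R : realType.
Local Notation C := (CC R).
Local Notation N := (@modulus R).
Implicit Types (f F : C -> C) (z w : C).

Lemma pseudohyperbolic_identity (a z : C) :
  N (1 + a^* * z) ^+ 2 = N (z + a) ^+ 2 + (1 - N a ^+ 2) * (1 - N z ^+ 2).
Proof. by rewrite !modulus_sq; case: a z => a b [c d] /=; ring. Qed.

Lemma modulusB_le_pseudo (a z : C) : N a <= 1 -> N z <= 1 -> N (z - a) <= N (1 - a^* * z).
Proof.
move=> a1 z1; rewrite -(@ler_pXn2r _ 2) ?nnegrE ?modulus_ge0 //.
have -> : 1 - a^* * z = 1 + (- a)^* * z by rewrite rmorphN mulNr.
rewrite pseudohyperbolic_identity lerDl modulusN.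
by apply: mulr_ge0; rewrite subr_ge0 exprn_ile1 ?modulus_ge0.
Qed.

Lemma one_add_conj_neq0 (a z : C) : N a < 1 -> N z <= 1 -> 1 + a^* * z != 0.
Proof.
move=> a1 z1; rewrite -modulus_gt0 (lt_le_trans _ (modulusDr _ _)) //.
rewrite modulus1 modulusM modulus_conj subr_gt0.
by rewrite (le_lt_trans (ler_piMr _ z1)) ?modulus_ge0.
Qed.

(** The disk automorphism sending 0 to [a]; its inverse is [mobius (- a)]. *)
Definition mobius (a z : C) : C := (z + a) / (1 + a^* * z).

Lemma mobius_id (a z : C) : N a < 1 -> N z <= 1 ->
  1 - N (mobius a z) ^+ 2 = (1 - N a ^+ 2) * (1 - N z ^+ 2) / N (1 + a^* * z) ^+ 2.
Proof.
move=> a1 z1; have nz := one_add_conj_neq0 a1 z1.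
rewrite /mobius modulusM modulusV exprMn exprVn.
have -> : N (z + a) ^+ 2 = N (1 + a^* * z) ^+ 2 - (1 - N a ^+ 2) * (1 - N z ^+ 2).
  by rewrite pseudohyperbolic_identity addrK.
by field; rewrite modulus_eq0.
Qed.

Lemma mobius_lt1 (a z : C) : N a < 1 -> N z < 1 -> N (mobius a z) < 1.
Proof.
move=> a1 z1; have nz := one_add_conj_neq0 a1 (ltW z1).
rewrite -(@ltr_pXn2r _ 2) ?nnegrE ?modulus_ge0 ?ler01 // expr1n -subr_gt0.
rewrite mobius_id ?ltW // divr_gt0 ?exprn_gt0 ?modulus_gt0 //.
by apply: mulr_gt0; rewrite subr_gt0 exprn_ilt1 ?modulus_ge0.
Qed.

Lemma holo_mobius (a z : C) : N a < 1 -> N z <= 1 -> holo_at (mobius a) z.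
Proof.
move=> a1 z1; apply: holo_div; first exact: one_add_conj_neq0.
  by apply: holoD; [exact: holo_id|exact: holo_cst].
apply: holoD; first exact: holo_cst.
by apply: holoM; [exact: holo_cst|exact: holo_id].
Qed.

Lemma mobius0 (a : C) : mobius a 0 = a.
Proof. by rewrite /mobius mulr0 addr0 add0r divr1. Qed.

Lemma mobiusK (a z : C) : N a < 1 -> N z < 1 -> mobius a (mobius (- a) z) = z.
Proof.
move=> a1 z1.
have n1 : 1 + (- a)^* * z != 0 by apply: one_add_conj_neq0; rewrite ?modulusN // ltW.
have n2' : 1 - a^* * a != 0 :> C.
  by rewrite -mulNr -rmorphN one_add_conj_neq0 ?modulusN // ltW.
rewrite /mobius; move: n1; rewrite rmorphN /= => n1.
have -> : (z - a) / (1 + - a^* * z) + a = z * (1 - a^* * a) / (1 + - a^* * z) by field.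
have -> : 1 + a^* * ((z - a) / (1 + - a^* * z)) = (1 - a^* * a) / (1 + - a^* * z) by field.
by field; rewrite n1 n2'.
Qed.

(** Lets a bound near the unit circle be used at an arbitrary centre: after composition with
    [mobius a], a circle about 0 still runs close to the unit circle. *)
Lemma mobius_near_circle (a : C) (s : R) : N a < 1 -> s < 1 ->
  exists2 r, 0 < r < 1 & forall z, N z = r -> s < N (mobius a z).
Proof.
move=> a1 s1; have a0 := modulus_ge0 a.
pose m := (1 - N a) ^+ 2; have m0 : 0 < m by rewrite /m exprn_gt0 // subr_gt0.
pose t := Num.max s 0; have t1 : t < 1 by rewrite /t gt_max s1 ltr01.
have t0 : 0 <= t by rewrite /t le_max lexx orbT.
have st : s <= t by rewrite /t le_max lexx.
(* On [N z = 1 - q] one gets [1 - N (mobius a z) ^+ 2 <= 2 * q / m <= (1 - t) / 2], where [m] bounds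
   the squared denominator from below. *)
pose q := Num.min (1 / 2) (m * (1 - t) / 4).
have q0 : 0 < q by rewrite /q lt_min divr_gt0 //= divr_gt0 // mulr_gt0 // subr_gt0.
have q2 : q <= 1 / 2 by rewrite /q ge_min lexx.
have q3 : q <= m * (1 - t) / 4 by rewrite /q ge_min lexx orbT.
exists (1 - q); first by lra.
move=> z zr; rewrite (le_lt_trans st) //.
have z1 : N z <= 1 by rewrite zr; lra.
rewrite -(@ltr_pXn2r _ 2) ?nnegrE ?modulus_ge0 //.
have := mobius_id a1 z1; set D := N (1 + _) => E.
have Dm : m <= D ^+ 2.
  rewrite /m ler_pXn2r ?nnegrE ?modulus_ge0 ?subr_ge0 ?(ltW a1) //.
  rewrite /D (le_trans _ (modulusDr _ _)) // modulus1 modulusM modulus_conj lerD2l lerN2.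
  by rewrite ler_piMr.
have D0 : 0 < D ^+ 2 by exact: lt_le_trans Dm.
have : (1 - N a ^+ 2) * (1 - N z ^+ 2) / D ^+ 2 <= 2 * q / m.
  rewrite ler_pdivrMr // mulrAC ler_pdivlMr //.
  have A1 : (1 - N a ^+ 2) * (1 - N z ^+ 2) <= 2 * q.
    have b1 : 1 - N a ^+ 2 <= 1 by rewrite gerBl sqr_ge0.
    have b2 : 1 - N z ^+ 2 <= 2 * q by rewrite zr; nra.
    have b3 : 0 <= 1 - N z ^+ 2 by rewrite zr; nra.
    by rewrite (le_trans _ b2) // ler_piMl.
  apply: ler_pM => //; last exact: ltW.
  by apply: mulr_ge0; rewrite subr_ge0 exprn_ile1 ?modulus_ge0 // ltW.
rewrite -E.
have : 2 * q / m <= (1 - t) / 2 by rewrite ler_pdivrMr //; lra.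
have : t ^+ 2 <= t by rewrite expr2 ler_piMr // ltW.
lra.
Qed.

(** If [a > b], then [(a / b) ^+ j] is unbounded by Bernoulli's inequality. *)
Lemma power_comparison (a b c K : R) : 0 <= a -> 0 < b -> 0 < c ->
  (forall j, a ^+ j * c <= b ^+ j * K) -> a <= b.
Proof.
move=> a0 b0 c0 h; rewrite leNgt; apply/negP => ba.
pose q := a / b; have q1 : 1 < q by rewrite /q ltr_pdivlMr // mul1r.
have bern j : 1 + j%:R * (q - 1) <= q ^+ j.
  elim: j => [|j ih]; first by rewrite mul0r addr0.
  rewrite exprS -natr1; have : q * (1 + j%:R * (q - 1)) <= q * q ^+ j.
    by rewrite ler_pM2l // (lt_trans ltr01).
  have : 0 <= j%:R * (q - 1) ^+ 2 by rewrite mulr_ge0 // sqr_ge0.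
  nra.
have qK j : q ^+ j <= K / c.
  by rewrite /q expr_div_n ler_pdivlMr // mulrAC ler_pdivrMr ?exprn_gt0 // [K * _]mulrC.
have Kc : 0 <= K / c by rewrite (le_trans _ (qK 0%N)).
have x0 : 0 <= K / c / (q - 1) by rewrite divr_ge0 // subr_ge0 ltW.
have := archi_boundP x0; rewrite ltr_pdivrMr ?subr_gt0 // => H.
have := bern (Num.bound (K / c / (q - 1))).
have := qK (Num.bound (K / c / (q - 1))).
lra.
Qed.

(* The zeros of the weight [p] absorb the exceptional points of [f]; applying
   the maximum principle to [f ^+ j * p] and letting [j] grow removes it. *)
Lemma max_modulus_weight f p (M K : R) : 0 <= M ->
  (forall j z, N z < 1 -> holo_at (fun w => f w ^+ j * p w) z) ->
  (forall z, N z < 1 -> N (p z) <= K) ->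
  (forall e, 0 < e -> exists2 s, s < 1 & forall z, s < N z < 1 -> N (f z) <= M + e) ->
  forall z, N z < 1 -> p z != 0 -> N (f z) <= M.
Proof.
move=> M0 hol pK bd z z1 pz; apply/ler_addgt0Pr => e e0.
have [s s1 hs] := bd e e0; have [r /andP[r0 r1] hr] := mobius_near_circle z1 s1.
have Me : 0 < M + e by lra.
apply: (@power_comparison _ _ (N (p z)) K); rewrite ?modulus_ge0 ?modulus_gt0 //.
move=> j; rewrite -modulusX -modulusM.
pose g w := f (mobius z w) ^+ j * p (mobius z w).
have gh w : N w < 1 -> holo_at g w.
  move=> w1; apply: (@holo_comp _ (mobius z) (fun w => f w ^+ j * p w)).
    by apply: holo_mobius => //; exact: ltW.
  by apply: hol; exact: mobius_lt1.
have := @max_modulus_center R g r ((M + e) ^+ j * K) r0.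
rewrite /g mobius0; apply.
- by move=> w /andP[_ wr]; apply: gh; exact: le_lt_trans wr r1.
- by apply: holo_cont; apply: gh; rewrite modulus0.
- move=> w wr; rewrite modulusM modulusX.
  have m1 : N (mobius z w) < 1 by apply: mobius_lt1; rewrite ?wr.
  rewrite ler_pM ?exprn_ge0 ?modulus_ge0 ?pK //.
  by rewrite lerXn2r ?nnegrE ?modulus_ge0 ?(ltW Me) // hs // hr.
Qed.

(** At an exceptional point the double zero of the weight forces value and derivative 0, whatever
    default value the quotient takes there. *)
Lemma holo_at_sq_bound f z (B d : R) : 0 < d ->
  (forall w, N (w - z) < d -> N (f w) <= B * N (w - z) ^+ 2) -> holo_at f z.
Proof.
move=> d0 h; exists 0; apply/has_derivativeP => e e0.
have fz : f z = 0.
  apply/eqP; rewrite -modulus_eq0; apply/eqP/le_anti; rewrite modulus_ge0 andbT.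
  by have := h z; rewrite subrr modulus0 expr0n mulr0; apply.
exists (Num.min d (e / (`|B| + 1))).
  by rewrite lt_min d0 divr_gt0 // ltr_wpDl.
move=> w; rewrite lt_min => /andP[wd we]; rewrite fz subr0 mul0r subr0.
rewrite (le_trans (h w wd)) // expr2 mulrA ler_wpM2r ?modulus_ge0 //.
rewrite ltr_pdivlMr ?ltr_wpDl // in we; rewrite (le_trans _ (ltW we)) // mulrC.
by rewrite ler_wpM2l ?modulus_ge0 // (le_trans (ler_norm _)) // lerDl.
Qed.

(** The claim is that the pseudohyperbolic difference quotient [f] below is at most 1. It is so in
    the limit at the unit circle, and the weighted maximum principle absorbs 0, where nothing is
    known of [F], and [z1], where [f] is 0/0. The bound [l < 1] keeps [1 - (F z1)^* * F w] away from
    0. *)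
Lemma schwarz_pick_strict F (l : R) z1 z : l < 1 ->
  (forall w, 0 < N w < 1 -> holo_at F w) ->
  (forall w, 0 < N w < 1 -> N (F w) <= l) ->
  0 < N z1 < 1 -> 0 < N z < 1 ->
  N (F z - F z1) * N (1 - z1^* * z) <= N (z - z1) * N (1 - (F z1)^* * F z).
Proof.
move=> l1 hol Fl z1d zd.
have [->|zz1] := eqVneq z z1; first by rewrite !subrr modulus0 !mul0r.
pose f w := (F w - F z1) * (1 - z1^* * w) / ((w - z1) * (1 - (F z1)^* * F w)).
(* Double zeros at the two exceptional points; on the disk this weight is at most [1 * 2 ^+ 2]. *)
pose p w := w ^+ 2 * (w - z1) ^+ 2.
have [z10 z11] := andP z1d; have [z0 z1'] := andP zd.
have l0 : 0 <= l by rewrite (le_trans _ (Fl _ zd)) ?modulus_ge0.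
have F1 w : 0 < N w < 1 -> N (F w) < 1 by move=> /Fl h; exact: le_lt_trans l1.
have conj w : 1 - (F z1)^* * w = 1 + (- F z1)^* * w by rewrite rmorphN mulNr.
have conj1 w : 1 - z1^* * w = 1 + (- z1)^* * w by rewrite rmorphN mulNr.
have den w : 0 < N w < 1 -> 1 - l <= N (1 - (F z1)^* * F w).
  move=> wd; rewrite (le_trans _ (modulusBr _ _)) // modulus1 modulusM modulus_conj.
  rewrite lerD2l lerN2 -[l]mul1r ler_pM ?modulus_ge0 ?Fl //.
  by rewrite ltW // F1.
have den0 w : 0 < N w < 1 -> 1 - (F z1)^* * F w != 0.
  by move=> /den h; rewrite -modulus_gt0 (lt_le_trans _ h) // subr_gt0.
have num w : N w < 1 -> N (1 - z1^* * w) <= 2.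
  move=> w1; rewrite (le_trans (modulusB _ _)) // modulus1 modulusM modulus_conj.
  have := modulus_ge0 w; nra.
have fle : N (f z) <= 1.
  apply: (@max_modulus_weight f p 1 4) => //; last first.
  - by rewrite /p mulf_neq0 ?expf_neq0 ?subr_eq0 // -modulus_gt0.
  - move=> e e0; pose m := (1 - N z1) / 2; have m0 : 0 < m by rewrite /m divr_gt0 // subr_gt0.
    (* The first bound keeps [w] at distance at least [m] from [z1]; the second makes
       [(1 - N z1 ^+ 2) * (1 - N w ^+ 2)] at most [2 * e * m ^+ 2], so that the automorphism factor
       is at most [1 + e]. *)
    exists (Num.max ((1 + N z1) / 2) (1 - e * m ^+ 2)).
      rewrite gt_max; apply/andP; split; first lra.
      by rewrite gtrBl mulr_gt0 // exprn_gt0.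
    move=> w; rewrite gt_max => /andP[/andP[w1 w2] w3].
    have wd : 0 < N w < 1 by apply/andP; split => //; lra.
    have wm : m <= N (w - z1).
      by rewrite (le_trans _ (modulusBr _ _)) // /m; lra.
    have wz0 : 0 < N (w - z1) by exact: lt_le_trans wm.
    have A1 : N (F w - F z1) <= N (1 - (F z1)^* * F w).
      by apply: modulusB_le_pseudo; apply: ltW; exact: F1.
    have A2 : N (1 - z1^* * w) <= (1 + e) * N (w - z1).
      rewrite -(@ler_pXn2r _ 2) ?nnegrE ?modulus_ge0 ?mulr_ge0 ?modulus_ge0 //; last by lra.
      rewrite conj1 pseudohyperbolic_identity modulusN.
      have c1 : (1 - N z1 ^+ 2) * (1 - N w ^+ 2) <= 2 * (1 - N w).
        have := modulus_ge0 w; have : 0 <= N z1 ^+ 2 <= 1.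
          by rewrite sqr_ge0 exprn_ile1 ?modulus_ge0 // ltW.
        move=> /andP[k1 k2] k3; have : 0 <= 1 - N w ^+ 2 <= 2 * (1 - N w) by clear -k3 w3; apply/andP; split; nra.
        by move=> /andP[k4 k5]; rewrite (le_trans _ k5) // ler_piMl //; lra.
      have c2 : m ^+ 2 <= N (w - z1) ^+ 2 by rewrite ler_pXn2r ?nnegrE ?modulus_ge0 ?(ltW m0).
      rewrite exprMn; have c3 : 0 <= e ^+ 2 * N (w - z1) ^+ 2 by rewrite mulr_ge0 // sqr_ge0.
      have c4 : e * m ^+ 2 <= e * N (w - z1) ^+ 2 by rewrite ler_pM2l.
      have -> : (1 + e) ^+ 2 * N (w - z1) ^+ 2 =
        N (w - z1) ^+ 2 + 2 * (e * N (w - z1) ^+ 2) + e ^+ 2 * N (w - z1) ^+ 2 by ring.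
      by clear -c1 c2 c3 c4 w2; lra.
    rewrite /f modulusM modulusV !modulusM ler_pdivrMr; last first.
      by rewrite mulr_gt0 // modulus_gt0 den0.
    rewrite mulrA [leRHS]mulrC ler_pM ?modulus_ge0 //.
  - move=> w w1; rewrite /p modulusM !modulusX.
    have b1 : N w ^+ 2 <= 1 by rewrite exprn_ile1 ?modulus_ge0 // ltW.
    have b2 : N (w - z1) <= 2 by rewrite (le_trans (modulusB _ _)) //; lra.
    have b3 : N (w - z1) ^+ 2 <= 2 ^+ 2 by rewrite lerXn2r ?nnegrE ?modulus_ge0.
    have -> : 4 = 1 * 2 ^+ 2 :> R by ring.
    by rewrite ler_pM ?sqr_ge0.
  move=> j w w1.
  have [->|w0] := eqVneq w 0.
    (* [X] bounds [f] within [N z1 / 2] of 0: numerator factors at most 2, denominator factors at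
       least [N z1 / 2] and [1 - l]. *)
    pose X := 2 * 2 / (N z1 / 2 * (1 - l)); pose B := X ^+ j * 4.
    apply: (@holo_at_sq_bound _ _ B (N z1 / 2)); first exact: half_gt0.
    move=> v; rewrite subr0 => vz; have [->|v0] := eqVneq v 0.
      by rewrite /p expr0n mul0r mulr0 modulus0 expr0n mulr0.
    have vd : 0 < N v < 1 by rewrite modulus_gt0 v0 /=; lra.
    have b1 : N (v - z1) <= 2 by rewrite (le_trans (modulusB _ _)) //; lra.
    have b2 : N (p v) <= 4 * N v ^+ 2.
      rewrite /p modulusM !modulusX mulrC ler_wpM2r ?sqr_ge0 //.
      have -> : 4 = 2 ^+ 2 :> R by ring.
      by rewrite lerXn2r ?nnegrE ?modulus_ge0.
    rewrite modulusM /B -mulrA; apply: ler_pM; rewrite ?modulus_ge0 //.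
    have X0 : 0 <= X.
      by rewrite /X divr_ge0 // mulr_ge0 ?subr_ge0 ?(ltW l1) // ltW // half_gt0.
    rewrite modulusX lerXn2r ?nnegrE ?modulus_ge0 //.
    rewrite /f modulusM modulusV !modulusM.
    have c1 : N (F v - F z1) <= 2.
      have := F1 v vd; have := F1 z1 z1d; have := modulusB (F v) (F z1); lra.
    have c2 : N z1 / 2 <= N (v - z1).
      have := modulusBr z1 v; rewrite (modulus_distC z1); lra.
    have c3 := den v vd; have c4 := num v (proj2 (andP vd)).
    rewrite /X ler_pM ?invr_ge0 ?mulr_ge0 ?modulus_ge0 ?ler_pM ?modulus_ge0 //.
    have c5 : 0 < N z1 / 2 * (1 - l) by rewrite mulr_gt0 ?half_gt0 ?subr_gt0.
    have c6 : N z1 / 2 * (1 - l) <= N (v - z1) * N (1 - (F z1)^* * F v).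
      by apply: ler_pM => //; [exact/ltW/half_gt0|rewrite subr_ge0 ltW].
    by rewrite lef_pV2 ?posrE // (lt_le_trans c5).
  have wd : 0 < N w < 1 by rewrite modulus_gt0 w0.
  have [wz|wz] := eqVneq w z1.
    rewrite {w w1 w0 wd}wz; have [L /has_derivativeP hL] := hol z1 z1d.
    have [d1 d10 hd1] := hL 1 ltr01.
    have [d2 d20 hd2] := open_disk z11.
    (* Near [z1] the increment of [F] is at most [(N L + 1) * N (v - z1)], which cancels the factor
       [v - z1] in the denominator of [f]. *)
    pose B := ((N L + 1) * 2 / (1 - l)) ^+ j.
    pose d := Num.min (Num.min d1 d2) (N z1).
    apply: (@holo_at_sq_bound _ _ B d); first by rewrite !lt_min d10 d20.
    move=> v; rewrite !lt_min => /andP[/andP[v1 v2] v3].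
    have vd : 0 < N v < 1.
      rewrite hd2 // andbT; have := modulusBr z1 v; rewrite (modulus_distC z1); lra.
    rewrite modulusM /p !modulusM !modulusX /B mulrA ler_wpM2r ?sqr_ge0 //.
    have b1 : N v ^+ 2 <= 1 by rewrite exprn_ile1 ?modulus_ge0 // ltW //; case/andP: vd.
    rewrite -[leRHS]mulr1 ler_pM ?exprn_ge0 ?modulus_ge0 ?sqr_ge0 //.
    have c3 := den v vd; have c4 := num v (proj2 (andP vd)).
    have L0 := modulus_ge0 L.
    rewrite lerXn2r ?nnegrE ?modulus_ge0 ?divr_ge0 ?mulr_ge0 ?subr_ge0 ?(ltW l1) //; first by clear -L0; lra.
    have c1 : N (F v - F z1) <= (N L + 1) * N (v - z1).
      have := hd1 v v1; rewrite mul1r => H.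
      have := modulusD (F v - F z1 - L * (v - z1)) (L * (v - z1)).
      by rewrite subrK modulusM; clear -H; lra.
    have D0 : 0 < N (1 - (F z1)^* * F v) by rewrite modulus_gt0 den0.
    have [->|vz] := eqVneq v z1.
      rewrite /f !subrr mul0r mul0r modulus0 divr_ge0 ?mulr_ge0 ?subr_ge0 ?(ltW l1) //; clear -L0; lra.
    have vz0 : 0 < N (v - z1) by rewrite modulus_gt0 subr_eq0.
    rewrite /f modulusM modulusV !modulusM ler_pdivrMr ?mulr_gt0 //.
    have -> : (N L + 1) * 2 / (1 - l) * (N (v - z1) * N (1 - (F z1)^* * F v)) =
      ((N L + 1) * N (v - z1)) * (2 * (N (1 - (F z1)^* * F v) / (1 - l))).
      by field; rewrite gt_eqF // subr_gt0.
    rewrite ler_pM ?modulus_ge0 // (le_trans c4) // ler_peMr // ler_pdivlMr ?subr_gt0 //.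
    by rewrite mul1r.
  apply: holoM; last first.
    apply: holoM; first exact/holoX/holo_id.
    by apply: holoX; apply: holoB; [exact: holo_id|exact: holo_cst].
  apply: holoX; apply: holo_div.
  - by rewrite mulf_neq0 ?den0 // subr_eq0.
  - apply: holoM; first by apply: holoB; [exact: hol|exact: holo_cst].
    apply: holoB; first exact: holo_cst.
    by apply: holoM; [exact: holo_cst|exact: holo_id].
  - apply: holoM; first by apply: holoB; [exact: holo_id|exact: holo_cst].
    apply: holoB; first exact: holo_cst.
    by apply: holoM; [exact: holo_cst|exact: hol].
move: fle; rewrite /f modulusM modulusV !modulusM ler_pdivrMr ?mul1r //.
by rewrite mulr_gt0 // modulus_gt0 ?den0 // subr_eq0.
Qed.

(** Apply the strict version to [l%:C * F] and let [l] tend to 1. *)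
Lemma schwarz_pick_punctured F z1 z :
  (forall w, 0 < N w < 1 -> holo_at F w) ->
  (forall w, 0 < N w < 1 -> N (F w) <= 1) ->
  0 < N z1 < 1 -> 0 < N z < 1 ->
  N (F z - F z1) * N (1 - z1^* * z) <= N (z - z1) * N (1 - (F z1)^* * F z).
Proof.
move=> hol F1 z1d zd.
set A := _ * _; set B := N (z - z1); set D := N _.
have A0 : 0 <= A by rewrite mulr_ge0 ?modulus_ge0.
have B0 : 0 <= B by rewrite modulus_ge0.
apply/ler_addgt0Pr => e e0.
(* Passing from [F] to [(1 - q)%:C * F] costs [q * A] on the left and at most [2 * q * B] on the
   right, together at most [e]. *)
pose q := Num.min (1 / 2) (e / (2 * B + A + 1)).
have q0 : 0 < q by rewrite /q lt_min divr_gt0 //= divr_gt0 //; lra.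
have q1 : q <= 1 / 2 by rewrite /q ge_min lexx.
have q2 : q * (2 * B + A + 1) <= e by rewrite -ler_pdivlMr ?ge_min ?lexx ?orbT //; lra.
pose l := 1 - q; have l01 : 0 < l < 1 by rewrite /l; lra.
have [l0 l1] := andP l01.
have := @schwarz_pick_strict (fun w => l%:C * F w) l z1 z l1.
have h1 w : 0 < N w < 1 -> holo_at (fun w => l%:C * F w) w.
  by move=> wd; apply: holoM; [exact: holo_cst|exact: hol].
have h2 w : 0 < N w < 1 -> N (l%:C * F w) <= l.
  by move=> /F1 Fw; rewrite modulusM modulus_posreal ?(ltW l0) // ler_piMr // ltW.
move=> /(_ h1 h2 z1d zd).
rewrite -mulrBr modulusM modulus_posreal ?(ltW l0) // -mulrA -/A -/B.
have -> : 1 - (l%:C * F z1)^* * (l%:C * F z) =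
   (1 - (F z1)^* * F z) + (1 - l ^+ 2)%:C * ((F z1)^* * F z).
  have El : (1 - l ^+ 2)%:C = 1 - l%:C * l%:C :> C by rewrite expr2 realCB realCM.
  rewrite El [X in 1 - X * _ = _](_ : _ = l%:C * (F z1)^* :> C); first by ring.
  by case: (F z1) => u v; apply: complexP => /=; ring.
move=> H.
have c1 : N ((1 - l ^+ 2)%:C * ((F z1)^* * F z)) <= 2 * q.
  rewrite !modulusM modulus_conj modulus_posreal; last by nra.
  have a1 := F1 _ z1d; have a2 := F1 _ zd.
  have a3 : N (F z1) * N (F z) <= 1 by rewrite mulr_ile1 ?modulus_ge0.
  have a4 : 1 - l ^+ 2 <= 2 * q by rewrite /l; nra.
  have a5 : 0 <= 1 - l ^+ 2 by nra.
  by rewrite (le_trans _ a4) // ler_piMr.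
have c2 : B * N ((1 - (F z1)^* * F z) + (1 - l ^+ 2)%:C * ((F z1)^* * F z)) <= B * (D + 2 * q).
  by rewrite ler_wpM2l // (le_trans (modulusD _ _)) // lerD2l.
rewrite /l in H; nra.
Qed.

End SchwarzPick.

(** * Compactness of closed disks *)

Section Compactness.
Variable R : realType.
Local Notation C := (CC R).
Local Notation N := (@modulus R).

Lemma closed_ball_compact (K : R) : compact [set z : C | N z <= K].
Proof.
move=> F FF FK; pose h (z : C) : R * R := (complex.Re z, complex.Im z).
have cB : compact (`[(- K), K] `*` `[(- K), K] : set (R * R)%type).
  by apply: compact_setX; exact: segment_compact.
have FB : (h @ F) (`[(- K), K] `*` `[(- K), K] : set (R * R)%type).
  apply: (@filterS C F _ _ (h @^-1` _) _ FK) => z /= zK; rewrite !in_itv /= -!ler_norml; split.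
    by rewrite (le_trans (normRe_le_modulus z)).
  by rewrite (le_trans (normIm_le_modulus z)).
have [[x y] [_ cl]] := cB (h @ F) _ FB.
have cl' : cluster F ((x +i* y) : C).
  move=> A B FA /nbhs_modulusP[e e0 eB].
  have FA' : (h @ F) (h @` A) by apply: (@filterS C F _ _ (h @^-1` _) _ FA) => z Az; exists z.
  have nB : nbhs ((x, y) : R * R) [set q | `|q.1 - x| < e / 2 /\ `|q.2 - y| < e / 2].
    exists ([set a | `|a - x| < e / 2], [set b | `|b - y| < e / 2]) => /=.
      by split; apply/nbhs_normP; exists (e / 2); rewrite /= ?half_gt0 // => a /=; rewrite distrC.
    by move=> [a b] /= [].
  have [_ [[z Az <-] /= [zx zy]]] := cl _ _ FA' nB.
  exists z; split => //; apply: eB; rewrite (le_lt_trans (modulus_le_ReIm _)) //.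
  case: z zx zy {Az} => a b /= ax bx; lra.
exists (x +i* y); split => //=.
rewrite leNgt; apply/negP => Kz.
have e0 : 0 < N (x +i* y) - K by rewrite subr_gt0.
have nB : nbhs ((x +i* y) : C) [set w | N (w - (x +i* y)) < N (x +i* y) - K].
  by apply/nbhs_modulusP; exists (N (x +i* y) - K).
have [z [z1 z2]] := cl' _ _ FK nB.
have z1' : N z <= K := z1.
have z2' : N (z - (x +i* y)) < N (x +i* y) - K := z2.
by have := modulusBr (x +i* y) z; rewrite (modulus_distC (x +i* y)); lra.
Qed.

(** The cluster point is given by terms infinitely often close to it, so no subsequence has to be
    extracted. *)
Lemma bolzano_weierstrass (u : nat -> C) (K : R) : (forall n, N (u n) <= K) ->
  exists2 z, N z <= K & forall e n0, 0 < e -> exists2 n, (n0 <= n)%N & N (u n - z) < e.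
Proof.
move=> uK; have FK : (u @ \oo) [set z : C | N z <= K].
  by exists 0%N => // n _; exact: uK.
have [z [zK cl]] := closed_ball_compact _ FK.
exists z => // e n0 e0.
have FA : (u @ \oo) [set w | exists2 n, (n0 <= n)%N & w = u n].
  by exists n0 => // n nn; exists n.
have nB : nbhs (z : C) [set w | N (w - z) < e] by apply/nbhs_modulusP; exists e.
by have [_ [[n nn ->] h]] := cl _ _ FA nB; exists n.
Qed.

Lemma inv_nat_small (e : R) : 0 < e ->
  exists n0, forall n, (n0 <= n)%N -> (n.+1%:R)^-1 < e.
Proof.
move=> e0; exists (Num.bound e^-1) => n hn.
have h : 0 <= e^-1 by rewrite invr_ge0 ltW.
have := archi_boundP h => H; rewrite -(invrK e) ltf_pV2 ?posrE ?invr_gt0 //.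
by rewrite (lt_le_trans H) // ler_nat ltnW.
Qed.

Lemma limit_le (u : nat -> C) (z a : C) (K : R) :
  (forall e n0, 0 < e -> exists2 n, (n0 <= n)%N & N (u n - z) < e) ->
  (forall n, N (u n - a) <= K) -> N (z - a) <= K.
Proof.
move=> h hK; apply/ler_addgt0Pr => e e0; have [n _ hn] := h e 0%N e0.
by have := modulus_tri (u n) z a; have := hK n; rewrite (modulus_distC z (u n)); lra.
Qed.

Lemma limit_ge (u : nat -> C) (z a : C) (K : R) :
  (forall e n0, 0 < e -> exists2 n, (n0 <= n)%N & N (u n - z) < e) ->
  (forall n, K <= N (u n - a)) -> K <= N (z - a).
Proof.
move=> h hK; apply/ler_addgt0Pr => e e0; have [n _ hn] := h e 0%N e0.
by have := modulus_tri z (u n) a; have := hK n; lra.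
Qed.

End Compactness.

(** * Consequences of the punctured Schwarz-Pick inequality *)

Section SchwarzConsequences.
Variable R : realType.
Local Notation C := (CC R).
Local Notation N := (@modulus R).
Implicit Types (f F : C -> C) (z w : C).

(** The punctured inequality with [z1] tending to the puncture, where [F] tends to [q]. The limit
    [q] may have modulus 1, which is the case used for rigidity. *)
Lemma schwarz_pick_center F q z :
  (forall w, 0 < N w < 1 -> holo_at F w) ->
  (forall w, 0 < N w < 1 -> N (F w) <= 1) ->
  (forall e, 0 < e -> exists2 d, 0 < d & forall w, 0 < N w < d -> N (F w - q) < e) ->
  0 < N z < 1 -> N (F z - q) <= N z * N (1 - q^* * F z).
Proof.
move=> hol F1 lim zd; apply/ler_addgt0Pr => e e0.
pose t := Num.min (1 / 2) (e / 8).
have t0 : 0 < t by rewrite /t lt_min divr_gt0 //= divr_gt0.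
have t1 : t <= 1 / 2 by rewrite /t ge_min lexx.
have t2 : t <= e / 8 by rewrite /t ge_min lexx orbT.
have [d d0 hd] := lim t t0.
pose z1 : C := (Num.min d t / 2)%:C.
have m0 : 0 < Num.min d t by rewrite lt_min d0.
have Nz1 : N z1 = Num.min d t / 2 by rewrite modulus_posreal // ltW // half_gt0.
have md : Num.min d t <= d by rewrite ge_min lexx.
have mt : Num.min d t <= t by rewrite ge_min lexx orbT.
have z1d : 0 < N z1 < 1 by rewrite Nz1; lra.
have /hd h1 : 0 < N z1 < d by rewrite Nz1; lra.
have z1t : N z1 <= t by rewrite Nz1; lra.
have H := schwarz_pick_punctured hol F1 z1d zd.
have Fz := F1 _ zd; have Fz1 := F1 _ z1d; have [z0 zlt] := andP zd.
have a1 : N (F z - q) - t <= N (F z - F z1).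
  by have := modulus_tri (F z1) (F z) q; lra.
have a2 : 1 - t <= N (1 - z1^* * z).
  rewrite (le_trans _ (modulusBr _ _)) // modulus1 modulusM modulus_conj.
  have : N z1 * N z <= N z1 by rewrite ler_piMr ?modulus_ge0 // ltW.
  lra.
have a3 : N (z - z1) <= N z + t by rewrite (le_trans (modulusB _ _)) // lerD2l.
have a4 : N (1 - (F z1)^* * F z) <= N (1 - q^* * F z) + t.
  have -> : 1 - (F z1)^* * F z = (1 - q^* * F z) - (F z1 - q)^* * F z.
    by rewrite rmorphB; ring.
  rewrite (le_trans (modulusB _ _)) // lerD2l modulusM modulus_conj.
  by rewrite (le_trans (ler_piMr _ Fz)) ?modulus_ge0 // ltW.
have Nq : N q <= 2 by have := modulusB (F z1) (F z1 - q); rewrite opprB addrC subrK; lra.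
have b1 : N (F z - q) <= 3 by rewrite (le_trans (modulusB _ _)) //; lra.
have b2 : N (1 - q^* * F z) <= 3.
  rewrite (le_trans (modulusB _ _)) // modulus1 modulusM modulus_conj.
  have : N q * N (F z) <= N q by rewrite ler_piMr ?modulus_ge0.
  lra.
have c1 : (N (F z - q) - t) * (1 - t) <= N (F z - F z1) * N (1 - z1^* * z).
  have [neg|pos] := ltP (N (F z - q) - t) 0.
    rewrite (@le_trans _ _ 0) ?mulr_ge0 ?modulus_ge0 //.
    by rewrite mulr_le0_ge0 ?(ltW neg) //; lra.
  by apply: ler_pM => //; lra.
have c2 : N (z - z1) * N (1 - (F z1)^* * F z) <= (N z + t) * (N (1 - q^* * F z) + t).
  by apply: ler_pM; rewrite ?modulus_ge0.
have X0 := modulus_ge0 (F z - q); have D0 := modulus_ge0 (1 - q^* * F z).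
have c3 := le_trans c1 (le_trans H c2).
nra.
Qed.

(** This is [schwarz_pick_center] for [f] itself with limit [q = 0]; no division by [z] occurs. *)
Lemma schwarz_lemma f z : (forall w, N w < 1 -> holo_at f w) ->
  (forall w, N w < 1 -> N (f w) <= 1) -> f 0 = 0 -> N z < 1 -> N (f z) <= N z.
Proof.
move=> hol f1 f0 z1; have [->|z0] := eqVneq z 0; first by rewrite f0 lexx.
have := @schwarz_pick_center f 0 z.
rewrite rmorph0 subr0 mul0r subr0 modulus1 mulr1; apply.
- by move=> w /andP[_]; exact: hol.
- by move=> w /andP[_]; exact: f1.
- have cf : ccont f 0 by apply: holo_cont; apply: hol; rewrite modulus0.
  move=> e /cf[d d0 h]; exists d => // w /andP[_ wd]; rewrite -{1}f0; apply: h.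
  by rewrite subr0.
- by rewrite modulus_gt0 z0.
Qed.

Lemma derivative_bound f (l z : C) (K : R) : has_derivative f z l ->
  (exists2 d, 0 < d & forall w, N (w - z) < d -> N (f w - f z) <= K * N (w - z)) ->
  N l <= K.
Proof.
move=> /has_derivativeP hf [d d0 hd]; apply/ler_addgt0Pr => e e0.
have [d' d'0 hd'] := hf e e0.
pose h := Num.min d d' / 2; have m0 : 0 < Num.min d d' by rewrite lt_min d0.
have m1 : Num.min d d' <= d by rewrite ge_min lexx.
have m2 : Num.min d d' <= d' by rewrite ge_min lexx orbT.
have h0 : 0 < h by rewrite /h; lra.
have E : z + h%:C - z = h%:C by rewrite addrC addKr.
have Nh : N h%:C = h by rewrite modulus_posreal // ltW.
have hd1 : h < d by rewrite /h; lra.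
have hd2 : h < d' by rewrite /h; lra.
have := hd (z + h%:C); rewrite E Nh => /(_ hd1) A1.
have := hd' (z + h%:C); rewrite E Nh => /(_ hd2) A2.
have := modulusB (f (z + h%:C) - f z) (f (z + h%:C) - f z - l * h%:C).
rewrite opprB addrC subrK modulusM Nh => A3.
by rewrite -(ler_pM2r h0); lra.
Qed.

Lemma schwarz_derivative f (l : C) : (forall w, N w < 1 -> holo_at f w) ->
  (forall w, N w < 1 -> N (f w) <= 1) -> f 0 = 0 -> has_derivative f 0 l -> N l <= 1.
Proof.
move=> hol f1 f0 df; apply: (derivative_bound df); exists 1 => // w.
by rewrite subr0 f0 subr0 mul1r; exact: schwarz_lemma.
Qed.

(** Take [F w = f w / w], with limit [q] at 0. Since [N q = 1], [N (1 - q^* * F z)] equals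
    [N (F z - q)], so the centred inequality reads [X <= N z * X] and forces [X = 0]. *)
Lemma schwarz_rigidity f (q z : C) : (forall w, N w < 1 -> holo_at f w) ->
  (forall w, N w < 1 -> N (f w) <= 1) -> f 0 = 0 -> has_derivative f 0 q ->
  N q = 1 -> N z < 1 -> f z = q * z.
Proof.
move=> hol f1 f0 /has_derivativeP df q1 z1.
have [->|z0] := eqVneq z 0; first by rewrite f0 mulr0.
pose F w := f w / w.
have zd : 0 < N z < 1 by rewrite modulus_gt0 z0.
have := @schwarz_pick_center F q z.
have -> : N (1 - q^* * F z) = N (F z - q).
  have -> : 1 - q^* * F z = q^* * (q - F z).
    by rewrite mulrBr [q^* * q]mulrC mul_conj q1 expr1n.
  by rewrite modulusM modulus_conj q1 mul1r modulus_distC.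
move=> /(_ _ _ _ zd) H0.
have H : N (F z - q) <= N z * N (F z - q).
  apply: H0.
  - move=> w /andP[w0 w1].
    by apply: holo_div; [rewrite -modulus_gt0|exact: hol|exact: holo_id].
  - move=> w /andP[w0 w1].
    by rewrite /F modulusM modulusV ler_pdivrMr // mul1r; exact: schwarz_lemma.
  - move=> e e0; have [d d0 hd] := df _ (half_gt0 e0); exists d => // w /andP[w0 wd].
    have w00 : w != 0 by rewrite -modulus_gt0.
    have := hd w; rewrite subr0 f0 subr0 => /(_ wd) H.
    have -> : F w - q = (f w - q * w) / w by rewrite /F; field.
    by rewrite modulusM modulusV ltr_pdivrMr // (le_lt_trans H) // ltr_pM2r //; lra.
have : N (F z - q) = 0.
  have := modulus_ge0 (F z - q); case/andP: zd => _ ?.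
  rewrite le_eqVlt => /orP[/eqP <- //|pos]; nra.
move/eqP; rewrite modulus_eq0 subr_eq0 /F => /eqP <-; by rewrite divfK.
Qed.

(** The constant does not degenerate at the puncture [p], so this does the work of a removable
    singularity theorem. After rescaling, points of the half disk give [1 / 2 <= N (1 - v1^* * v)],
    and the other factor is at most 2; hence the 4. *)
Lemma bounded_holo_lipschitz F (p : C) (r M : R) : 0 < r -> 0 < M ->
  (forall w, 0 < N (w - p) < r -> holo_at F w) ->
  (forall w, 0 < N (w - p) < r -> N (F w) <= M) ->
  forall z z1, 0 < N (z - p) < r / 2 -> 0 < N (z1 - p) < r / 2 ->
  N (F z - F z1) <= 4 * M / r * N (z - z1).
Proof.
move=> r0 M0 hol FM z z1 /andP[z0 zr] /andP[z10 z1r].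
pose G w := F (p + r%:C * w) / M%:C.
have NM : N M%:C = M by rewrite modulus_posreal // ltW.
have Nr : N r%:C = r by rewrite modulus_posreal // ltW.
have rC : r%:C != 0 :> C by rewrite -modulus_gt0 Nr.
have MC : M%:C != 0 :> C by rewrite -modulus_gt0 NM.
have dom w : 0 < N w < 1 -> 0 < N (p + r%:C * w - p) < r.
  move=> /andP[w0 w1]; rewrite addrC addKr modulusM Nr mulr_gt0 //=.
  by rewrite gtr_pMr.
have GM w : 0 < N w < 1 -> N (G w) <= 1.
  move=> /dom /FM h; rewrite /G modulusM modulusV NM ler_pdivrMr // mul1r //.
have Ghol w : 0 < N w < 1 -> holo_at G w.
  move=> /dom /hol h; apply: holo_div => //; last exact: holo_cst.
  apply: (@holo_comp _ (fun w => p + r%:C * w) F) => //.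
  apply: holoD; first exact: holo_cst.
  by apply: holoM; [exact: holo_cst|exact: holo_id].
pose v := (z - p) / r%:C; pose v1 := (z1 - p) / r%:C.
have Nv : N v = N (z - p) / r by rewrite modulusM modulusV Nr.
have Nv1 : N v1 = N (z1 - p) / r by rewrite modulusM modulusV Nr.
have hv : N v < 1 / 2 by rewrite Nv ltr_pdivrMr //; lra.
have hv1 : N v1 < 1 / 2 by rewrite Nv1 ltr_pdivrMr //; lra.
have vd : 0 < N v < 1 by apply/andP; split; [rewrite Nv divr_gt0|lra].
have v1d : 0 < N v1 < 1 by apply/andP; split; [rewrite Nv1 divr_gt0|lra].
have := schwarz_pick_punctured Ghol GM v1d vd.
have E : p + r%:C * v = z by rewrite /v; field.
have E1 : p + r%:C * v1 = z1 by rewrite /v1; field.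
have -> : G v - G v1 = (F z - F z1) / M%:C by rewrite /G E E1; field.
have -> : v - v1 = (z - z1) / r%:C by rewrite /v /v1; field.
rewrite !modulusM !modulusV NM Nr.
have A1 : 1 / 2 <= N (1 - v1^* * v).
  rewrite (le_trans _ (modulusBr _ _)) // modulus1 modulusM modulus_conj.
  have [v0 _] := andP vd; have [v10 _] := andP v1d; nra.
have A2 : N (1 - (G v1)^* * G v) <= 2.
  rewrite (le_trans (modulusB _ _)) // modulus1 modulusM modulus_conj.
  have := mulr_ile1 (modulus_ge0 _) (modulus_ge0 _) (GM _ v1d) (GM _ vd); lra.
set X := N (F z - F z1); set Y := N (z - z1) => H.
have X0 : 0 <= X / M by rewrite divr_ge0 ?modulus_ge0 // ltW.
have Y0 : 0 <= Y / r by rewrite divr_ge0 ?modulus_ge0 // ltW.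
have K : X / M * (1 / 2) <= Y / r * 2.
  apply: (le_trans _ (le_trans H _)); first by rewrite ler_wpM2l.
  by rewrite ler_wpM2l.
rewrite -[leLHS](divfK (lt0r_neq0 M0)) (_ : 4 * M / r * Y = (4 * (Y / r)) * M); last by ring.
by rewrite ler_pM2r //; lra.
Qed.

End SchwarzConsequences.

(** * Injective holomorphic maps *)

Section InjectiveHolomorphic.
Variable R : realType.
Local Notation C := (CC R).
Local Notation N := (@modulus R).

Lemma has_derivativeX (f : C -> C) z l n : has_derivative f z l ->
  has_derivative (fun w => f w ^+ n) z (n%:R * f z ^+ n.-1 * l).
Proof.
move=> hf; elim: n => [|n ih].
  by rewrite !mul0r; exact: has_derivative_cst.
have := has_derivativeM hf ih.
rewrite (_ : (fun w => f w * f w ^+ n) = (fun w => f w ^+ n.+1)); last first.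
  by apply: funext => w; rewrite exprS.
rewrite (_ : l * f z ^+ n + _ = n.+1%:R * f z ^+ n.+1.-1 * l) //=.
by case: n {ih} => [|n]; rewrite -natr1 /= ?expr0 ?exprS; ring.
Qed.

Lemma has_derivative_shift (f : C -> C) (p z l : C) :
  has_derivative f (p + z) l -> has_derivative (fun w => f (p + w) - f p) z l.
Proof.
move=> hf.
have h1 : has_derivative (fun w => p + w) z (0 + 1).
  by apply: has_derivativeD; [exact: has_derivative_cst|exact: has_derivative_id].
have := has_derivativeD (has_derivative_comp h1 hf) (has_derivative_cst (- f p) z).
by rewrite add0r mulr1 addr0.
Qed.

(** If [n] is the order of the zero at 0, then [F = g / z ^+ n] is Lipschitz off 0 and bounded away
    from 0 near 0. In g' = z^(n-1) (z F' + n F) the second term dominates. *)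
Lemma critical_point_isolated (g : C -> C) (r : R) : 0 < r -> g 0 = 0 ->
  (forall z, N z < r -> holo_at g z) -> (forall z, 0 < N z < r -> g z != 0) ->
  exists2 d, 0 < d & forall z l, 0 < N z < d -> has_derivative g z l -> l != 0.
Proof.
move=> r0 g0 hol gn0.
(* [bdd n] says that [g] vanishes at 0 to order at least [n]. *)
pose bdd n := exists M d, [/\ 0 < M, 0 < d & forall z, 0 < N z < d -> N (g z) <= M * N z ^+ n].
have quot n z : z != 0 -> N z < r -> holo_at (fun w => g w / w ^+ n) z.
  move=> z0 zr; apply: holo_div; [by rewrite expf_neq0|exact: hol|exact/holoX/holo_id].
have hg0 : holo_at g 0 by apply: hol; rewrite modulus0.
have [s [s0 sr gs]] : exists s, [/\ 0 < s, s < r & forall z, N z < s -> N (g z) <= 1].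
  have [d d0 hd] := holo_cont hg0 ltr01.
  exists (Num.min d r / 2); have m0 : 0 < Num.min d r by rewrite lt_min d0.
  have m1 : Num.min d r <= d by rewrite ge_min lexx.
  have m2 : Num.min d r <= r by rewrite ge_min lexx orbT.
  split; [lra|lra|move=> z zs; have := hd z; rewrite g0 !subr0 => h].
  by apply/ltW/h; lra.
(* A zero of infinite order would allow dividing by [w] again and again in the Schwarz lemma, giving
   [N (g (s%:C * w)) <= N w ^+ n] for all [n] and a zero of [g] at half the radius [s]. *)
have notall : ~ forall n, bdd n.
  move=> all; have NsC : N s%:C = s by rewrite modulus_posreal // ltW.
  have sC : s%:C != 0 :> C by rewrite -modulus_gt0 NsC.
  have small n w : 0 < N w < 1 -> N (g (s%:C * w)) <= N w ^+ n.
    elim: n w => [|n ih] w wd.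
      by rewrite expr0 gs // modulusM NsC gtr_pMr //; case/andP: wd.
    have [w0 w1] := andP wd; have w00 : w != 0 by rewrite -modulus_gt0.
    have dom v : 0 < N v < 1 -> 0 < N (s%:C * v) < r.
      move=> /andP[v0 v1]; rewrite modulusM NsC mulr_gt0 //=.
      by rewrite (lt_trans _ sr) // gtr_pMr.
    have := @schwarz_pick_center R (fun w => g (s%:C * w) / w ^+ n) 0 w.
    rewrite subr0 rmorph0 mul0r subr0 modulus1 mulr1 modulusM modulusV modulusX => H.
    rewrite exprSr -ler_pdivrMl ?exprn_gt0 // mulrC; apply: H => //.
    - move=> v vd; have [v0 v1] := andP vd.
      apply: holo_div; [by rewrite expf_neq0 // -modulus_gt0| |exact/holoX/holo_id].
      apply: (@holo_comp _ (fun v => s%:C * v) g).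
        by apply: holoM; [exact: holo_cst|exact: holo_id].
      by apply: hol; case/andP: (dom v vd).
    - move=> v vd; have [v0 v1] := andP vd.
      by rewrite modulusM modulusV modulusX ler_pdivrMr ?exprn_gt0 // mul1r ih.
    - move=> e e0; have [M [d [M0 d0 hd]]] := all n.+1.
      pose t := M * s ^+ n.+1; have t0 : 0 < t by rewrite mulr_gt0 // exprn_gt0.
      exists (Num.min (d / s) (e / t)); first by rewrite lt_min !divr_gt0.
      move=> v; rewrite lt_min => /andP[v0 /andP[vd ve]].
      rewrite subr0 modulusM modulusV modulusX ltr_pdivrMr ?exprn_gt0 //.
      have vs : 0 < N (s%:C * v) < d.
        by rewrite modulusM NsC mulr_gt0 //= mulrC -ltr_pdivlMr.
      rewrite (le_lt_trans (hd _ vs)) // modulusM NsC exprMn mulrA -/t exprS mulrA.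
      by rewrite ltr_pM2r ?exprn_gt0 // mulrC -ltr_pdivlMr.
  have h2 : N (1 / 2 : C) = 1 / 2.
    by rewrite modulusM modulusV modulus1 -realC_nat modulus_posreal.
  have hd : 0 < N (1 / 2 : C) < 1 by rewrite h2; lra.
  have z0 : g (s%:C * (1 / 2)) != 0.
    apply: gn0; rewrite modulusM NsC h2; apply/andP; split; lra.
  have := @power_comparison R 1 (1 / 2) (N (g (s%:C * (1 / 2)))) 1.
  have q : 0 < (1 / 2 : R) by lra.
  rewrite ler01 modulus_gt0 z0 => /(_ isT q isT) H.
  have : (1 : R) <= 1 / 2.
    by apply: H => j; rewrite expr1n mul1r mulr1 -h2 small.
  lra.
have bdd0 : bdd 0%N.
  exists 1, s; split => // z /andP[_ zs]; rewrite expr0 mulr1; exact: gs.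
have bdd1 : bdd 1%N.
  have [l /has_derivativeP hl] := hg0; have [d d0 hd] := hl 1 ltr01.
  exists (N l + 1), d; split => //; first by rewrite ltr_wpDl ?modulus_ge0.
  move=> z /andP[_ zd]; have := hd z; rewrite g0 !subr0 expr1 mul1r => /(_ zd) H.
  by have := modulusD (g z - l * z) (l * z); rewrite subrK modulusM; lra.
have [n [bn nbn]] : exists n, bdd n /\ ~ bdd n.+1.
  apply: contrapT => h; apply: notall; elim=> // n ih.
  by apply: contrapT => nb; apply: h; exists n.
have n0 : n != 0%N by apply/eqP => n0; apply: nbn; rewrite n0.
have [M [d1 [M0 d10 hM]]] := bn.
pose d := Num.min d1 r; have d0 : 0 < d by rewrite /d lt_min d10.
have dd1 : d <= d1 by rewrite /d ge_min lexx.
have dr : d <= r by rewrite /d ge_min lexx orbT.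
pose F w := g w / w ^+ n.
have Fhol w : 0 < N (w - 0) < d -> holo_at F w.
  rewrite subr0 => /andP[w0 wd]; apply: quot; [by rewrite -modulus_gt0|lra].
have FM w : 0 < N (w - 0) < d -> N (F w) <= M.
  rewrite subr0 => /andP[w0 wd]; rewrite /F modulusM modulusV modulusX.
  by rewrite ler_pdivrMr ?exprn_gt0 // hM // w0 /=; lra.
have [K K0 lip] : exists2 K, 0 < K & forall z z1, 0 < N z < d / 2 -> 0 < N z1 < d / 2 ->
    N (F z - F z1) <= K * N (z - z1).
  exists (4 * M / d); first by rewrite divr_gt0 // mulr_gt0.
  by move=> z z1 zd z1d; apply: (bounded_holo_lipschitz d0 M0 Fhol FM); rewrite subr0.
(* Failure of order [n.+1] with constant [2 * K]. As [F] is [K]-Lipschitz, its modulus exceeds a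
   quarter of [N (F z1)] at all points closer to 0 than [N (F z1) / (4 * K)]. *)
have [z1 [z10 z1d Fz1]] : exists z, [/\ 0 < N z, N z < d / 2 & 2 * K * N z < N (F z)].
  apply: contrapT => h; apply: nbn; exists (2 * K), (d / 2); split; [exact: mulr_gt0|exact: half_gt0|].
  move=> z /andP[z0 zd]; rewrite leNgt; apply/negP => lt; apply: h; exists z; split => //.
  rewrite /F modulusM modulusV modulusX ltr_pdivlMr ?exprn_gt0 //.
  have -> : 2 * K * N z * N z ^+ n = 2 * K * N z ^+ n.+1 by rewrite exprS; ring.
  by [].
have Fz0 : 0 < N (F z1) by rewrite (le_lt_trans _ Fz1) // mulr_ge0 ?modulus_ge0 // mulr_ge0 // ltW.
exists (Num.min (d / 2) (N (F z1) / (4 * K))).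
  by rewrite lt_min half_gt0 // divr_gt0 // mulr_gt0.
move=> z l; rewrite lt_min => /andP[z0 /andP[zd zF]] hl; apply/eqP => l0.
have z00 : z != 0 by rewrite -modulus_gt0.
have Fz : N (F z1) / 4 < N (F z).
  have := lip z1 z; rewrite z10 z0 z1d zd => /(_ isT isT) H.
  have a1 := modulusBr (F z1) (F z); have a2 := modulusB z1 z.
  have a3 : K * N (z1 - z) <= K * (N z1 + N z) by rewrite ler_pM2l.
  have zF' : N z * (4 * K) < N (F z1) by rewrite -ltr_pdivlMr ?mulr_gt0.
  by clearbody F; clear -zF' H Fz1 a1 a2 a3; lra.
have zd' : N z < d by clearbody d; clear -zd d0; lra.
have [L hL] : holo_at F z by apply: Fhol; rewrite subr0 z0.
have LK : N L <= K.
  apply: (derivative_bound hL); exists (Num.min (N z) (d / 2 - N z)).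
    by rewrite lt_min z0 subr_gt0.
  move=> w; rewrite lt_min => /andP[w1 w2]; apply: lip; rewrite ?z0 ?zd //.
  apply/andP; split.
    by have := modulusBr z w; rewrite modulus_distC; clear -w1; lra.
  by have := modulusD (w - z) z; rewrite subrK; clearbody d; clear -w2; lra.
have hX := has_derivativeM hL (has_derivativeX n (has_derivative_id z)).
have : has_derivative g z (L * z ^+ n + F z * (n%:R * z ^+ n.-1 * 1)).
  apply: (has_derivative_near z0 _ hX) => w wz.
  rewrite /F /= divfK // expf_neq0 //; apply: contraTneq wz => ->.
  by rewrite sub0r modulusN ltxx.
move=> /(has_derivative_unique hl); rewrite l0.
have -> : z ^+ n = z * z ^+ n.-1 by rewrite -exprS prednK // lt0n.
have -> : L * (z * z ^+ n.-1) + F z * (n%:R * z ^+ n.-1 * 1) =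
   z ^+ n.-1 * (L * z + n%:R * F z) by ring.
move/esym/eqP; rewrite mulf_eq0 expf_eq0 (negbTE z00) andbF /= addr_eq0 => /eqP E.
have : N (L * z) = n%:R * N (F z).
  by rewrite E modulusN modulusM -realC_nat modulus_posreal.
rewrite modulusM => E'.
have a1 : N L * N z <= K * N z by rewrite ler_wpM2r // ltW.
have a2 : 1 * N (F z) <= n%:R * N (F z) by rewrite ler_wpM2r ?modulus_ge0 // ler1n lt0n.
have zF' : N z * (4 * K) < N (F z1) by rewrite -ltr_pdivlMr ?mulr_gt0.
by clearbody F; clear -a1 a2 zF' E' Fz; lra.
Qed.

(** * Injective maps: openness, inverse and nonvanishing derivative *)

Section Univalent.
Variable f : C -> C.
Hypothesis fhol : forall z, N z < 1 -> holo_at f z.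
Hypothesis finj : forall z w, N z < 1 -> N w < 1 -> f z = f w -> z = w.

(** By injectivity and compactness [f - f p] has a positive minimum [m] on a small circle about [p].
    If [w] within [m / 2] of [f p] were not attained, [(f - w)^-1] would be larger at the centre
    than on the circle. *)
Lemma univalent_open p r : N p < 1 -> 0 < r -> exists2 d, 0 < d &
  forall w, N (w - f p) < d -> exists z, [/\ N z < 1, N (z - p) <= r & f z = w].
Proof.
move=> p1 r0; pose s := Num.min r ((1 - N p) / 2).
have s0 : 0 < s by rewrite /s lt_min r0 divr_gt0 // subr_gt0.
have sr : s <= r by rewrite /s ge_min lexx.
have s1 : s <= (1 - N p) / 2 by rewrite /s ge_min lexx orbT.
have inD z : N (z - p) <= s -> N z < 1.
  by move=> zs; have := modulusD (z - p) p; rewrite subrK; lra.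
have [m m0 hm] : exists2 m, 0 < m & forall z, N (z - p) = s -> m <= N (f z - f p).
  apply: contrapT => h.
  have hn n : exists z, N (z - p) = s /\ N (f z - f p) < n.+1%:R^-1.
    apply: contrapT => hz; apply: h; exists n.+1%:R^-1; first by rewrite invr_gt0.
    move=> z zs; rewrite leNgt; apply/negP => lt; apply: hz; by exists z.
  have [u hu] := choice hn.
  have uB n : N (u n) <= 1 by apply/ltW/inD; rewrite (hu n).1.
  have [z _ cl] := bolzano_weierstrass uB.
  have zs : N (z - p) = s.
    by apply/le_anti; rewrite (limit_le cl) ?(limit_ge cl) // => n; rewrite (hu n).1.
  have z1 : N z < 1 by apply: inD; rewrite zs.
  have fz : f z = f p.
    apply/eqP; rewrite -subr_eq0 -modulus_eq0; apply/eqP/le_anti; rewrite modulus_ge0 andbT.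
    apply/ler_addgt0Pr => e e0; rewrite add0r.
    have [d d0 hd] := holo_cont (fhol z1) (half_gt0 e0).
    have [n0 hn0] := inv_nat_small (half_gt0 e0).
    have [n nn un] := cl d n0 d0.
    have := hd _ un; have := lt_trans (hu n).2 (hn0 n nn).
    by have := modulus_tri (f (u n)) (f z) (f p); rewrite (modulus_distC (f z) (f (u n))); lra.
  have := finj z1 p1 fz => E; move: zs; rewrite E subrr modulus0; lra.
exists (m / 2); first exact: half_gt0.
move=> w wp; apply: contrapT => none.
have nw z : N (z - p) <= s -> f z - w != 0.
  move=> zs; rewrite subr_eq0; apply/eqP => fz; apply: none; exists z.
  by split => //; [exact: inD|exact: le_trans sr].
have hE z : p + z - p = z by rewrite addrC addKr.
have ghol z : N z <= s -> holo_at (fun z => (f (p + z) - w)^-1) z.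
  move=> zs; apply: holoV; first by apply: nw; rewrite hE.
  apply: holoB; last exact: holo_cst.
  apply: (@holo_comp _ (fun z => p + z) f); last by apply: fhol; apply: inD; rewrite hE.
  by apply: holoD; [exact: holo_cst|exact: holo_id].
have := @max_modulus_center R (fun z => (f (p + z) - w)^-1) s (m / 2)^-1 s0.
rewrite addr0 modulusV => H.
have : (N (f p - w))^-1 <= (m / 2)^-1.
  apply: H.
  - by move=> z /andP[_]; exact: ghol.
  - by apply: holo_cont; apply: ghol; rewrite modulus0 ltW.
  - move=> z zs; have zs' : N (p + z - p) = s by rewrite hE.
    have A := hm _ zs'; have B := modulus_tri w (f (p + z)) (f p).
    have m2 := half_gt0 m0; rewrite modulusV lef_pV2 ?posrE //; lra.
have fp0 : 0 < N (f p - w) by rewrite modulus_gt0 nw // subrr modulus0 ltW.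
by rewrite lef_pV2 ?posrE ?half_gt0 // modulus_distC; lra.
Qed.

Definition disk_inverse (w : C) : C :=
  if pselect (exists z, N z < 1 /\ f z = w) is left h then sval (cid h) else 0.

Local Notation k := disk_inverse.

Lemma disk_inverseK z : N z < 1 -> k (f z) = z.
Proof.
move=> z1; rewrite /disk_inverse; case: pselect => [h|]; last by case; exists z.
by case: (cid h) => y /= [y1 /finj]; apply.
Qed.

Lemma disk_inverse_cont p : N p < 1 -> ccont k (f p).
Proof.
move=> p1 e e0; have [d d0 hd] := univalent_open p1 (half_gt0 e0).
exists d => // w /hd[z [z1 zp <-]]; rewrite !disk_inverseK //; lra.
Qed.

(** Caratheodory's identity read backwards: near [f p] the inverse satisfies
    [k w = p + (phi (k w))^-1 * (w - f p)], with a factor continuous at [f p]. *)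
Lemma disk_inverse_derivative p l : N p < 1 -> l != 0 -> has_derivative f p l ->
  has_derivative k (f p) l^-1.
Proof.
move=> p1 l0 [phi cphi [phip fE]].
have [d d0 hd] := univalent_open p1 ltr01.
have cpk : ccont (fun w => phi (k w)) (f p).
  by apply: ccont_comp; [exact: disk_inverse_cont|rewrite disk_inverseK].
have pk0 : phi (k (f p)) != 0 by rewrite disk_inverseK ?phip.
have N0 : 0 < N (phi (k (f p))) by rewrite modulus_gt0.
have [d' d'0 hd'] := cpk _ N0.
pose g w := p + (phi (k w))^-1 * (w - f p).
have gE : g (f p) = p by rewrite /g subrr mulr0 addr0.
apply: (@has_derivative_near _ g k _ _ (Num.min d d')); first by rewrite lt_min d0.
  move=> w; rewrite lt_min => /andP[/hd[z [z1 _ <-]] /hd' h].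
  have pz : phi z != 0.
    rewrite -modulus_gt0; have := modulusBr (phi (k (f p))) (phi (k (f z))).
    by rewrite modulus_distC (disk_inverseK z1) in h *; lra.
  rewrite /g disk_inverseK // (fE z); apply/eqP; rewrite -subr_eq0; apply/eqP; field.
  exact: pz.
exists (fun w => (phi (k w))^-1); first exact: ccontV.
by split; [rewrite disk_inverseK ?phip|move=> w; rewrite gE].
Qed.

(** If the derivative vanishes at [p], it is nonzero at nearby points, so the inverse is holomorphic
    and bounded around [f p] except at [f p] itself, hence Lipschitz there. Thus
    [N (z - p) <= K * N (f z - f p)], while derivative 0 gives
    [N (f z - f p) <= (2 * K)^-1 * N (z - p)]. *)
Lemma univalent_derivative_neq0 p l : N p < 1 -> has_derivative f p l -> l != 0.
Proof.
move=> p1 hl; apply/eqP => l0; rewrite {l}l0 in hl.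
pose r := 1 - N p; have r0 : 0 < r by rewrite subr_gt0.
have inD z : N z < r -> N (p + z) < 1.
  by move=> zr; have := modulusD p z; rewrite /r in zr; lra.
have [d d0 hd] : exists2 d, 0 < d & forall z l, 0 < N z < d ->
    has_derivative (fun w => f (p + w) - f p) z l -> l != 0.
  apply: (@critical_point_isolated _ r) => //; first by rewrite addr0 subrr.
    move=> z zr; have [L hL] := fhol (inD z zr).
    by exists L; exact: has_derivative_shift.
  move=> z /andP[z0 zr]; rewrite subr_eq0; apply/eqP => /finj E.
  have := E (inD z zr) p1 => /eqP; rewrite -subr_eq0 addrAC subrr add0r.
  by rewrite -modulus_eq0 gt_eqF.
have [e e0 he] := univalent_open p1 (half_gt0 d0).
have khol w : 0 < N (w - f p) < e -> holo_at k w.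
  move=> /andP[w0 /he[z [z1 zp E]]]; rewrite -E.
  have zp0 : 0 < N (z - p).
    rewrite modulus_gt0 subr_eq0; apply/eqP => zpE.
    by move: w0; rewrite -E zpE subrr modulus0 ltxx.
  have [L hL] := fhol z1; exists L^-1; apply: disk_inverse_derivative => //.
  apply: (hd (z - p)); first by rewrite zp0 /=; lra.
  by apply: has_derivative_shift; rewrite addrC subrK.
have kM w : 0 < N (w - f p) < e -> N (k w) <= 1.
  by move=> /andP[_ /he[z [z1 _ <-]]]; rewrite disk_inverseK // ltW.
have [K K0 lip] : exists2 K, 0 < K & forall z z1, 0 < N (z - f p) < e / 2 ->
    0 < N (z1 - f p) < e / 2 -> N (k z - k z1) <= K * N (z - z1).
  exists (4 * 1 / e); first by rewrite mulr1 divr_gt0.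
  exact: bounded_holo_lipschitz e0 ltr01 khol kM.
have kL w : 0 < N (w - f p) < e / 2 -> N (k w - p) <= K * N (w - f p).
  move=> wd; apply/ler_addgt0Pr => x x0.
  have x1 : 0 < Num.min (x / 2) (x / 2 / K) by rewrite lt_min half_gt0 // divr_gt0 // half_gt0.
  have [y y0 hy] := disk_inverse_cont p1 (half_gt0 x0).
  pose m := Num.min (Num.min y (e / 2)) (x / 2 / K).
  have m0 : 0 < m by rewrite /m !lt_min y0 half_gt0 //= divr_gt0 // half_gt0.
  have m1 : m <= y by rewrite /m !ge_min lexx.
  have m2 : m <= e / 2 by rewrite /m !ge_min lexx orbT.
  have m3 : m <= x / 2 / K by rewrite /m !ge_min lexx orbT.
  pose v := f p + (m / 2)%:C.
  have Nv : N (v - f p) = m / 2 by rewrite /v addrC addKr modulus_posreal //; lra.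
  have vd : 0 < N (v - f p) < e / 2 by rewrite Nv; lra.
  have := hy v; rewrite disk_inverseK // Nv => /(_ _) A.
  have A' : N (k v - p) < x / 2 by apply: A; lra.
  have B := lip w v wd vd.
  have D := modulus_tri (k v) (k w) p; have E := modulus_tri (f p) w v.
  rewrite (modulus_distC (f p)) Nv in E.
  have : K * N (w - v) <= K * (N (w - f p) + m / 2) by rewrite ler_pM2l.
  have : K * m <= x / 2 by rewrite mulrC -ler_pdivlMr.
  lra.
have K1 : 0 < (2 * K)^-1 by rewrite invr_gt0 mulr_gt0.
move/has_derivativeP: (hl) => /(_ _ K1)[y y0 hy].
have [y' y'0 hy'] := has_derivative_cont hl (half_gt0 e0).
pose m := Num.min (Num.min y y') r / 2.
have M0 : 0 < Num.min (Num.min y y') r by rewrite !lt_min y0 y'0.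
have M1 : Num.min (Num.min y y') r <= y by rewrite !ge_min lexx.
have M2 : Num.min (Num.min y y') r <= y' by rewrite !ge_min lexx orbT.
have M3 : Num.min (Num.min y y') r <= r by rewrite !ge_min lexx orbT.
have m0 : 0 < m by rewrite /m; lra.
pose z := p + m%:C.
have Nz : N (z - p) = m by rewrite /z addrC addKr modulus_posreal // ltW.
have z1 : N z < 1 by apply: inD; rewrite modulus_posreal ?(ltW m0) // /m; lra.
have zy : N (z - p) < y by rewrite Nz /m; lra.
have zy' : N (z - p) < y' by rewrite Nz /m; lra.
have := hy z zy; rewrite mul0r subr0 Nz => A.
have fz : 0 < N (f z - f p).
  rewrite modulus_gt0 subr_eq0; apply/eqP => /finj E.
  by have := E z1 p1 => E'; move: Nz; rewrite E' subrr modulus0; lra.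
have := kL (f z); rewrite fz (hy' z zy') disk_inverseK // Nz => /(_ isT) B.
have : K * N (f z - f p) <= K * ((2 * K)^-1 * m) by rewrite ler_pM2l.
have -> : K * ((2 * K)^-1 * m) = m / 2 by field; rewrite gt_eqF.
lra.
Qed.

Lemma disk_inverse_holo z : N z < 1 -> holo_at k (f z).
Proof.
move=> z1; have [l hl] := fhol z1; exists l^-1; apply: disk_inverse_derivative => //.
exact: univalent_derivative_neq0 hl.
Qed.

Lemma mobius_derivative (a : C) : N a < 1 ->
  has_derivative (mobius (- a)) a (1 - N a ^+ 2)%:C^-1.
Proof.
move=> a1.
have D0 : 1 + (- a)^* * a != 0 by apply: one_add_conj_neq0; rewrite ?modulusN // ltW.
have h1 : has_derivative (fun z : C => z + - a) a (1 + 0).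
  by apply: has_derivativeD; [exact: has_derivative_id|exact: has_derivative_cst].
have h2 : has_derivative (fun z : C => 1 + (- a)^* * z) a (0 + (0 * a + (- a)^* * 1)).
  apply: has_derivativeD; first exact: has_derivative_cst.
  by apply: has_derivativeM; [exact: has_derivative_cst|exact: has_derivative_id].
have := has_derivativeM h1 (@has_derivativeV _ (fun z : C => 1 + (- a)^* * z) a _ D0 h2).
rewrite subrr mul0r addr0 addr0 mul1r.
have -> : 1 + (- a)^* * a = (1 - N a ^+ 2)%:C.
  by rewrite rmorphN mulNr mulrC mul_conj realCB.
by [].
Qed.

(** * Subordination to an injective map *)

Section Subordinate.
Variables (h : C -> C) (z0 m l : C).
Hypothesis hhol : forall z, N z < 1 -> holo_at h z.
Hypothesis hin : forall z, N z < 1 -> exists2 y, N y < 1 & f y = h z.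
Hypothesis z01 : N z0 < 1.
Hypothesis h0 : h 0 = f z0.
Hypothesis dh : has_derivative h 0 m.
Hypothesis df : has_derivative f z0 l.

(** The self-map of the disk fixing 0 to which the Schwarz lemma is applied: [h] pulled back by [f],
    with the base point [z0] moved to 0. *)
Let psi z := mobius (- z0) (k (h z)).

Let kh1 z : N z < 1 -> N (k (h z)) < 1.
Proof. by move=> /hin[y y1 <-]; rewrite disk_inverseK. Qed.

Let psi_holo z : N z < 1 -> holo_at psi z.
Proof.
move=> z1; apply: (@holo_comp _ (fun z => k (h z)) (mobius (- z0))).
  apply: holo_comp; first exact: hhol.
  by have [y y1 <-] := hin z1; exact: disk_inverse_holo.
by apply: holo_mobius; rewrite ?modulusN // ltW // kh1.
Qed.

Let psi_le1 z : N z < 1 -> N (psi z) <= 1.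
Proof. by move=> z1; apply/ltW/mobius_lt1; rewrite ?modulusN // kh1. Qed.

Let psi0 : psi 0 = 0.
Proof. by rewrite /psi h0 disk_inverseK // /mobius subrr mul0r. Qed.

Let dpsi : has_derivative psi 0 ((1 - N z0 ^+ 2)%:C^-1 * (l^-1 * m)).
Proof.
apply: (@has_derivative_comp _ (fun z => k (h z)) (mobius (- z0))).
  apply: has_derivative_comp => //; rewrite h0; apply: disk_inverse_derivative => //.
  exact: univalent_derivative_neq0 df.
by rewrite h0 disk_inverseK //; exact: mobius_derivative.
Qed.

Let dpsi_modulus : N ((1 - N z0 ^+ 2)%:C^-1 * (l^-1 * m)) = N m / (N l * (1 - N z0 ^+ 2)).
Proof.
have a0 : 0 <= 1 - N z0 ^+ 2 by rewrite subr_ge0 exprn_ile1 ?modulus_ge0 // ltW.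
by rewrite !modulusM !modulusV modulus_posreal // invfM; ring.
Qed.

Let den_gt0 : 0 < N l * (1 - N z0 ^+ 2).
Proof.
rewrite mulr_gt0 //; first by rewrite modulus_gt0; exact: univalent_derivative_neq0 df.
by rewrite subr_gt0 exprn_ilt1 ?modulus_ge0.
Qed.

Lemma subordinate_derivative : N m <= N l * (1 - N z0 ^+ 2).
Proof.
have := schwarz_derivative psi_holo psi_le1 psi0 dpsi.
by rewrite dpsi_modulus ler_pdivrMr // mul1r.
Qed.

(** Equality makes the derivative of [psi] unimodular, so [psi] is a rotation by rigidity, and [h]
    has the same image as [f]. *)
Lemma subordinate_onto z : N m = N l * (1 - N z0 ^+ 2) -> N z < 1 ->
  exists2 y, N y < 1 & h y = f z.
Proof.
move=> E z1; set q := (1 - N z0 ^+ 2)%:C^-1 * (l^-1 * m).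
have q1 : N q = 1 by rewrite dpsi_modulus E divff // gt_eqF.
have q0 : q != 0 by rewrite -modulus_gt0 q1.
have rig w := @schwarz_rigidity R psi q w psi_holo psi_le1 psi0 dpsi q1.
pose y := mobius (- z0) z / q.
have y1 : N y < 1.
  by rewrite modulusM modulusV q1 invr1 mulr1; apply: mobius_lt1; rewrite ?modulusN.
have qy : q * y = mobius (- z0) z by rewrite /y [q * _]mulrC divfK.
exists y => //; have := rig y y1; rewrite qy /psi => Ey.
have : k (h y) = z.
  by rewrite -(mobiusK z01 (kh1 y1)) Ey mobiusK.
by have [x x1 <-] := hin y1; rewrite disk_inverseK // => ->.
Qed.

End Subordinate.
End Univalent.
End InjectiveHolomorphic.

(** * The conformal radius of a convex domain *)

Section ConvexMap.
Variable R : realType.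
Local Notation C := (CC R).
Local Notation N := (@modulus R).
Local Notation Re := complex.Re.

Definition cone_at (A : C -> Prop) (v : C) :=
  forall (r : R) w, 0 < r -> A w -> A (v + r%:C * (w - v)).

(** Expand [0 <= (N (1 + y) - 1) ^+ 2]. *)
Lemma modulus_one_add (y : C) : N (1 + y) <= 1 + Re y + N y ^+ 2 / 2.
Proof.
have E : N (1 + y) ^+ 2 = 1 + 2 * Re y + N y ^+ 2.
  by rewrite !modulus_sq; case: y => p q /=; ring.
have y0 := modulus_ge0 (1 + y).
have := sqr_ge0 (N (1 + y) - 1); rewrite sqrrB1 E; lra.
Qed.

Lemma mobius_derivative0 (a : C) : N a < 1 ->
  has_derivative (mobius a) 0 (1 - N a ^+ 2)%:C.
Proof.
move=> a1.
have D0 : 1 + a^* * 0 != 0 by rewrite mulr0 addr0 oner_eq0.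
have h1 : has_derivative (fun z : C => z + a) 0 (1 + 0).
  by apply: has_derivativeD; [exact: has_derivative_id|exact: has_derivative_cst].
have h2 : has_derivative (fun z : C => 1 + a^* * z) 0 (0 + (0 * 0 + a^* * 1)).
  apply: has_derivativeD; first exact: has_derivative_cst.
  by apply: has_derivativeM; [exact: has_derivative_cst|exact: has_derivative_id].
have := has_derivativeM h1 (@has_derivativeV _ (fun z : C => 1 + a^* * z) 0 _ D0 h2).
have -> : (1 + 0) / (1 + a^* * 0) + (0 + a) * (- (0 + (0 * 0 + a^* * 1)) / (1 + a^* * 0) ^+ 2) =
   (1 - N a ^+ 2)%:C :> C.
  by rewrite realCB -mul_conj !mulr0 !addr0 expr1n -[1%:C]/(1 : C) !divr1; ring.
by [].
Qed.

Variables (f g : C -> C) (a : C).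
Hypothesis finj : forall z w, N z < 1 -> N w < 1 -> f z = f w -> z = w.
Hypothesis fder : forall z, N z < 1 -> has_derivative f z (g z).
Hypothesis f0 : f 0 = 0.
Hypothesis g0 : g 0 = 1.
Hypothesis dg0 : has_derivative g 0 (2 * a).

Definition image (w : C) := exists2 z, N z < 1 & f z = w.
Local Notation O := image.

Hypothesis cvx : forall (u v : C) (t : R), O u -> O v -> 0 <= t <= 1 ->
  O ((1 - t)%:C * u + t%:C * v).

Let fhol z : N z < 1 -> holo_at f z.
Proof. by move=> z1; exists (g z); exact: fder. Qed.

Lemma image0 : O 0.
Proof. by exists 0; rewrite ?modulus0. Qed.

(** The conformal radius of the image at [f z], as a function of [z]. *)
Definition radius (z : C) : R := N (g z) * (1 - N z ^+ 2).

(* Since the conformal radius at [t w] is [1 + 2 t Re (a w) + o(t)], the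
   Schwarz-Pick inequality for the competitors [h] bounds [kappa]. *)
Lemma first_variation (w : C) (kappa eps : R) : 0 < eps ->
  (forall t, 0 < t < eps -> exists h, [/\ forall z, N z < 1 -> holo_at h z,
     forall z, N z < 1 -> O (h z), h 0 = t%:C * w & has_derivative h 0 (1 + t * kappa)%:C]) ->
  kappa <= 2 * Re (a * w).
Proof.
move=> eps0 H; apply/ler_addgt0Pr => e e0.
have w0 := modulus_ge0 w; have a0 := modulus_ge0 a.
(* [K] dominates the coefficient with which the relative error [e1] of both first-order expansions
   enters [A3]. *)
pose K := N w * (4 + 2 * N a) + 1; have K0 : 0 < K by rewrite /K; nra.
pose e1 := Num.min 1 (e / (2 * K)).
have e10 : 0 < e1 by rewrite /e1 lt_min ltr01 divr_gt0 // mulr_gt0.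
have e11 : e1 <= 1 by rewrite /e1 ge_min lexx.
have e12 : e1 * K <= e / 2.
  have h : e1 <= e / (2 * K) by rewrite /e1 ge_min lexx orbT.
  have := ler_wpM2r (ltW K0) h.
  by have -> : e / (2 * K) * K = e / 2 by field; rewrite gt_eqF.
clearbody e1; have D0 : N (0 : C) < 1 by rewrite modulus0.
have dk : has_derivative (disk_inverse f) 0 1.
  have h1 : has_derivative f 0 1 by rewrite -g0; exact: fder.
  by rewrite -invr1 -{1}f0; apply: disk_inverse_derivative => //; exact: oner_neq0.
move/has_derivativeP: dk => /(_ _ e10)[d1 d10 hd1].
move/has_derivativeP: dg0 => /(_ _ e10)[d2 d20 hd2].
pose M := N w + 1; have M0 : 0 < M by rewrite /M; lra.
pose L := (2 * N (a * w)) ^+ 2 + 1; have L0 : 0 < L by rewrite /L ltr_wpDl ?sqr_ge0.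
pose t := Num.min (Num.min (eps / 2) (d1 / (2 * M))) (Num.min (d2 / (4 * M)) (e / L)).
have t0 : 0 < t.
  by rewrite /t !lt_min half_gt0 //= !divr_gt0 // mulr_gt0.
have t1 : t <= eps / 2 by rewrite /t !ge_min lexx.
have t2 : t * (2 * M) <= d1 by rewrite -ler_pdivlMr ?mulr_gt0 // /t !ge_min lexx ?orbT.
have t3 : t * (4 * M) <= d2 by rewrite -ler_pdivlMr ?mulr_gt0 // /t !ge_min lexx ?orbT.
have t4 : t * L <= e by rewrite -ler_pdivlMr // /t !ge_min lexx ?orbT.
clearbody t; have [|h [hh hO h0 dh]] := H t; first by rewrite t0 /=; lra.
have [z z1 fz] : O (t%:C * w) by rewrite -h0; apply: hO; rewrite modulus0.
have S := subordinate_derivative fhol finj hh hO z1 (etrans h0 (esym fz)) dh (fder z1).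
have tw : N (t%:C * w) = t * N w by rewrite modulusM modulus_posreal // ltW.
have kz : disk_inverse f (t%:C * w) = z by rewrite -fz disk_inverseK.
have k0 : disk_inverse f 0 = 0 by rewrite -{1}f0 disk_inverseK.
(* The inverse has derivative 1 at 0, so the preimage of [t%:C * w] is [t%:C * w] to first order. *)
have A1 : N (z - t%:C * w) <= e1 * (t * N w).
  have := hd1 (t%:C * w); rewrite kz k0 !subr0 mul1r tw; apply.
  by rewrite /M in t2; nra.
have zb : N z <= 2 * (t * N w).
  have tw0 : 0 <= t * N w by rewrite mulr_ge0 // ltW.
  have := modulusD (z - t%:C * w) (t%:C * w); rewrite subrK tw.
  have : e1 * (t * N w) <= 1 * (t * N w) by rewrite ler_wpM2r.
  lra.
have A2 : N (g z - 1 - 2 * a * z) <= e1 * N z.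
  have := hd2 z; rewrite g0 !subr0; apply.
  by rewrite /M in t3; nra.
have A3 : N (g z) <= 1 + 2 * t * Re (a * w) + t ^+ 2 * (2 * N (a * w)) ^+ 2 / 2 +
    e1 * (t * (N w * (2 + 2 * N a))).
  have -> : g z = (1 + 2 * t%:C * (a * w)) + (2 * a * (z - t%:C * w) + (g z - 1 - 2 * a * z)) by ring.
  have B1 := modulus_one_add (2 * t%:C * (a * w)).
  have E2 : 2 * t%:C = (2 * t)%:C :> C by rewrite realCM realC_nat.
  rewrite E2 ReZ modulusM modulus_posreal in B1; last by rewrite mulr_ge0 // ltW.
  have B2 : N (2 * a * (z - t%:C * w)) <= 2 * N a * (e1 * (t * N w)).
    by rewrite 2!modulusM -realC_nat modulus_posreal // ler_wpM2l // mulr_ge0.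
  have B3 : e1 * N z <= e1 * (2 * (t * N w)) by rewrite ler_pM2l.
  have B4 := modulusD (1 + (2 * t)%:C * (a * w)) (2 * a * (z - t%:C * w) + (g z - 1 - 2 * a * z)).
  have B5 := modulusD (2 * a * (z - t%:C * w)) (g z - 1 - 2 * a * z).
  rewrite E2; apply: (le_trans B4).
  have -> : t ^+ 2 * (2 * N (a * w)) ^+ 2 / 2 = (2 * t * N (a * w)) ^+ 2 / 2 by ring.
  by clear -A2 B1 B2 B3 B5; lra.
(* The factor [1 - N z ^+ 2] of the conformal radius is dropped; it is at most 1. *)
have A4 : 1 + t * kappa <= N (g z).
  apply: (@le_trans _ _ (N (1 + t * kappa)%:C)); first by rewrite modulus_real ler_norm.
  by rewrite (le_trans S) // ler_piMr ?modulus_ge0 // gerBl sqr_ge0.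
have A5 : t * kappa <= t * (2 * Re (a * w) + t * L / 2 + e1 * K).
  have : 0 <= t * (t / 2 + e1 * (N w * 2 + 1)).
    apply: mulr_ge0; first exact: ltW.
    apply: addr_ge0; first by rewrite ltW // half_gt0.
    by apply: mulr_ge0; [exact: ltW|lra].
  by rewrite /L /K; lra.
by rewrite ler_pM2l // in A5; lra.
Qed.

Lemma radius_tangent z : N z < 1 -> radius z <= 1 + 2 * Re (a * f z).
Proof.
move=> z1; rewrite -lerBlDl.
have gz0 : g z != 0 by apply: univalent_derivative_neq0 (fder z1).
have Ng0 : 0 < N (g z) by rewrite modulus_gt0.
(* The rotation that makes the derivative of [f (mobius z (lam * z'))] at 0 real and positive, equal
   to [radius z]. The competitor then has derivative [1 + t * (radius z - 1)]. *)
pose lam : C := (N (g z))%:C / g z.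
have Nlam : N lam = 1 by rewrite modulusM modulusV modulus_posreal ?divff ?gt_eqF // ltW.
apply: (@first_variation _ _ 1) => // t /andP[t0 t1].
pose u z' := mobius z (lam * z').
have lam1 z' : N z' < 1 -> N (lam * z') < 1 by rewrite modulusM Nlam mul1r.
have u1 z' : N z' < 1 -> N (u z') < 1 by move=> h; apply: mobius_lt1 => //; exact: lam1.
have hlam (z' : C) : has_derivative (fun v => lam * v) z' (0 * z' + lam * 1).
  by apply: has_derivativeM; [exact: has_derivative_cst|exact: has_derivative_id].
have uhol z' : N z' < 1 -> holo_at u z'.
  move=> h; apply: (@holo_comp _ (fun v => lam * v) (mobius z)).
    by eexists; exact: hlam.
  by apply: holo_mobius => //; exact/ltW/lam1.
have u0 : u 0 = z by rewrite /u mulr0 mobius0.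
exists (fun z' => (1 - t)%:C * f z' + t%:C * f (u z')); split.
- move=> z' h; apply: holoD.
    by apply: holoM; [exact: holo_cst|exact: fhol].
  apply: holoM; first exact: holo_cst.
  by apply: holo_comp; [exact: uhol|apply: fhol; exact: u1].
- move=> z' h; apply: cvx; first by exists z'.
    by exists (u z') => //; exact: u1.
  by rewrite !ltW.
- by rewrite u0 f0 mulr0 add0r.
have h1 : has_derivative f 0 1 by rewrite -g0; apply: fder; rewrite modulus0.
have h2 : has_derivative u 0 ((1 - N z ^+ 2)%:C * (0 * 0 + lam * 1)).
  apply: (@has_derivative_comp _ (fun v => lam * v) (mobius z)) => //.
  by rewrite mulr0; exact: mobius_derivative0.
have h3 := has_derivative_comp h2 (_ : has_derivative f (u 0) (g z)).
have {}h3 : has_derivative (fun z' => f (u z')) 0 (g z * ((1 - N z ^+ 2)%:C * (0 * 0 + lam * 1))).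
  by apply: h3; rewrite u0; exact: fder.
have := has_derivativeD (has_derivativeM (has_derivative_cst (1 - t)%:C 0) h1)
  (has_derivativeM (has_derivative_cst t%:C 0) h3).
set l1 := (X in has_derivative _ _ X); suff -> : l1 = (1 + t * (radius z - 1))%:C by [].
rewrite /l1 /radius !mul0r !add0r !mulr1.
have -> : g z * ((1 - N z ^+ 2)%:C * lam) = (N (g z) * (1 - N z ^+ 2))%:C.
  by rewrite realCM /lam; field.
by rewrite -realCM -realCD; congr (_%:C); ring.
Qed.

Lemma radius_gt0 z : N z < 1 -> 0 < radius z.
Proof.
move=> z1; rewrite mulr_gt0 //; last by rewrite subr_gt0 exprn_ilt1 ?modulus_ge0.
by rewrite modulus_gt0; exact: univalent_derivative_neq0 (fder z1).
Qed.

Lemma image_half_plane w : O w -> 0 < 1 + 2 * Re (a * w).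
Proof. by move=> [z z1 <-]; exact: lt_le_trans (radius_gt0 z1) (radius_tangent z1). Qed.

Lemma cone_vertex_critical v : cone_at O v -> 1 + 2 * Re (a * v) = 0.
Proof.
move=> cone.
have h1 : has_derivative f 0 1 by rewrite -g0; apply: fder; rewrite modulus0.
(* Homotheties about [v] of ratio [1 + s], for [s] of both signs: [s = - t] is a variation towards
   [v] with [kappa = -1], [s = t] one towards [- v] with [kappa = 1]. *)
have fam (s : R) : 0 < 1 + s ->
    exists h, [/\ forall z, N z < 1 -> holo_at h z, forall z, N z < 1 -> O (h z),
      h 0 = - s%:C * v & has_derivative h 0 (1 + s)%:C].
  move=> s0; exists (fun z => v + (1 + s)%:C * (f z - v)); split.
  - move=> z z1; apply: holoD; first exact: holo_cst.
    apply: holoM; first exact: holo_cst.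
    by apply: holoB; [exact: fhol|exact: holo_cst].
  - by move=> z z1; apply: cone => //; exists z.
  - by rewrite f0 realCD -[1%:C]/(1 : C); ring.
  have := has_derivativeD (has_derivative_cst v 0) (has_derivativeM (has_derivative_cst (1 + s)%:C 0)
     (has_derivativeD h1 (has_derivative_cst (- v) 0))).
  set l1 := (X in has_derivative _ _ X); suff -> : l1 = (1 + s)%:C by [].
  by rewrite /l1 mul0r !add0r addr0 mulr1.
have A : -1 <= 2 * Re (a * v).
  apply: (@first_variation _ _ 1) => // t /andP[t0 t1].
  have [|h [h2 h3 h4 h5]] := fam (- t); first lra.
  by exists h; split => //; [rewrite h4 realCN opprK|rewrite mulrN1].
have B : 1 <= 2 * Re (a * - v).
  apply: (@first_variation _ _ 1) => // t /andP[t0 t1].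
  have [|h [h2 h3 h4 h5]] := fam t; first lra.
  by exists h; split => //; [rewrite h4 mulNr mulrN|rewrite mulr1].
by move: B; rewrite mulrN ReN; lra.
Qed.

Lemma critical_vertex_cone u :
  (forall w t, O w -> 0 <= t < 1 -> O ((1 - t)%:C * w + t%:C * u)) ->
  1 + 2 * Re (a * u) = 0 -> cone_at O u.
Proof.
move=> star crit.
have onto t w : 0 < t < 1 -> O w -> exists2 w', O w' & w = (1 - t)%:C * w' + t%:C * u.
  move=> /andP[t0 t1] [z z1 <-].
  have t01 : 0 <= t < 1 by rewrite (ltW t0).
  have := star 0 t image0 t01; rewrite mulr0 add0r => -[z0 z01 fz0].
  have h1 : has_derivative f 0 1 by rewrite -g0; apply: fder; rewrite modulus0.
  have dh : has_derivative (fun z => (1 - t)%:C * f z + t%:C * u) 0 (1 - t)%:C.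
    have := has_derivativeD (has_derivativeM (has_derivative_cst (1 - t)%:C 0) h1)
      (has_derivative_cst (t%:C * u) 0).
    by rewrite mul0r add0r mulr1 addr0.
  have hhol z' : N z' < 1 -> holo_at (fun z => (1 - t)%:C * f z + t%:C * u) z'.
    move=> z'1; apply: holoD; last exact: holo_cst.
    by apply: holoM; [exact: holo_cst|exact: fhol].
  have hO z' : N z' < 1 -> O ((1 - t)%:C * f z' + t%:C * u).
    by move=> z'1; apply: star => //; exists z'.
  have h0 : (1 - t)%:C * f 0 + t%:C * u = f z0 by rewrite f0 mulr0 add0r fz0.
  have Nm : N (1 - t)%:C = 1 - t by rewrite modulus_posreal // subr_ge0 ltW.
  have up := subordinate_derivative fhol finj hhol hO z01 h0 dh (fder z01).
  have down := radius_tangent z01.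
  (* Schwarz-Pick gives one inequality and [radius_tangent] at [f z0 = t%:C * u] the other; the two
     bounds agree because [u] is critical. *)
  have E : N (1 - t)%:C = N (g z0) * (1 - N z0 ^+ 2).
    apply/le_anti/andP; split; first exact: up.
    rewrite (le_trans down) // fz0 Nm mulrCA ReZ.
    have -> : 1 + 2 * (t * Re (a * u)) = 1 - t + t * (1 + 2 * Re (a * u)) by ring.
    by rewrite crit mulr0 addr0.
  have [y y1 hy] := subordinate_onto fhol finj hhol hO z01 h0 dh (fder z01) E z1.
  by exists (f y); [exists y|rewrite hy].
(* Contractions about [u] stay in the image by [star]; an expansion of ratio [r] undoes the
   contraction with [t = 1 - r^-1], which is onto. *)
move=> r w r0 Ow; have [r1|r1|->] := ltgtP r 1.
- have -> : u + r%:C * (w - u) = (1 - (1 - r))%:C * w + (1 - r)%:C * u.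
    by rewrite !realCB -[1%:C]/(1 : C); ring.
  by apply: star => //; lra.
- have ri : 0 < r^-1 < 1 by rewrite invr_gt0 r0 invf_lt1.
  have [|w' Ow' ->] := onto (1 - r^-1) w _ Ow; first lra.
  suff -> : u + r%:C * ((1 - (1 - r^-1))%:C * w' + (1 - r^-1)%:C * u - u) = w' by [].
  have rC : r%:C != 0 :> C by rewrite -modulus_gt0 modulus_posreal // ltW.
  by rewrite !realCB realCV -[1%:C]/(1 : C); field.
- by rewrite -[1%:C]/(1 : C) mul1r addrC subrK.
Qed.

End ConvexMap.

(** * Unbounded plane convex sets *)

Section PlaneConvexity.
Variable R : realType.
Local Notation C := (CC R).
Local Notation N := (@modulus R).
Local Notation Re := complex.Re.
Implicit Types (z w u v d : C) (s t r : R).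

Lemma polar_right y : 0 < Re y ->
  exists r t, [/\ 0 < r, - (pi / 2) < t < pi / 2 & y = r%:C * cis t].
Proof.
case: y => p q /= p0; pose t := atan (q / p).
have tb : - (pi / 2) < t < pi / 2 by rewrite atan_gtNpi2 atan_ltpi2.
have c0 : 0 < cos t by exact: cos_gt0_pihalf.
have tn : sin t / cos t = q / p by have := atanK (q / p); rewrite -/t /tan.
exists (p / cos t), t; split => //; first exact: divr_gt0.
apply: complexP => /=; rewrite mul0r ?subr0 ?addr0; first by rewrite divfK // gt_eqF.
by rewrite mulrAC -mulrA tn mulrC divfK // gt_eqF.
Qed.

Lemma polar_form y : y != 0 -> exists r t, 0 < r /\ y = r%:C * cis t.
Proof.
case: y => p q y0; have [p0|p0|p0] := ltgtP p 0.
- have [|r [t [r0 _ E]]] := @polar_right (- (p +i* q)); first by rewrite /= oppr_gt0.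
  exists r, (t + pi); split => //; rewrite -[LHS]opprK E -mulrN; congr (_ * _).
  by apply: complexP => /=; rewrite ?cosDpi ?sinDpi.
- by have [|r [t [r0 _ E]]] := @polar_right (p +i* q) => //; exists r, t.
- have [q0|q0|q0] := ltgtP q 0.
  + exists (- q), (- (pi / 2)); split; first by rewrite oppr_gt0.
    by apply: complexP => /=; rewrite ?cosN ?sinN cos_pihalf sin_pihalf ?p0; ring.
  + exists q, (pi / 2); split => //.
    by apply: complexP => /=; rewrite cos_pihalf sin_pihalf ?p0; ring.
  + by move: y0; rewrite p0 q0 eqxx.
Qed.

Lemma Re_mul_cis s t : Re ((cis s)^* * cis t) = cos (t - s).
Proof. by rewrite /= cosB; ring. Qed.

Variable A : C -> Prop.
Hypothesis A_open : forall z, A z -> exists2 e, 0 < e & forall w, N (w - z) < e -> A w.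
Hypothesis A_convex : forall u v t, A u -> A v -> 0 <= t <= 1 ->
  A ((1 - t)%:C * u + t%:C * v).
Hypothesis A0 : A 0.

Definition adherent y := forall e : R, 0 < e -> exists2 w, A w & N (w - y) < e.

Lemma open_convex_adherent x y t : A x -> adherent y -> 0 <= t < 1 ->
  A ((1 - t)%:C * x + t%:C * y).
Proof.
move=> Ax ady /andP[t0 t1]; have [e e0 he] := A_open Ax.
have [->|tn0] := eqVneq t 0.
  by rewrite subr0 -[1%:C]/(1 : C) -[0%:C]/(0 : C) mul1r mul0r addr0.
have tp : 0 < t by rewrite lt_def tn0.
have s0 : 0 < 1 - t by rewrite subr_gt0.
have sC : (1 - t)%:C != 0 :> C by rewrite -modulus_gt0 modulus_posreal // ltW.
have [y' Ay' hy'] := ady (e * (1 - t) / t) (divr_gt0 (mulr_gt0 e0 s0) tp).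
(* Replacing [y] by a nearby [y'] in the set is compensated by moving [x] within its open
   neighbourhood. *)
pose x' := x + t%:C / (1 - t)%:C * (y - y').
have -> : (1 - t)%:C * x + t%:C * y = (1 - t)%:C * x' + t%:C * y'.
  by rewrite /x'; move: (1 - t)%:C sC => S sC; field.
apply: A_convex => //; last by rewrite t0 ltW.
apply: he; rewrite /x' addrC addKr 2!modulusM modulusV.
rewrite !modulus_posreal ?(ltW s0) // modulus_distC.
by rewrite mulrAC ltr_pdivrMr // mulrC -ltr_pdivlMr.
Qed.

Definition recession d := forall w s, A w -> 0 <= s -> A (w + s%:C * d).

(** Write [w + s%:C * d] as a combination of [w / (1 - q)%:C], still in the open set for small [q],
    and of the adherent point [(s / q)%:C * d] with weight [q]. *)
Lemma adherent_ray_recession d : (forall s, 0 <= s -> adherent (s%:C * d)) -> recession d.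
Proof.
move=> ray w s Aw s0; have [e e0 he] := A_open Aw; have w0 := modulus_ge0 w.
pose q := Num.min (1 / 2) (e / (4 * (N w + 1))).
have q0 : 0 < q by rewrite /q lt_min divr_gt0 //= divr_gt0 // mulr_gt0 // ltr_wpDl.
have q1 : q <= 1 / 2 by rewrite /q ge_min lexx.
have q2 : q * (4 * (N w + 1)) <= e.
  by rewrite -ler_pdivlMr ?mulr_gt0 ?ltr_wpDl // /q ge_min lexx orbT.
have s1 : 0 < 1 - q by lra.
have sC : (1 - q)%:C != 0 :> C by rewrite -modulus_gt0 modulus_posreal // ltW.
have qC : q%:C != 0 :> C by rewrite -modulus_gt0 modulus_posreal // ltW.
have -> : w + s%:C * d = (1 - q)%:C * (w / (1 - q)%:C) + q%:C * ((s / q)%:C * d).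
  by rewrite realCM realCV; move: (1 - q)%:C sC => S sC; field; rewrite qC sC.
apply: open_convex_adherent; last by rewrite ltW //=; lra.
  apply: he; have -> : w / (1 - q)%:C - w = q%:C / (1 - q)%:C * w.
    have E : q%:C = 1 - (1 - q)%:C :> C by rewrite realCB -[1%:C]/(1 : C); ring.
    by rewrite [in RHS]E; move: (1 - q)%:C sC => S sC; field.
  rewrite 2!modulusM modulusV !modulus_posreal ?(ltW s1) ?(ltW q0) //.
  by rewrite mulrAC ltr_pdivrMr //; nra.
by apply: ray; rewrite divr_ge0 // ltW.
Qed.

Lemma scale_in w t : A w -> 0 <= t <= 1 -> A (t%:C * w).
Proof. by move=> Aw t01; have := A_convex A0 Aw t01; rewrite mulr0 add0r. Qed.

(** The direction [d] is a cluster point of the normalized far points: by convexity with 0 the set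
    contains [s%:C * v n] as soon as [s <= N (u n)], so the whole ray along [d] is adherent. *)
Lemma unbounded_recession : (forall M : R, exists2 w, A w & M < N w) ->
  exists2 d, N d = 1 & recession d.
Proof.
move=> unb.
have h n : exists w, A w /\ n.+1%:R < N w by have [w] := unb n.+1%:R; exists w.
have [u hu] := choice h.
have u0 n : 0 < N (u n) by rewrite (le_lt_trans _ (hu n).2).
have uC n : (N (u n))%:C != 0 :> C by rewrite -modulus_gt0 modulus_posreal // ltW.
pose v n := u n / (N (u n))%:C.
have Nv n : N (v n) = 1.
  by rewrite modulusM modulusV modulus_posreal ?divff ?gt_eqF // ltW.
have vB n : N (v n) <= 1 by rewrite Nv.
have [d _ cl] := bolzano_weierstrass vB.
exists d.
  have a n : N (v n - 0) = 1 by rewrite subr0 Nv.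
  have := limit_le cl (fun n => (eq_ind_r (fun x => x <= 1) (lexx 1) (a n))).
  have := limit_ge cl (fun n => (eq_ind_r (fun x => 1 <= x) (lexx 1) (a n))).
  by rewrite subr0 => h1 h2; apply/le_anti; rewrite h1 h2.
apply: adherent_ray_recession => s s0 e e0.
have e1 : 0 < e / (s + 1) by rewrite divr_gt0 // ltr_wpDl.
have [n nn hn] := cl _ (Num.bound s) e1.
have sn : s <= N (u n).
  apply: ltW; apply: (lt_trans (archi_boundP s0)); apply: (le_lt_trans _ (hu n).2).
  by rewrite ler_nat; exact: leqW.
exists (s%:C * v n).
  have -> : s%:C * v n = (s / N (u n))%:C * u n by rewrite /v realCM realCV; ring.
  apply: scale_in; first by have [] := hu n.
  by rewrite divr_ge0 ?modulus_ge0 //= ler_pdivrMr // mul1r.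
rewrite -mulrBr modulusM modulus_posreal //.
rewrite ltr_pdivlMr ?ltr_wpDl // in hn.
by have := modulus_ge0 (v n - d); nra.
Qed.

Lemma not_recession_gap d : ~ recession d -> exists s e, [/\ 0 < s, 0 < e &
  forall w, A w -> e <= N (w - s%:C * d)].
Proof.
move=> nr; apply: contrapT => h; apply: nr; apply: adherent_ray_recession => s s0 e e0.
have [->|sn0] := eqVneq s 0.
  by exists 0 => //; rewrite -[0%:C]/(0 : C) mul0r subrr modulus0.
apply: contrapT => h'; apply: h; exists s, e; split => //; first by rewrite lt_def sn0.
by move=> w Aw; rewrite leNgt; apply/negP => lt; apply: h'; exists w.
Qed.

(** A far point [w] with [w + s%:C * d] of modulus at most [rho] has [s] large, and scaling it by
    [s1 / s] gives a point of the set within [s1 * rho / s] of [s1%:C * - d]. The gap around that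
    point forbids this. *)
Lemma far_ray d (rho : R) : 0 < rho -> N d = 1 -> ~ recession (- d) ->
  exists2 rho', rho < rho' & forall w s, A w -> rho' < N w -> 0 <= s -> rho < N (w + s%:C * d).
Proof.
move=> rho0 d1 nr; have [s1 [e [s10 e0 gap]]] := not_recession_gap nr.
pose S := s1 + s1 * rho / e + 1.
have q0 : 0 < s1 * rho / e by rewrite divr_gt0 // mulr_gt0.
exists (rho + S); first by rewrite /S; lra.
move=> w s Aw wbig s0; rewrite ltNge; apply/negP => small.
have sS : S < s.
  have := modulusB (w + s%:C * d) (s%:C * d); rewrite addrK modulusM d1 mulr1.
  by rewrite modulus_posreal //; lra.
have sp : 0 < s by rewrite /S in sS; lra.
have t01 : 0 <= s1 / s <= 1.
  by rewrite divr_ge0 ?(ltW s10) ?(ltW sp) //= ler_pdivrMr // mul1r; rewrite /S in sS; lra.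
have := gap _ (scale_in Aw t01).
have -> : (s1 / s)%:C * w - s1%:C * - d = (s1 / s)%:C * (w + s%:C * d).
  have sC : s%:C != 0 :> C by rewrite -modulus_gt0 modulus_posreal // ltW.
  by rewrite realCM realCV; field.
rewrite modulusM modulus_posreal ?divr_ge0 ?(ltW s10) ?(ltW sp) // leNgt => /negP; apply.
have : s1 / s * N (w + s%:C * d) <= s1 / s * rho by rewrite ler_wpM2l ?divr_ge0 ?(ltW s10) ?(ltW sp).
move/le_lt_trans; apply; rewrite mulrAC ltr_pdivrMr //.
have : s1 * rho / e < s by rewrite /S in sS; lra.
by rewrite ltr_pdivrMr // [s * e]mulrC.
Qed.

(** Homotheties of ratio [(1 + s)^-1] about [v] and [1 + s] about [u] compose to the translation by
    [s%:C * (v - u)]. *)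
Lemma two_cones_recession u v : cone_at A u -> cone_at A v -> recession (v - u).
Proof.
move=> cu cv w s Aw s0; have s1 : 0 < 1 + s by rewrite ltr_wpDr.
have sC : (1 + s)%:C != 0 :> C by rewrite -modulus_gt0 modulus_posreal // ltW.
have r0 : 0 < (1 + s)^-1 by rewrite invr_gt0.
have := cu _ _ s1 (cv _ _ r0 Aw).
rewrite realCV; set x := _ + _; suff -> : x = w + s%:C * (v - u) by [].
have E : s%:C = (1 + s)%:C - 1 :> C by rewrite realCD -[1%:C]/(1 : C); ring.
by rewrite /x E; move: (1 + s)%:C sC => S sC; field.
Qed.

(** * Convex sets in a half-plane: lines and cones *)

Section HalfPlane.
Variable a : C.
Hypothesis a_neq0 : a != 0.
Hypothesis A_half : forall w, A w -> 0 < 1 + 2 * Re (a * w).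

(** A line inside the half-plane is parallel to its edge, so [Re (a * d) = 0], and the set is a
    union of complete level lines of [Re (a * _)]. *)
Lemma line_recession_slice d : N d = 1 -> recession d -> recession (- d) ->
  forall w w', Re (a * w) = Re (a * w') -> A w' -> A w.
Proof.
move=> d1 rd rd' w w' E Aw'.
have lin s : A (s%:C * d).
  have [s0|s0] := leP 0 s; first by have := rd 0 s A0 s0; rewrite add0r.
  have := rd' 0 (- s) A0; rewrite add0r realCN mulrNN; apply.
  by rewrite oppr_ge0 ltW.
have ad : Re (a * d) = 0.
  have h s : 0 < 1 + 2 * (s * Re (a * d)) by rewrite -ReZ mulrCA; exact: A_half.
  apply/eqP; apply: contraT => n0.
  by have := h (- (Re (a * d))^-1); rewrite mulNr mulVf //; lra.
have ad0 : complex.Im (a * d) != 0.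
  apply: contra_neq a_neq0 => i0; have : a * d = 0 by apply: complexP.
  move/eqP; rewrite mulf_eq0 => /orP[/eqP //|/eqP d0].
  by move: d1; rewrite d0 modulus0 => /esym/eqP; rewrite oner_eq0.
pose s := complex.Im (a * (w - w')) / complex.Im (a * d).
have ws : w = w' + s%:C * d.
  apply: (mulfI a_neq0); rewrite mulrDr mulrCA; apply/eqP; rewrite addrC -subr_eq -mulrBr.
  apply/eqP; apply: complexP.
    by rewrite ReZ ad mulr0 mulrBr ReB E subrr.
  have -> : complex.Im (s%:C * (a * d)) = s * complex.Im (a * d).
    by case: (a * d) => x y /=; ring.
  by rewrite /s divfK.
rewrite ws; have [s0|s0] := leP 0 s; first exact: rd.
have := rd' w' (- s) Aw'; rewrite realCN mulrNN; apply.
by rewrite oppr_ge0 ltW.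
Qed.

Lemma shift_in w : A w -> exists2 e, 0 < e & exists w1 w2, [/\ A w1, A w2,
  Re (a * w1) = Re (a * w) - e & Re (a * w2) = Re (a * w) + e].
Proof.
move=> Aw; have [e e0 he] := A_open Aw.
have a0 : 0 < N a by rewrite modulus_gt0.
pose r := e / (2 * N a); have r0 : 0 < r by rewrite /r divr_gt0 // mulr_gt0.
have rE : r * N a < e.
  have -> : r * N a = e / 2 by rewrite /r; field; rewrite gt_eqF.
  by lra.
have aa : Re (a * a^*) = N a ^+ 2 by rewrite mul_conj.
exists (r * N a ^+ 2); first by rewrite mulr_gt0 // exprn_gt0.
exists (w - r%:C * a^*), (w + r%:C * a^*); split.
- by apply: he; rewrite addrC addKr modulusN modulusM modulus_conj modulus_posreal // ltW.
- by apply: he; rewrite addrC addKr modulusM modulus_conj modulus_posreal // ltW.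
- by rewrite mulrBr mulrCA ReB ReZ aa.
- by rewrite mulrDr mulrCA ReD ReZ aa.
Qed.

(** The set is the preimage under [Re (a * _)] of an open interval that is bounded below; a finite
    or infinite upper end gives the two cases. *)
Lemma line_recession_classification d : N d = 1 -> recession d -> recession (- d) ->
  (exists b1 b2 : R, b1 < b2 /\ forall w, A w <-> b1 < Re (a * w) < b2) \/
  (exists b : R, forall w, A w <-> b < Re (a * w)).
Proof.
move=> d1 rd rd'; have slice := line_recession_slice d1 rd rd'.
pose I : set R := [set x | exists2 w, A w & Re (a * w) = x].
have I0 : I 0 by exists 0; rewrite ?mulr0.
have Ine : I !=set0 by exists 0.
have Il : has_lbound I by exists (- 1) => _ [w Aw <-]; have := A_half Aw; lra.
have Imid x y x' : I x -> I y -> x < x' < y -> I x'.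
  move=> [w Aw <-] [w' Aw' <-] /andP[xz zy].
  pose t := (x' - Re (a * w)) / (Re (a * w') - Re (a * w)).
  have D0 : 0 < Re (a * w') - Re (a * w) by lra.
  exists ((1 - t)%:C * w + t%:C * w').
    apply: A_convex => //; apply/andP; split; first by rewrite divr_ge0 // ltW // subr_gt0.
    by rewrite ler_pdivrMr //; lra.
  rewrite mulrDr !(mulrCA a) ReD !ReZ /t; field.
  by rewrite gt_eqF.
have lo x : I x -> inf I < x.
  move=> [w Aw <-]; have [e e0 [w1 [w2 [A1 A2 E1 E2]]]] := shift_in Aw.
  have : inf I <= Re (a * w1) by apply: ge_inf => //; exists w1.
  by lra.
have inI w x : Re (a * w) = x -> I x -> A w.
  by move=> wx [w' Aw' E]; apply: (slice w w') => //; rewrite wx E.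
have [Iu|nIu] := pselect (has_ubound I).
  left; exists (inf I), (sup I).
  have hi x : I x -> x < sup I.
    move=> [w Aw <-]; have [e e0 [w1 [w2 [A1 A2 E1 E2]]]] := shift_in Aw.
    have : Re (a * w2) <= sup I by apply: ub_le_sup => //; exists w2.
    by lra.
  split; first exact: lt_trans (lo _ I0) (hi _ I0).
  move=> w; split=> [Aw|/andP[w1 w2]].
    have Iw : I (Re (a * w)) by exists w.
    by rewrite lo ?hi.
  have [x Ix xw] := inf_lt Ine w1; have [y Iy wy] := sup_gt Ine w2.
  by apply: (inI w _ erefl); apply: (Imid x y) => //; rewrite xw.
right; exists (inf I) => w; split=> [Aw|w1]; first by apply: lo; exists w.
have [x Ix xw] := inf_lt Ine w1.
have [y Iy wy] : exists2 y, I y & Re (a * w) < y.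
  apply: contrapT => h; apply: nIu; exists (Re (a * w)) => y Iy.
  by rewrite leNgt; apply/negP => lt; apply: h; exists y.
by apply: (inI w _ erefl); apply: (Imid x y) => //; rewrite xw.
Qed.

Lemma cis_near t (e m : R) : 0 < e -> 0 < m -> exists2 d, 0 < d < m &
  N (cis (t - d) - cis t) < e /\ N (cis (t + d) - cis t) < e.
Proof.
move=> e0 m0; have [d d0 hd] := @polar_diff0 R 1 ltr01.
pose y := Num.min (Num.min (d / 2) (e / 4)) (m / 2).
have y0 : 0 < y by rewrite /y !lt_min !half_gt0 //= divr_gt0.
have y1 : y <= d / 2 by rewrite /y !ge_min lexx.
have y2 : y <= e / 4 by rewrite /y !ge_min lexx orbT.
have y3 : y <= m / 2 by rewrite /y !ge_min lexx orbT.
have key x : `|x| = y -> N (cis (t + x) - cis t) < e.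
  move=> xy; rewrite cisD -{2}[cis t]mulr1 -mulrBr modulusM modulus_cis mul1r.
  have := hd 0 x; rewrite normr0 d0 xy => /(_ isT) H.
  have yd : y < d by lra.
  have {H} := H yd; rewrite /polar expR0 -[1%:C]/(1 : C) !mul1r add0r => H.
  have := modulusD (cis x - 1 - (0 +i* x)) (0 +i* x); rewrite subrK.
  have -> : N (0 +i* x) = y by rewrite /modulus /= expr0n add0r sqrtr_sqr.
  lra.
exists y; first (by rewrite y0 /=; lra); split; apply: key; first by rewrite normrN gtr0_norm.
by rewrite gtr0_norm.
Qed.

Lemma cone_classification v : cone_at A v -> 1 + 2 * Re (a * v) = 0 ->
  (forall w, A w <-> - (1 / 2) < Re (a * w)) \/
  exists theta alpha : R, 0 < alpha < pi /\ forall w, A w <-> sector v theta alpha w.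
Proof.
move=> cone av; have [ra [b [ra0 aE]]] := polar_form a_neq0.
have p0 := @pi_gt0 R.
(* Directions of the cone, with angles shifted by [b = arg a] so that the half-plane condition reads
   [- (pi / 2) < t < pi / 2]. *)
pose T : set R := [set t | - (pi / 2) < t < pi / 2 /\ A (v + cis (t - b))].
have rel w : A w -> 0 < Re (a * (w - v)).
  by move=> /A_half; rewrite mulrBr ReB; lra.
have raC : ra%:C != 0 :> C by rewrite -modulus_gt0 modulus_posreal // ltW.
have unit_cis t : cis t * cis (- t) = 1 by rewrite -cisD subrr /cis cos0 sin0.
have coneE r t : 0 < r -> A (v + cis t) <-> A (v + r%:C * cis t).
  move=> r0; have rC : r%:C != 0 :> C by rewrite -modulus_gt0 modulus_posreal // ltW.
  split=> h; first by have := cone r _ r0 h; rewrite [v + cis t]addrC addrK.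
  have ri : 0 < r^-1 by rewrite invr_gt0.
  have := cone _ _ ri h; rewrite [v + r%:C * _]addrC addrK realCV mulrA mulVf // mul1r.
  by [].
have polarA w : 0 < Re (a * (w - v)) -> exists r t, [/\ 0 < r, - (pi / 2) < t < pi / 2 &
    w = v + r%:C * cis (t - b)].
  move=> /polar_right[r [t [r0 tb E]]]; exists (r / ra), t; split => //; first exact: divr_gt0.
  have -> : (r / ra)%:C * cis (t - b) = (a * (w - v)) * (ra%:C^-1 * cis (- b)).
    by rewrite E cisD realCM realCV; ring.
  rewrite aE; have -> : ra%:C * cis b * (w - v) * (ra%:C^-1 * cis (- b)) =
    (cis b * cis (- b)) * (w - v) by field.
  by rewrite unit_cis mul1r addrC subrK.
have Acoord w : A w -> exists r t, [/\ 0 < r, T t & w = v + r%:C * cis (t - b)].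
  move=> Aw; have [r [t [r0 tb E]]] := polarA w (rel w Aw).
  by exists r, t; split => //; split => //; apply/(coneE r) => //; rewrite -E.
have Tne : T !=set0 by have [r [t [_ Tt _]]] := Acoord 0 A0; exists t.
have Tl : has_lbound T by exists (- (pi / 2)) => t [/andP[/ltW]].
have Tu : has_ubound T by exists (pi / 2) => t [/andP[_ /ltW]].
have Tin t : T t -> inf T < t < sup T.
  move=> [/andP[t1 t2] At]; have [e e0 he] := A_open At.
  have m0 : 0 < Num.min (t + pi / 2) (pi / 2 - t) by rewrite lt_min; apply/andP; split; lra.
  have [d] := cis_near (t - b) e0 m0.
  rewrite lt_min => /andP[d0 /andP[d1 d2]] [h1 h2].
  have near x : N (cis (t - b + x) - cis (t - b)) < e -> A (v + cis (t + x - b)).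
    move=> h; apply: he.
    have -> : v + cis (t + x - b) - (v + cis (t - b)) = cis (t + x - b) - cis (t - b) by ring.
    by rewrite addrAC.
  apply/andP; split.
    apply: (@le_lt_trans _ _ (t - d)); last by rewrite gtrBl.
    by apply: ge_inf => //; split; [apply/andP; split; lra|exact: near].
  apply: (@lt_le_trans _ _ (t + d)); first by rewrite ltrDl.
  by apply: ub_le_sup => //; split; [apply/andP; split; lra|exact: near].
have Tmid t : inf T < t < sup T -> T t.
  move=> /andP[t1 t2].
  have [t' [/andP[b1 b2] At'] tt'] := inf_lt Tne t1.
  have [t'' [/andP[b3 b4] At''] tt''] := sup_gt Tne t2.
  clear t1 t2; split; first by apply/andP; split; lra.
  have P0 : 0 < sin (t'' - t) by apply: sin_gt0_pi; apply/andP; split; lra.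
  have Q0 : 0 < sin (t - t') by apply: sin_gt0_pi; apply/andP; split; lra.
  have D0 : 0 < sin (t'' - t') by apply: sin_gt0_pi; apply/andP; split; lra.
  set P := sin (t'' - t) in P0; set Q := sin (t - t') in Q0; set D := sin (t'' - t') in D0.
  have PQ0 : 0 < P + Q by exact: addr_gt0.
  have PQC : (P + Q)%:C != 0 :> C by rewrite -modulus_gt0 modulus_posreal // ltW.
  (* A direction between two others is a positive combination of them, with sines of the angle
     differences as coefficients. Dividing by [P + Q] makes the combination convex; the remaining
     positive scale is absorbed by the cone. *)
  have E : D%:C * cis (t - b) = P%:C * cis (t' - b) + Q%:C * cis (t'' - b).
    rewrite !cisD !mulrA -mulrDl; congr (_ * _).
    rewrite /D /P /Q; apply: complexP => /=; rewrite !sinB.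
    - by have := cos2Dsin2 t; rewrite !mul0r !subr0 => H; ring: H.
    - by have := cos2Dsin2 t; rewrite !mul0r !addr0 => H; ring: H.
  have t01 : 0 <= Q / (P + Q) <= 1.
    by rewrite divr_ge0 ?(ltW Q0) ?(ltW PQ0) //= ler_pdivrMr // mul1r; lra.
  apply/(coneE (D / (P + Q))); first exact: divr_gt0.
  have := A_convex At' At'' t01; set x := _ + _.
  suff -> : x = v + (D / (P + Q))%:C * cis (t - b) by [].
  have -> : (D / (P + Q))%:C * cis (t - b) = (D%:C * cis (t - b)) / (P + Q)%:C.
    by rewrite realCM realCV; ring.
  have EP : P%:C = (P + Q)%:C - Q%:C :> C by rewrite realCD; ring.
  by rewrite /x E EP realCB realCM realCV -[1%:C]/(1 : C); move: (P + Q)%:C PQC => S SC; field.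
have polarT w : A w <-> exists r t, [/\ 0 < r, inf T < t < sup T & w = v + r%:C * cis (t - b)].
  split=> [/Acoord[r [t [r0 Tt E]]]|[r [t [r0 /Tmid[_ At] ->]]]].
    by exists r, t; split => //; exact: Tin.
  by apply/coneE.
have [m [M [mM lem leM {}polarT]]] : exists m M : R, [/\ m < M, - (pi / 2) <= m, M <= pi / 2 &
    forall w, A w <-> exists r t, [/\ 0 < r, m < t < M & w = v + r%:C * cis (t - b)]].
  exists (inf T), (sup T); split => //.
  - by have [t /Tin /andP[lt1 lt2]] := Tne; exact: lt_trans lt2.
  - by apply: lb_le_inf => // t [/andP[/ltW]].
  - by apply: ge_sup => // t [/andP[_ /ltW]].
(* Since [m] and [M] lie in the closed interval from [- (pi / 2)] to [pi / 2], an opening of at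
   least [pi] fills the half-plane. *)
have [small|big] := ltP (M - m) pi.
  right; exists (m - b), (M - m); split; first by rewrite small subr_gt0 mM.
  move=> w; rewrite polarT; split=> [[r [t [r0 tb ->]]]|[r [t [r0 tb ->]]]].
    by exists r, (t - b); split => //; move: tb => /andP[? ?]; apply/andP; split; lra.
  exists r, (t + b); split => //; last by rewrite addrK.
  by move: tb => /andP[? ?]; apply/andP; split; lra.
left=> w; split=> [/A_half|w1]; first lra.
have [|r [t [r0 tb ->]]] := polarA w; first by rewrite mulrBr ReB; lra.
apply/polarT; exists r, t; split => //.
by move: tb => /andP[? ?]; apply/andP; split; lra.
Qed.

End HalfPlane.
End PlaneConvexity.

(** * Boundary values *)

Section SphericalNeighborhoods.
Variable R : realType.
Local Notation C := (CC R).
Local Notation N := (@modulus R).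
Variable F : C -> sphere R.
Hypothesis Fcont : {within closed_disk, continuous F}.

Let Fnbhs zeta (V : set (sphere R)) : N zeta <= 1 -> nbhs (F zeta) V ->
  exists2 d : R, 0 < d & forall z, N z <= 1 -> N (z - zeta) < d -> V (F z).
Proof.
move=> z1 hV; have cz : closed_disk zeta by apply/closed_diskE.
have := Fcont hV; rewrite /nbhs /= -(nbhs_subspace_in cz) => h.
have /nbhs_modulusP[d d0 hd] : nbhs zeta [set z | closed_disk z -> V (F z)] by exact: h.
by exists d => // z zz zd; apply: (hd z zd); apply/closed_diskE.
Qed.

Lemma extension_at_finite zeta u : N zeta <= 1 -> F zeta = Some u ->
  forall e, 0 < e -> exists2 d, 0 < d & forall z, N z <= 1 -> N (z - zeta) < d ->
  exists2 v, F z = Some v & N (v - u) < e.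
Proof.
move=> z1 Fz e e0.
have nV : nbhs (u : C) [set v | N (v - u) < e] by apply/nbhs_modulusP; exists e.
have hV : nbhs (F zeta) (Some @` [set v : C | N (v - u) < e] : set (sphere R)).
  by rewrite Fz; exact: (@one_point_compactification_some_nbhs C u).
have [d d0 hd] := Fnbhs z1 hV; exists d => // z zz /(hd z zz)[v hv <-].
by exists v.
Qed.

(** Closed disks are closed and compact, so their complements are neighbourhoods of the point at
    infinity. *)
Lemma extension_at_infinity zeta : N zeta <= 1 -> F zeta = None ->
  forall K : R, exists2 d, 0 < d & forall z v, N z <= 1 -> N (z - zeta) < d ->
  F z = Some v -> K < N v.
Proof.
move=> z1 Fz K.
have clK : closed [set v : C | N v <= K].
  rewrite -(setCK [set v : C | N v <= K]); apply: open_closedC.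
  apply/open_modulusP => v /= /negP; rewrite -ltNge => Kv.
  exists (N v - K); first by rewrite subr_gt0.
  by move=> w wv /= wK; have := modulusBr v w; rewrite modulus_distC; lra.
have hV : nbhs (None : sphere R) (Some @` (~` [set v : C | N v <= K]) `|` [set None]).
  by exists [set v : C | N v <= K] => //; split; [exact: closed_ball_compact|].
rewrite -Fz in hV.
have [d d0 hd] := Fnbhs z1 hV; exists d => // z v zz /(hd z zz) /= + Fv.
rewrite Fv => -[[w /= /negP wK [<-]]|] //.
  by rewrite ltNge.
by rewrite Fz.
Qed.

End SphericalNeighborhoods.

(** * Sign of a continuous function on a segment *)

Section RealConnectedness.
Variable R : realType.

(** Continuity is relative to the unit interval: [h] will be a composite of a segment with
    [disk_inverse f] or [f], controlled only along that segment. *)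
Lemma segment_sign (h : R -> R) :
  (forall t, 0 <= t <= 1 -> forall e, 0 < e -> exists2 d, 0 < d &
     forall s, 0 <= s <= 1 -> `|s - t| < d -> `|h s - h t| < e) ->
  (forall t, 0 <= t <= 1 -> h t != 0) -> 0 < h 0 -> 0 < h 1.
Proof.
move=> hc h0 hp; rewrite ltNge; apply/negP => h1.
pose S : set R := [set t | 0 <= t <= 1 /\ 0 < h t].
have S0 : S 0 by split; rewrite ?lexx ?ler01.
have Sb : has_ubound S by exists 1 => t [/andP[]].
have Sne : S !=set0 by exists 0.
pose c := sup S.
have c01 : 0 <= c <= 1.
  by rewrite ub_le_sup //= ge_sup // => t [/andP[]].
have cub x : S x -> x <= c by exact: ub_le_sup.
have club x : x < c -> exists2 t, S t & x < t by exact: sup_gt.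
clearbody c; have hc0 : 0 < `|h c| by rewrite normr_gt0 h0.
have [d d0 hd] := hc c c01 _ hc0.
have [t St tc] : exists2 t, S t & c - d < t by apply: club; rewrite gtrBl.
have tle := cub t St.
have [/andP[t0 t1] ht] := St; have [c0 c1] := andP c01.
have td : `|t - c| < d by rewrite ltr_norml; lra.
have t01 : 0 <= t <= 1 by rewrite t0.
have hcp : 0 < h c.
  rewrite ltNge le_eqVlt (negbTE (h0 c c01)) /=; apply/negP => neg.
  have := hd t t01 td; rewrite (ltr0_norm neg) ltr_norml; clear -ht; lra.
have c1' : c < 1.
  by rewrite lt_def c1 andbT; apply: contraTneq h1 => ->; rewrite -ltNge.
pose s := Num.min 1 (c + d / 2).
have s1 : s <= 1 by rewrite /s ge_min lexx.
have s2 : s <= c + d / 2 by rewrite /s ge_min lexx orbT.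
have cs : c < s by rewrite /s lt_min c1' /= ltrDl half_gt0.
clearbody s; have sd : `|s - c| < d by rewrite ltr_norml; clear -cs s2 d0; lra.
have s01 : 0 <= s <= 1 by rewrite s1 andbT; clear -cs c0; lra.
have Ss : S s.
  split => //; have := hd s s01 sd; rewrite (gtr0_norm hcp) ltr_norml; clear; lra.
by have := cub s Ss; rewrite leNgt cs.
Qed.

End RealConnectedness.

(** * Chords and arcs of the unit circle *)

Section CircleGeometry.
Variable R : realType.
Local Notation C := (CC R).
Local Notation N := (@modulus R).
Local Notation Re := complex.Re.
Local Notation Im := complex.Im.
Implicit Types (p q z w : C).

(** Twice the signed area of the triangle [p q z]; its sign tells the side of the line [p q]. *)
Definition cross p q z : R :=
  (Re q - Re p) * (Im z - Im p) - (Im q - Im p) * (Re z - Re p).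

Let unit_eq p : N p = 1 -> Im p ^+ 2 = 1 - Re p ^+ 2.
Proof. by move=> p1; have := modulus_sq p; rewrite p1 expr1n; lra. Qed.

(** For a triangle inscribed in the unit circle the product of the sides is four times the area; the
    squared form is the identity [E]. *)
Lemma cross_zero p q z : N p = 1 -> N q = 1 -> N z = 1 -> p != q ->
  cross p q z = 0 -> z = p \/ z = q.
Proof.
move=> p1 q1 z1 pq cr.
have E : 4 * cross p q z ^+ 2 = N (p - q) ^+ 2 * (N (q - z) ^+ 2 * N (z - p) ^+ 2).
  have := unit_eq p1; have := unit_eq q1; have := unit_eq z1.
  rewrite !modulus_sq /cross; case: p q z {p1 q1 z1 pq cr} => a b [c d] [x y] /= Hz Hq Hp.
  ring: Hz Hq Hp.
move: E; rewrite cr expr0n mulr0 => /esym/eqP.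
rewrite mulf_eq0 expf_eq0 modulus_eq0 subr_eq0 (negbTE pq) /=.
rewrite mulf_eq0 !expf_eq0 /= !modulus_eq0 !subr_eq0.
by move=> /orP[/eqP ->|/eqP ->]; [right|left].
Qed.

(** Chord separation is symmetric: [p q] separates [z] from [w] exactly when [z w] separates [p]
    from [q]. *)
Lemma cross_swap p q z w : N p = 1 -> N q = 1 -> N z = 1 -> N w = 1 ->
  cross p q z * cross p q w * N (z - w) ^+ 2 =
  cross z w p * cross z w q * N (p - q) ^+ 2.
Proof.
move=> p1 q1 z1 w1.
have := unit_eq p1; have := unit_eq q1; have := unit_eq z1; have := unit_eq w1.
rewrite !modulus_sq /cross; case: p q z w {p1 q1 z1 w1} => a b [c d] [x y] [u v] /= H1 H2 H3 H4.
ring: H1 H2 H3 H4.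
Qed.

Lemma crossC p q z : cross q p z = - cross p q z.
Proof. by rewrite /cross; ring. Qed.

Lemma cross_cont p q z (e : R) : 0 < e -> exists2 d, 0 < d &
  forall w, N (w - z) < d -> `|cross p q w - cross p q z| < e.
Proof.
move=> e0; pose K := `|Re q - Re p| + `|Im q - Im p| + 1.
have K0 : 0 < K by rewrite /K ltr_wpDl ?addr_ge0.
exists (e / K); first exact: divr_gt0.
move=> w; rewrite ltr_pdivlMr // => h.
have -> : cross p q w - cross p q z =
    (Re q - Re p) * Im (w - z) - (Im q - Im p) * Re (w - z).
  by rewrite /cross; case: w z {h} => [x y] [x' y'] /=; ring.
apply: le_lt_trans h; rewrite (le_trans (ler_normB _ _)) // !normrM.
have a1 : `|Re q - Re p| * `|Im (w - z)| <= `|Re q - Re p| * N (w - z).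
  by rewrite ler_wpM2l // normIm_le_modulus.
have a2 : `|Im q - Im p| * `|Re (w - z)| <= `|Im q - Im p| * N (w - z).
  by rewrite ler_wpM2l // normRe_le_modulus.
by have := modulus_ge0 (w - z); rewrite /K; lra.
Qed.

(** The witness, a quarter turn of the normalized chord, is the midpoint of the arc on the left of
    [p q]. *)
Lemma arc_point p q : N p = 1 -> N q = 1 -> p != q -> exists2 z, N z = 1 & 0 < cross p q z.
Proof.
move=> p1 q1 pq; have D0 : 0 < N (q - p) by rewrite modulus_gt0 subr_eq0 eq_sym.
have DC : (N (q - p))%:C != 0 :> C by rewrite -modulus_gt0 modulus_posreal // ltW.
pose z : C := (0 +i* 1) * (q - p) / (N (q - p))%:C; exists z.
  have i1 : N (0 +i* 1) = 1 by rewrite /modulus /= expr0n add0r expr1n sqrtr1.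
  by rewrite 2!modulusM i1 mul1r modulusV modulus_posreal ?divff ?gt_eqF // ltW.
have E : cross p q z = N (q - p) - (Re q * Im p - Im q * Re p).
  rewrite -[X in X - _](mulfK (lt0r_neq0 D0)) -expr2 modulus_sq /cross /z -realCV.
  by case: p q {p1 q1 pq D0 DC z} => a b [c d] /=; ring.
rewrite E subr_gt0; have [neg|pos] := leP (Re q * Im p - Im q * Re p) 0.
  exact: le_lt_trans D0.
rewrite -(@ltr_pXn2r _ 2) ?nnegrE ?modulus_ge0 ?(ltW pos) //.
have Dsq : N (q - p) ^+ 2 = 2 * (1 - (Re p * Re q + Im p * Im q)).
  have := unit_eq p1; have := unit_eq q1; rewrite modulus_sq.
  by case: p q {p1 q1 pq D0 DC z E pos} => a b [c d] /= H1 H2; ring: H1 H2.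
have Isq : (Re q * Im p - Im q * Re p) ^+ 2 = 1 - (Re p * Re q + Im p * Im q) ^+ 2.
  have := unit_eq p1; have := unit_eq q1.
  by case: p q {p1 q1 pq D0 DC z E pos Dsq} => a b [c d] /= H1 H2; ring: H1 H2.
have D2 : 0 < N (q - p) ^+ 2 by rewrite exprn_gt0.
rewrite Isq Dsq; rewrite Dsq in D2; nra.
Qed.

(** Measure the angle from [p] to [q] in steps [2 * pi / n%:R]: the integer part modulo [n] is [j],
    the fractional part is the error [y], at most one step. *)
Lemma rotation_cover p q n : N p = 1 -> N q = 1 -> (0 < n)%N ->
  exists (j : 'I_n) (y : R), 0 <= y <= 2 * pi / n%:R /\
    cis (2 * pi * (j%:R / n%:R)) * p = q * cis (- y).
Proof.
move=> p1 q1 n0; have p0 := @pi_gt0 R.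
have nR : 0 < n%:R :> R by rewrite ltr0n.
have pz : p != 0 by rewrite -modulus_gt0 p1.
have qp0 : q / p != 0 by rewrite mulf_neq0 ?invr_eq0 // -modulus_gt0 q1.
have [r [t [r0 E]]] := polar_form qp0.
have r1 : r = 1.
  have : N (q / p) = 1 by rewrite modulusM modulusV p1 q1 invr1 mulr1.
  by rewrite E modulusM modulus_cis mulr1 modulus_posreal // ltW.
have {r r0 r1}E : q = cis t * p by rewrite -(divfK pz q) E r1 -[1%:C]/(1 : C) mul1r.
have cis_per k : cis (2 * pi * k%:R) = 1 :> C.
  elim: k => [|k ih]; first by rewrite mulr0 /cis cos0 sin0.
  rewrite -(natr1 k) mulrDr mulr1 cisD ih mul1r /cis.
  by rewrite mulr_natl cos2pi sin2pi.
pose K := Num.bound (`|t| / (2 * pi)).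
have tp2 : 0 < 2 * pi :> R by rewrite mulr_gt0.
have t'0 : 0 <= t + 2 * pi * K%:R.
  have h : 0 <= `|t| / (2 * pi) by rewrite divr_ge0 // ltW.
  have := archi_boundP h; rewrite ltr_pdivrMr // => H.
  have := ler_norm (- t); rewrite normrN /K; lra.
pose x := (t + 2 * pi * K%:R) / (2 * pi) * n%:R.
have x0 : 0 <= x by rewrite mulr_ge0 ?(ltW nR) // divr_ge0 // ltW.
have /andP[m1 m2] := truncn_itv x0; set m := Num.truncn x in m1 m2.
have jn : (m %% n < n)%N by rewrite ltn_mod.
exists (Ordinal jn), (2 * pi * ((x - m%:R) / n%:R)); split.
  apply/andP; split.
    by rewrite mulr_ge0 ?(ltW tp2) // divr_ge0 ?(ltW nR) // subr_ge0.
  have xm : x - m%:R <= 1 by rewrite -(natr1 m) in m2; lra.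
  by rewrite mulrA ler_pM2r ?invr_gt0 // ler_piMr // ltW.
rewrite /= E [RHS]mulrAC; congr (_ * _).
have shift (y : R) (k : nat) : cis y = cis (y + 2 * pi * k%:R) :> C.
  by rewrite [RHS]cisD cis_per mulr1.
rewrite (shift _ (m %/ n)%N) (shift t K) -cisD; congr (cis _).
have -> : x - m%:R = x - ((m %/ n)%N%:R * n%:R + (m %% n)%N%:R).
  by rewrite -natrM -natrD -divn_eq.
have key (P n' q' r' K' : R) : P != 0 -> n' != 0 -> 2 * P * (r' / n') + 2 * P * q' =
    t + 2 * P * K' + - (2 * P * (((t + 2 * P * K') / (2 * P) * n' - (q' * n' + r')) / n')).
  by move=> h1 h2; field; rewrite h1 h2.
by rewrite /x; apply: key; rewrite gt_eqF.
Qed.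

End CircleGeometry.

(** * Values of the spherical extension on the circle *)

Section BoundaryBehaviour.
Variable R : realType.
Local Notation C := (CC R).
Local Notation N := (@modulus R).
Local Notation Re := complex.Re.
Local Notation Im := complex.Im.

Lemma disk_near (zeta : C) (d : R) : N zeta = 1 -> 0 < d -> exists2 z, N z < 1 & N (z - zeta) < d.
Proof.
move=> z1 d0; pose s := Num.min d 1 / 2.
have m0 : 0 < Num.min d 1 by rewrite lt_min d0 ltr01.
have m1 : Num.min d 1 <= d by rewrite ge_min lexx.
have m2 : Num.min d 1 <= 1 by rewrite ge_min lexx orbT.
exists ((1 - s)%:C * zeta); first by rewrite modulusM z1 mulr1 modulus_posreal /s; lra.
have -> : (1 - s)%:C * zeta - zeta = - (s%:C * zeta) by rewrite realCB -[1%:C]/(1 : C); ring.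
by rewrite modulusN modulusM z1 mulr1 modulus_posreal /s; lra.
Qed.

Lemma holo_prod n (u : nat -> C -> C) z : (forall j, (j < n)%N -> holo_at (u j) z) ->
  holo_at (fun w => \prod_(j < n) u j w) z.
Proof.
elim: n => [|n ih] h.
  by rewrite (_ : (fun w => _) = fun=> 1); [exact: holo_cst|apply: funext => w; rewrite big_ord0].
rewrite (_ : (fun w => _) = fun w => (\prod_(j < n) u j w) * u n w); last first.
  by apply: funext => w; rewrite big_ord_recr.
by apply: holoM; [apply: ih => j jn; apply: h; exact: ltnW|exact: h].
Qed.

(* The product of finitely many rotations of [G] tends to [0] at the whole
   circle, hence vanishes at the centre. *)
Lemma vanishing_arc (G : C -> C) (B : R) (zeta0 : C) (delta : R) :
  (forall z, N z < 1 -> holo_at G z) -> (forall z, N z < 1 -> N (G z) <= B) ->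
  N zeta0 = 1 -> 0 < delta ->
  (forall zeta, N zeta = 1 -> N (zeta - zeta0) < delta ->
     forall e, 0 < e -> exists2 d, 0 < d & forall z, N z < 1 -> N (z - zeta) < d -> N (G z) < e) ->
  G 0 = 0.
Proof.
move=> hol bd z01 delta0 van; have p0 := @pi_gt0 R.
(* At least 1, so that the factors other than the small one are bounded together by [K ^+ n]. *)
pose K := Num.max B 1; have K1 : 1 <= K by rewrite /K le_max lexx orbT.
have K0 : 0 < K by exact: lt_le_trans K1.
have GK z : N z < 1 -> N (G z) <= K by move=> h; rewrite /K le_max bd.
have [d d0 hd] := @polar_diff0 R 1 ltr01.
pose m := Num.min d (delta / 2).
have m0 : 0 < m by rewrite /m lt_min d0 half_gt0.
have m1 : m <= d by rewrite /m ge_min lexx.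
have m2 : m <= delta / 2 by rewrite /m ge_min lexx orbT.
clearbody m; have tp : 0 < 2 * pi :> R by rewrite mulr_gt0.
(* The rotation step [2 * pi / n%:R] is below [m <= delta / 2], and a rotation by an angle [y] moves
   a point of the circle by at most [2 * y]; so some rotation brings any point into the arc. *)
pose n := (Num.bound (2 * pi / m)).+1.
have nm : 2 * pi / n%:R < m.
  have h : 0 <= 2 * pi / m by rewrite divr_ge0 // ltW.
  rewrite ltr_pdivrMr ?ltr0n // [m * _]mulrC -ltr_pdivrMr //.
  by rewrite (lt_trans (archi_boundP h)) // ltr_nat.
have near1 y : 0 <= y <= 2 * pi / n%:R -> N (cis (- y) - 1) < delta.
  move=> /andP[y0 y1]; have := hd 0 (- y); rewrite normr0 d0 normrN (ger0_norm y0).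
  have yd : y < d by lra.
  move=> /(_ isT yd); rewrite /polar expR0 -[1%:C]/(1 : C) !mul1r add0r => H.
  have := modulusD (cis (- y) - 1 - (0 +i* - y)) (0 +i* - y); rewrite subrK.
  have -> : N (0 +i* - y) = y by rewrite /modulus /= expr0n add0r sqrrN sqrtr_sqr ger0_norm.
  lra.
pose om (j : nat) : C := cis (2 * pi * (j%:R / n%:R)).
pose P z := \prod_(j < n) G (om j * z).
have om1 j z : N (om j * z) = N z by rewrite modulusM modulus_cis mul1r.
have Phol z : N z < 1 -> holo_at P z.
  move=> z1; apply: (@holo_prod n (fun j w => G (om j * w))) => j _.
  apply: (@holo_comp _ (fun w => om j * w) G); last by apply: hol; rewrite om1.
  by apply: holoM; [exact: holo_cst|exact: holo_id].
have Pbound (j : 'I_n) z : N z < 1 -> N (P z) <= N (G (om j * z)) * K ^+ n.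
  move=> z1; rewrite /P (big_morph N (@modulusM R) (@modulus1 R)) (bigD1 j) //=.
  rewrite ler_wpM2l ?modulus_ge0 //.
  have : \prod_(i < n | i != j) N (G (om i * z)) <= \prod_(i < n | i != j) K.
    by apply: ler_prod => i _; rewrite modulus_ge0 GK ?om1.
  move/le_trans; apply; rewrite prodr_const ler_weXn2l //.
  by rewrite (leq_trans (max_card _)) // card_ord.
(* Compactness turns the pointwise decay at each point of the circle into a uniform one. *)
have small e : 0 < e -> exists2 s, s < 1 & forall z, s < N z < 1 -> N (P z) <= e.
  move=> e0; apply: contrapT => h.
  have hz (k : nat) : exists z, [/\ N z < 1, 1 - k.+1%:R^-1 < N z & e < N (P z)].
    apply: contrapT => hk; apply: h; exists (1 - k.+1%:R^-1); first by rewrite gtrBl invr_gt0.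
    move=> z /andP[z1 z2]; rewrite leNgt; apply/negP => lt; apply: hk.
    by exists z.
  have [u hu] := choice hz.
  have uB k : N (u k) <= 1 by have [/ltW] := hu k.
  have [zeta zeta1 cl] := bolzano_weierstrass uB.
  have Nz : N zeta = 1.
    apply/le_anti; rewrite zeta1 /=; apply/ler_addgt0Pr => x x0.
    have [n0 hn0] := inv_nat_small (half_gt0 x0).
    have [k kn uk] := cl _ n0 (half_gt0 x0).
    have := hn0 k kn; have [_ h2 _] := hu k; move: h2; set q := _^-1 => h2 h3.
    by have := modulusBr (u k) zeta; clear -h2 h3 uk; lra.
  have [j [y [yb E]]] := rotation_cover Nz z01 (isT : (0 < n)%N).
  have Nj : N (om j * zeta) = 1 by rewrite om1.
  have close : N (om j * zeta - zeta0) < delta.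
    have -> : om j * zeta - zeta0 = zeta0 * (cis (- y) - 1) by rewrite /om E; ring.
    by rewrite modulusM z01 mul1r near1.
  have e1 : 0 < e / K ^+ n by rewrite divr_gt0 // exprn_gt0.
  have [x x0 hx] := van _ Nj close _ e1.
  have [k _ uk] := cl _ 0%N x0; have [u1 _ ue] := hu k.
  have : N (G (om j * u k)) < e / K ^+ n.
    by apply: hx; rewrite ?om1 // -mulrBr om1.
  rewrite ltr_pdivlMr ?exprn_gt0 // => H.
  by move: ue; rewrite ltNge (le_trans (Pbound j (u k) u1) (ltW H)).
have P0 : N (P 0) <= 0.
  apply/ler_addgt0Pr => e /small[s s1 hs]; rewrite add0r.
  pose t := Num.max s 0; have t1 : t < 1 by rewrite /t gt_max s1 ltr01.
  have t0 : 0 <= t by rewrite /t le_max lexx orbT.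
  have st : s <= t by rewrite /t le_max lexx.
  clearbody t; apply: (@max_modulus_center _ P ((1 + t) / 2)); first by lra.
  - by move=> z /andP[_ zr]; apply: Phol; lra.
  - by apply: holo_cont; apply: Phol; rewrite modulus0.
  - by move=> z zr; apply: hs; rewrite zr; lra.
move: P0; rewrite le_eqVlt ltNge modulus_ge0 orbF modulus_eq0 /P.
under eq_bigr do rewrite mulr0.
by rewrite prodr_const card_ord expf_eq0 /= => /eqP.
Qed.

Variables (f g : C -> C) (a : C) (F : C -> sphere R).
Hypothesis finj : forall z w, N z < 1 -> N w < 1 -> f z = f w -> z = w.
Hypothesis fder : forall z, N z < 1 -> has_derivative f z (g z).
Hypothesis f0 : f 0 = 0.
Hypothesis a_neq0 : a != 0.
Local Notation O := (image f).
Local Notation k := (disk_inverse f).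
Hypothesis O_open : forall z, O z -> exists2 e, 0 < e & forall w, N (w - z) < e -> O w.
Hypothesis cvx : forall (u v : C) (t : R), O u -> O v -> 0 <= t <= 1 ->
  O ((1 - t)%:C * u + t%:C * v).
Hypothesis O_half : forall w, O w -> 0 < 1 + 2 * Re (a * w).
Hypothesis Fdisk : forall z, N z < 1 -> F z = Some (f z).
Hypothesis Fcont : {within closed_disk, continuous F}.

Let fhol z : N z < 1 -> holo_at f z.
Proof. by move=> z1; exists (g z); exact: fder. Qed.

(** A countable neighbourhood base at [p], which treats finite points and infinity uniformly. *)
Definition sphere_near (p : sphere R) (n : nat) (w : C) : Prop :=
  if p is Some u then N (w - u) < n.+1%:R^-1 else n%:R < N w.

Lemma sphere_near_limit p (z : nat -> C) zeta : (forall n, N (z n) < 1) ->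
  (forall n, sphere_near p n (f (z n))) -> N zeta <= 1 ->
  (forall e n0, 0 < e -> exists2 n, (n0 <= n)%N & N (z n - zeta) < e) -> F zeta = p.
Proof.
move=> z1 hz zeta1 cl; case Ez : (F zeta) => [v|]; case: p hz => [u|] //= hz.
- congr Some; apply/eqP; rewrite -subr_eq0 -modulus_eq0; apply/eqP/le_anti.
  rewrite modulus_ge0 andbT; apply/ler_addgt0Pr => e e0; rewrite add0r.
  have [d d0 hd] := extension_at_finite Fcont zeta1 Ez (half_gt0 e0).
  have [n0 hn0] := inv_nat_small (half_gt0 e0); have [n nn zn] := cl d n0 d0.
  have [v' Fv vv] := hd _ (ltW (z1 n)) zn; move: Fv; rewrite Fdisk // => -[E].
  have A := lt_trans (hz n) (hn0 n nn); rewrite -E in vv.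
  by have := modulus_tri (f (z n)) v u; rewrite (modulus_distC v (f (z n))); lra.
- have [d d0 hd] := extension_at_finite Fcont zeta1 Ez ltr01.
  have [n nn zn] := cl d (Num.bound (N v + 1)) d0.
  have [v' Fv vv] := hd _ (ltW (z1 n)) zn; move: Fv; rewrite Fdisk // => -[E].
  rewrite -E in vv; have v0 : 0 <= N v + 1 by rewrite addr_ge0 ?modulus_ge0.
  have A := lt_le_trans (archi_boundP v0) (_ : _ <= n%:R).
  have {}A : N v + 1 < n%:R by apply: A; rewrite ler_nat.
  by exfalso; have := hz n; have := modulusBr (f (z n)) v; lra.
- have [d d0 hd] := extension_at_infinity Fcont zeta1 Ez (N u + 1).
  have [n nn zn] := cl d 0%N d0; have B := hd _ _ (ltW (z1 n)) zn (Fdisk (z1 n)).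
  have A : n.+1%:R^-1 <= 1 :> R by rewrite invf_le1 ?ler1n.
  by exfalso; have := lt_le_trans (hz n) A; have := modulusBr (f (z n)) u; lra.
Qed.

Lemma sphere_near_at p zeta : N zeta = 1 -> F zeta = p -> forall n, exists2 d, 0 < d &
  forall z, N z < 1 -> N (z - zeta) < d -> sphere_near p n (f z).
Proof.
move=> z1 Fz n; have z1' : N zeta <= 1 by rewrite z1.
case: p Fz => [u|] Fz /=.
  have i0 : 0 < n.+1%:R^-1 :> R by rewrite invr_gt0.
  have [d d0 hd] := extension_at_finite Fcont z1' Fz i0; exists d => // z zz zd.
  by have [v] := hd z (ltW zz) zd; rewrite Fdisk // => -[<-].
have [d d0 hd] := extension_at_infinity Fcont z1' Fz n%:R; exists d => // z zz zd.
exact: hd (ltW zz) zd (Fdisk zz).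
Qed.

(** Points whose values tend to [p] accumulate in the closed disk at a point where [F] is [p]; [Q n]
    carries side conditions along. *)
Lemma sphere_near_cluster p (Q : nat -> C -> Prop) :
  (forall n, exists z, [/\ N z < 1, Q n z & sphere_near p n (f z)]) ->
  exists zeta (z : nat -> C), [/\ N zeta <= 1, F zeta = p, forall n, N (z n) < 1,
    forall n, Q n (z n) &
    forall e n0, 0 < e -> exists2 n, (n0 <= n)%N & N (z n - zeta) < e].
Proof.
move=> /choice[z hz].
have zB n : N (z n) <= 1 by have [/ltW] := hz n.
have [zeta zeta1 cl] := bolzano_weierstrass zB; exists zeta, z; split => //.
- by apply: sphere_near_limit cl => // n; have [] := hz n.
- by move=> n; have [] := hz n.
- by move=> n; have [] := hz n.
Qed.

Definition omitted (p : sphere R) := forall z, N z < 1 -> Some (f z) <> p.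

Lemma omitted_circle p zeta : omitted p -> N zeta <= 1 -> F zeta = p -> N zeta = 1.
Proof.
move=> om z1 Fz; apply/le_anti; rewrite z1 leNgt /=; apply/negP => lt.
by apply: (om zeta lt); rewrite -Fdisk.
Qed.

Lemma omitted_infinity : omitted None. Proof. by []. Qed.

Lemma omitted_finite u : ~ O u -> omitted (Some u).
Proof. by move=> nu z z1 [E]; apply: nu; exists z. Qed.

(** If [u = f z0], continuity of the inverse at [u] would bring points close to [zeta] close to
    [z0], inside the disk. *)
Lemma boundary_value_omitted zeta u : N zeta = 1 -> F zeta = Some u -> ~ O u.
Proof.
move=> z1 Fz [z0 z01 E].
have e0 : 0 < (1 - N z0) / 2 by rewrite divr_gt0 // subr_gt0.
have [d d0 hd] := disk_inverse_cont fhol finj z01 e0.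
have [n0 hn0] := inv_nat_small d0.
have [d' d'0 hd'] := sphere_near_at z1 Fz n0.
have m0 : 0 < Num.min d' ((1 - N z0) / 2) by rewrite lt_min d'0.
have [z zz] := disk_near z1 m0; rewrite lt_min => /andP[zd zd2].
have := hd (f z); rewrite !disk_inverseK // => H.
have {}H : N (z - z0) < (1 - N z0) / 2.
  by apply: H; rewrite E; exact: lt_trans (hd' z zz zd) (hn0 n0 (leqnn _)).
have := modulusBr zeta z; have := modulusBr z z0.
by rewrite (modulus_distC zeta z) z1; lra.
Qed.

Lemma boundary_value_adherent zeta u : N zeta = 1 -> F zeta = Some u -> adherent O u.
Proof.
move=> z1 Fz e e0; have [n0 hn0] := inv_nat_small e0.
have [d d0 hd] := sphere_near_at z1 Fz n0; have [z zz zd] := disk_near z1 d0.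
exists (f z); first by exists z.
exact: lt_trans (hd z zz zd) (hn0 n0 (leqnn _)).
Qed.

Lemma boundary_value_exists u : adherent O u -> ~ O u ->
  exists2 zeta, N zeta = 1 & F zeta = Some u.
Proof.
move=> adh nu.
have [|zeta [_ [z1 Fz _ _ _]]] := @sphere_near_cluster (Some u) (fun _ _ => True).
  move=> n; have i0 : 0 < n.+1%:R^-1 :> R by rewrite invr_gt0.
  by have [w [z z1 <-] h] := adh _ i0; exists z.
by exists zeta => //; apply: omitted_circle Fz => //; exact: omitted_finite.
Qed.

Lemma infinite_value_exists (Q : C -> Prop) :
  (forall M : R, exists2 w, O w & Q w /\ M < N w) ->
  exists zeta, [/\ N zeta = 1, F zeta = None &
    forall d, 0 < d -> exists z, [/\ N z < 1, N (z - zeta) < d & Q (f z)]].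
Proof.
move=> h; have [|zeta [z [z1 Fz zz zQ cl]]] := @sphere_near_cluster None (fun _ z => Q (f z)).
  by move=> n; have [_ [z z1 <-] [Qz nz]] := h n%:R; exists z.
exists zeta; split => //; first by apply: omitted_circle Fz.
by move=> d d0; have [n _ hn] := cl d 0%N d0; exists (z n).
Qed.

Let den_ge z : N z < 1 -> 1 / 2 <= N (1 + a * f z).
Proof.
move=> z1; have Oz : O (f z) by exists z.
have := O_half Oz; have := Re_le_modulus (1 + a * f z); rewrite ReD /=; lra.
Qed.

(** The quotients [(f - u) / (1 + a * f)] and [1 / (1 + a * f)] are bounded, as the half-plane
    condition gives [1 / 2 <= N (1 + a * f z)]. If [F] were [p] on an arc they would vanish at 0,
    where their values are [- u] and 1. *)
Lemma arc_not_constant p zeta0 (delta : R) : omitted p -> N zeta0 = 1 -> 0 < delta ->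
  exists zeta, [/\ N zeta = 1, N (zeta - zeta0) < delta & F zeta <> p].
Proof.
move=> om z01 delta0; apply: contrapT => none.
have Fp zeta : N zeta = 1 -> N (zeta - zeta0) < delta -> F zeta = p.
  by move=> z1 zd; apply: contrapT => h; apply: none; exists zeta.
have a0 : 0 < N a by rewrite modulus_gt0.
have den_holo z : N z < 1 -> holo_at (fun w => 1 + a * f w) z.
  move=> z1; apply: holoD; first exact: holo_cst.
  by apply: holoM; [exact: holo_cst|exact: fhol].
have den0 z : N z < 1 -> 0 < N (1 + a * f z) by move=> /den_ge; lra.
case: p om Fp {none} => [u|] om Fp.
  have := om 0; rewrite modulus0 ltr01 f0 => /(_ isT) u0.
  have un0 : u != 0 by apply/eqP => E; apply: u0; rewrite E.
  pose G z := (f z - u) / (1 + a * f z).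
  suff : G 0 = 0.
    by rewrite /G f0 mulr0 addr0 divr1 sub0r => /eqP; rewrite oppr_eq0 (negbTE un0).
  apply: (@vanishing_arc G ((N a)^-1 + 2 * ((N a)^-1 + N u)) zeta0 delta) => //.
  - move=> z z1; apply: holo_div; [by rewrite -modulus_gt0 den0| |exact: den_holo].
    by apply: holoB; [exact: fhol|exact: holo_cst].
  - move=> z z1; rewrite /G modulusM modulusV ler_pdivrMr ?den0 //.
    have := den_ge z1; set D := N (1 + a * f z) => D2.
    have fE : N (f z) <= (N a)^-1 * (D + 1).
      rewrite ler_pdivlMl // -modulusM.
      have := modulusB (1 + a * f z) 1; rewrite [1 + _]addrC addrK modulus1.
      by rewrite /D [1 + _]addrC.
    have i0 : 0 < (N a)^-1 by rewrite invr_gt0.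
    have u1 := modulus_ge0 u; have := modulusB (f z) u.
    nra.
  - move=> zeta z1 zd e e0; have [n0 hn0] := inv_nat_small (half_gt0 e0).
    have [d d0 hd] := sphere_near_at z1 (Fp zeta z1 zd) n0; exists d => // z zz zzd.
    rewrite /G modulusM modulusV ltr_pdivrMr ?den0 //.
    have A := lt_trans (hd z zz zzd) (hn0 n0 (leqnn _)).
    by have := den_ge zz; nra.
pose G z := (1 + a * f z)^-1.
suff : G 0 = 0 by rewrite /G f0 mulr0 addr0 invr1 => /eqP; rewrite oner_eq0.
apply: (@vanishing_arc G 2 zeta0 delta) => //.
- by move=> z z1; apply: holoV; [rewrite -modulus_gt0 den0|exact: den_holo].
- move=> z z1; rewrite /G modulusV -[2]invrK lef_pV2 ?posrE ?invr_gt0 ?den0 //.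
  by rewrite -div1r den_ge.
- move=> zeta z1 zd e e0.
  have b0 : 0 <= (e^-1 + 1) / N a by rewrite divr_ge0 ?addr_ge0 ?invr_ge0 ?(ltW e0) ?(ltW a0).
  have [d d0 hd] := sphere_near_at z1 (Fp zeta z1 zd) (Num.bound ((e^-1 + 1) / N a)).
  exists d => // z zz zzd; rewrite /G modulusV -[e]invrK ltf_pV2 ?posrE ?invr_gt0 ?den0 //.
  have := lt_trans (archi_boundP b0) (hd z zz zzd); rewrite ltr_pdivrMr // => A.
  have := modulusDr (a * f z) 1; rewrite modulusM modulus1 [a * _ + 1]addrC; lra.
Qed.

(* A chord with endpoints where [F] differs from [p] separates [zeta1] from
   [zeta2], and [F] stays away from [p] on it; so a segment of the image close
   to [p] cannot be pulled back across the chord. *)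
Lemma crosscut p zeta1 zeta2 : omitted p -> N zeta1 = 1 -> N zeta2 = 1 ->
  zeta1 != zeta2 -> F zeta1 = p -> F zeta2 = p ->
  exists n (M : C -> R) e, [/\ 0 < e,
    forall w1 w2, (forall t, 0 <= t <= 1 -> O ((1 - t)%:C * w1 + t%:C * w2) /\
        sphere_near p n ((1 - t)%:C * w1 + t%:C * w2)) -> 0 < M (k w1) -> 0 < M (k w2),
    forall z, N (z - zeta1) < e -> 0 < M z & forall z, N (z - zeta2) < e -> M z < 0].
Proof.
move=> om z1 z2 z12 F1 F2.
have [al [al1 alc Fal]] : exists al, [/\ N al = 1, 0 < cross zeta1 zeta2 al & F al <> p].
  have [y y1 yc] := arc_point z1 z2 z12; have [d d0 hd] := cross_cont zeta1 zeta2 y yc.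
  have [al [al1 ald Fal]] := arc_not_constant om y1 d0; exists al; split => //.
  by have := hd al ald; rewrite ltr_norml; lra.
have [be [be1 bec Fbe]] : exists be, [/\ N be = 1, cross zeta1 zeta2 be < 0 & F be <> p].
  have z21 : zeta2 != zeta1 by rewrite eq_sym.
  have [y y1 yc] := arc_point z2 z1 z21; have [d d0 hd] := cross_cont zeta2 zeta1 y yc.
  have [be [be1 bed Fbe]] := arc_not_constant om y1 d0; exists be; split => //.
  by have := hd be bed; rewrite ltr_norml [cross _ _ be]crossC; lra.
have ab : al != be by apply: contraTneq alc => ->; rewrite -leNgt ltW.
(* [al] and [be] were chosen on opposite sides of the chord [zeta1 zeta2]; [cross_swap] exchanges
   the roles. *)
have prod_neg : cross al be zeta1 * cross al be zeta2 < 0.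
  have E := cross_swap z1 z2 al1 be1.
  have p1 : 0 < N (al - be) ^+ 2 by rewrite exprn_gt0 // modulus_gt0 subr_eq0.
  have p2 : 0 < N (zeta1 - zeta2) ^+ 2 by rewrite exprn_gt0 // modulus_gt0 subr_eq0.
  rewrite -(pmulr_llt0 _ p2) -E pmulr_llt0 //; nra.
(* Otherwise points of the chord with values tending to [p] accumulate on the circle, because [p] is
   omitted, hence at [al] or [be], where [F] differs from [p]. *)
have [n avoid] : exists n, forall z, N z < 1 -> cross al be z = 0 -> ~ sphere_near p n (f z).
  apply: contrapT => h.
  have [|zeta [z [zz Fz zlt zc cl]]] := @sphere_near_cluster p (fun _ z => cross al be z = 0).
    move=> n; apply: contrapT => hn; apply: h; exists n => z zz zc nz.
    by apply: hn; exists z.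
  have zeta_1 := omitted_circle om zz Fz.
  have c0 : cross al be zeta = 0.
    apply/eqP; rewrite -normr_eq0; apply/eqP/le_anti; rewrite normr_ge0 andbT.
    apply/ler_addgt0Pr => e e0; rewrite add0r.
    have [d d0 hd] := cross_cont al be zeta e0; have [m _ zm] := cl d 0%N d0.
    by have := hd _ zm; rewrite zc sub0r normrN => /ltW.
  by have [E|E] := cross_zero al1 be1 zeta_1 ab c0; [apply: Fal|apply: Fbe]; rewrite -E.
(* Pulled back by the inverse, a segment close to [p] never meets the chord, so it stays on one
   side. The sign [sg] will orient the chord so that [zeta1] is on the positive side. *)
have core (sg : R) : sg != 0 -> forall w1 w2, (forall t, 0 <= t <= 1 ->
    O ((1 - t)%:C * w1 + t%:C * w2) /\ sphere_near p n ((1 - t)%:C * w1 + t%:C * w2)) ->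
    0 < sg * cross al be (k w1) -> 0 < sg * cross al be (k w2).
  move=> sg0 w1 w2 seg; pose ga (t : R) : C := (1 - t)%:C * w1 + t%:C * w2.
  have ga0 : ga 0 = w1.
    by rewrite /ga subr0 -[1%:C]/(1 : C) -[0%:C]/(0 : C) mul1r mul0r addr0.
  have ga1 : ga 1 = w2.
    by rewrite /ga subrr -[1%:C]/(1 : C) -[0%:C]/(0 : C) mul1r mul0r add0r.
  rewrite -{1}ga0 -{1}ga1; apply: (@segment_sign R (fun t => sg * cross al be (k (ga t)))).
    move=> t t01 e e0; have [[z zz E] _] := seg t t01.
    have s0 : 0 < `|sg| by rewrite normr_gt0.
    have [d d0 hd] := cross_cont al be z (divr_gt0 e0 s0).
    have [d' d'0 hd'] := disk_inverse_cont fhol finj zz d0.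
    have W0 : 0 < N (w2 - w1) + 1 by rewrite ltr_wpDl ?modulus_ge0.
    exists (d' / (N (w2 - w1) + 1)); first exact: divr_gt0.
    move=> s s01 st; rewrite -mulrBr normrM mulrC -ltr_pdivlMr //.
    have kt : k (ga t) = z by rewrite /ga -E disk_inverseK.
    rewrite kt; apply: hd; have := hd' (ga s); rewrite disk_inverseK // => H.
    apply: H; rewrite E /ga.
    have -> : (1 - s)%:C * w1 + s%:C * w2 - ((1 - t)%:C * w1 + t%:C * w2) = (s - t)%:C * (w2 - w1).
      by rewrite !realCB; ring.
    rewrite modulusM modulus_real; move: st; rewrite ltr_pdivlMr //.
    by apply: le_lt_trans; rewrite ler_wpM2l // lerDl.
  move=> t t01; rewrite mulf_neq0 //; have [[z zz E] nt] := seg t t01.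
  rewrite /ga -E disk_inverseK //; apply/eqP => c0.
  by apply: (avoid z zz c0); rewrite E.
pose sg : R := if 0 < cross al be zeta1 then 1 else -1.
have sg0 : sg != 0 by rewrite /sg; case: ifP; rewrite ?oppr_eq0 oner_eq0.
have [s1 s2] : 0 < sg * cross al be zeta1 /\ sg * cross al be zeta2 < 0.
  rewrite /sg; case: (ltP 0 (cross al be zeta1)) => c1; first by rewrite !mul1r -(pmulr_rlt0 _ c1).
  have c1' : cross al be zeta1 < 0.
    by rewrite lt_neqAle c1 andbT; apply: contraTneq prod_neg => ->; rewrite mul0r ltxx.
  by rewrite !mulN1r oppr_gt0 oppr_lt0 -(nmulr_rlt0 _ c1').
have sgN : `|sg| = 1 by rewrite /sg; case: ifP; rewrite ?normrN normr1.
have s2' : 0 < - (sg * cross al be zeta2) by rewrite oppr_gt0.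
have [d1 d10 hd1] := cross_cont al be zeta1 s1.
have [d2 d20 hd2] := cross_cont al be zeta2 s2'.
exists n, (fun z => sg * cross al be z), (Num.min d1 d2); split.
- by rewrite lt_min d10.
- exact: core.
- move=> z; rewrite lt_min => /andP[/hd1 h _].
  have : `|sg * cross al be z - sg * cross al be zeta1| < sg * cross al be zeta1.
    by rewrite -mulrBr normrM sgN mul1r.
  by rewrite ltr_norml; lra.
- move=> z; rewrite lt_min => /andP[_ /hd2 h].
  have : `|sg * cross al be z - sg * cross al be zeta2| < - (sg * cross al be zeta2).
    by rewrite -mulrBr normrM sgN mul1r.
  by rewrite ltr_norml; lra.
Qed.

(** Disks about [u] are convex, so one segment joins image points near the two boundary points
    without leaving a small disk. *)
Lemma finite_value_unique zeta1 zeta2 u : N zeta1 = 1 -> N zeta2 = 1 ->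
  F zeta1 = Some u -> F zeta2 = Some u -> zeta1 = zeta2.
Proof.
move=> z1 z2 F1 F2; apply/eqP; apply: contraT => z12.
have om := omitted_finite (boundary_value_omitted z1 F1).
have [n [M [e [e0 seg M1 M2]]]] := crosscut om z1 z2 z12 F1 F2.
have pick zeta : N zeta = 1 -> F zeta = Some u ->
    exists z, [/\ N z < 1, N (z - zeta) < e & N (f z - u) < n.+1%:R^-1].
  move=> zz Fz; have [d d0 hd] := sphere_near_at zz Fz n.
  have m0 : 0 < Num.min d e by rewrite lt_min d0.
  have [z z_1] := disk_near zz m0; rewrite lt_min => /andP[zd ze].
  by exists z; split => //; exact: hd.
have [y1 [y11 y1e y1u]] := pick _ z1 F1; have [y2 [y21 y2e y2u]] := pick _ z2 F2.
have := seg (f y1) (f y2); rewrite !disk_inverseK // => H.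
have := M2 _ y2e; rewrite ltNge => /negP[]; apply/ltW/H; last exact: M1.
move=> t t01; split; first by apply: cvx => //; [exists y1|exists y2].
rewrite /sphere_near; have [t0 t1] := andP t01.
have -> : (1 - t)%:C * f y1 + t%:C * f y2 - u = (1 - t)%:C * (f y1 - u) + t%:C * (f y2 - u).
  by rewrite realCB -[1%:C]/(1 : C); ring.
apply: le_lt_trans (modulusD _ _) _; rewrite !modulusM !modulus_posreal ?subr_ge0 //.
move: y1u y2u; set q := _^-1; have := modulus_ge0 (f y1 - u); have := modulus_ge0 (f y2 - u).
have [->|tn0] := eqVneq t 0; first by lra.
have tp : 0 < t by rewrite lt_def tn0.
by nra.
Qed.

(** Far image points are joined by three segments: out along [d], across, and back. [far_ray] keeps
    the two rays away from the origin because [- d] is not a recession direction. *)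
Lemma infinite_value_unique d zeta1 zeta2 : N d = 1 -> recession O d -> ~ recession O (- d) ->
  N zeta1 = 1 -> N zeta2 = 1 -> F zeta1 = None -> F zeta2 = None -> zeta1 = zeta2.
Proof.
move=> d1 rd nrd z1 z2 F1 F2; apply/eqP; apply: contraT => z12.
have [n [M [e [e0 seg M1 M2]]]] := crosscut omitted_infinity z1 z2 z12 F1 F2.
have O0 : O 0 by exists 0; rewrite ?modulus0.
have n1 : 0 < n%:R + 1 :> R by rewrite ltr_wpDl.
have [rho rho1 far] := far_ray O_open cvx O0 n1 d1 nrd.
have pick zeta : N zeta = 1 -> F zeta = None ->
    exists z, [/\ N z < 1, N (z - zeta) < e & rho < N (f z)].
  move=> zz Fz; have r0 : 0 <= rho by lra.
  have [x x0 hx] := sphere_near_at zz Fz (Num.bound rho).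
  have m0 : 0 < Num.min x e by rewrite lt_min x0.
  have [z z_1] := disk_near zz m0; rewrite lt_min => /andP[zd ze].
  by exists z; split => //; exact: lt_trans (archi_boundP r0) (hx z z_1 zd).
have [y1 [y11 y1e y1u]] := pick _ z1 F1; have [y2 [y21 y2e y2u]] := pick _ z2 F2.
have O1 : O (f y1) by exists y1. have O2 : O (f y2) by exists y2.
(* After translation by [S%:C * d] the crossing segment has modulus at least [n%:R + 1]. *)
pose S := n%:R + N (f y1) + N (f y2) + 1.
have f10 := modulus_ge0 (f y1); have f20 := modulus_ge0 (f y2).
have S0 : 0 <= S by rewrite /S; lra.
have ray w t : O w -> rho < N w -> 0 <= t <= 1 ->
    O (w + (t * S)%:C * d) /\ sphere_near None n (w + (t * S)%:C * d).
  move=> Ow wr /andP[t0 t1]; have ts : 0 <= t * S by rewrite mulr_ge0.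
  split; first exact: rd.
  by have := far w (t * S) Ow wr ts; rewrite /=; lra.
have s1 : 0 < M (k (f y1 + S%:C * d)).
  apply: (seg (f y1)); last by rewrite disk_inverseK // M1.
  move=> t t01; have := ray (f y1) t O1 y1u t01.
  by have -> : (1 - t)%:C * f y1 + t%:C * (f y1 + S%:C * d) = f y1 + (t * S)%:C * d
    by rewrite realCB realCM -[1%:C]/(1 : C); ring.
have s2 : 0 < M (k (f y2 + S%:C * d)).
  apply: (seg _ _ _ s1) => t t01; split.
    by apply: cvx => //; apply: rd.
  have [t0 t1] := andP t01.
  have -> : (1 - t)%:C * (f y1 + S%:C * d) + t%:C * (f y2 + S%:C * d) =
    S%:C * d + ((1 - t)%:C * f y1 + t%:C * f y2) by rewrite realCB -[1%:C]/(1 : C); ring.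
  rewrite /=; apply: lt_le_trans (modulusDr _ _).
  rewrite modulusM d1 mulr1 modulus_posreal //.
  have := modulusD ((1 - t)%:C * f y1) (t%:C * f y2).
  rewrite !modulusM !modulus_posreal ?subr_ge0 // /S.
  have : (1 - t) * N (f y1) <= N (f y1) by rewrite ler_piMl //; lra.
  have : t * N (f y2) <= N (f y2) by rewrite ler_piMl.
  lra.
have s3 : 0 < M (k (f y2)).
  apply: (seg _ _ _ s2) => t t01.
  have t01' : 0 <= 1 - t <= 1 by move: t01 => /andP[? ?]; apply/andP; split; lra.
  have := ray (f y2) (1 - t) O2 y2u t01'.
  by have -> : (1 - t)%:C * (f y2 + S%:C * d) + t%:C * f y2 = f y2 + ((1 - t) * S)%:C * d
    by rewrite realCM !realCB -[1%:C]/(1 : C); ring.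
by have := M2 _ y2e; rewrite disk_inverseK // in s3; lra.
Qed.

(** * The two ends of a strip *)

Section Strip.
Variables (c : C) (b1 b2 : R).
Hypothesis c_neq0 : c != 0.
Hypothesis O_strip : forall w, O w <-> b1 < Re (c * w) < b2.

Let b0 : b1 < 0 < b2.
Proof.
have O0 : O 0 by exists 0; rewrite ?modulus0.
by move/O_strip: O0; rewrite mulr0.
Qed.

Let strip_modulus w : O w -> N c * N w <= b2 - b1 + `|Im (c * w)|.
Proof.
move=> /O_strip /andP[h1 h2]; rewrite -modulusM (le_trans (modulus_le_ReIm _)) // lerD2r.
by have /andP[? ?] := b0; rewrite ler_norml; lra.
Qed.

(** Near [zeta] the values of [f] lie towards the end of the strip of sign [s]; [Im (c * _)] is the
    coordinate along the strip. *)
Let side_near (s : R) zeta : Prop :=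
  exists2 d, 0 < d & forall z, N z < 1 -> N (z - zeta) < d -> 0 < s * Im (c * f z).

Let Im_line (w1 w2 : C) (t : R) :
  Im (c * ((1 - t)%:C * w1 + t%:C * w2)) = (1 - t) * Im (c * w1) + t * Im (c * w2).
Proof. by case: c w1 w2 => x y [p q] [u v] /=; ring. Qed.

Let large_near zeta (m : R) : N zeta = 1 -> F zeta = None -> exists2 d, 0 < d &
  forall z, N z < 1 -> N (z - zeta) < d -> m < `|Im (c * f z)|.
Proof.
move=> z1 Fz; have c0 : 0 < N c by rewrite modulus_gt0.
have z1' : N zeta <= 1 by rewrite z1.
have [d d0 hd] := extension_at_infinity Fcont z1' Fz ((m + (b2 - b1)) / N c).
exists d => // z zz zd; have := hd z _ (ltW zz) zd (Fdisk zz).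
rewrite ltr_pdivrMr // => A; have Oz : O (f z) by exists z.
by have := strip_modulus Oz; lra.
Qed.

(** The part of the disk near [zeta] is convex, and [Im (c * f z)] has no zero on it, since [f] is
    large there while the strip has bounded width. *)
Lemma strip_end_side zeta : N zeta = 1 -> F zeta = None ->
  side_near 1 zeta \/ side_near (-1) zeta.
Proof.
move=> z1 Fz; have [d d0 hd] := large_near 0 z1 Fz.
have [z0 z01 z0d] := disk_near z1 d0.
have Im0 z : N z < 1 -> N (z - zeta) < d -> Im (c * f z) != 0.
  by move=> zz /(hd z zz); rewrite normr_gt0.
have key (s : R) : `|s| = 1 -> 0 < s * Im (c * f z0) -> side_near s zeta.
  move=> s1 h0; have sn0 : s != 0 by rewrite -normr_eq0 s1 oner_eq0.
  exists d => // z zz zd; pose ga (t : R) : C := (1 - t)%:C * z0 + t%:C * z.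
  have ga0 : ga 0 = z0.
    by rewrite /ga subr0 -[1%:C]/(1 : C) -[0%:C]/(0 : C) mul1r mul0r addr0.
  have ga1 : ga 1 = z.
    by rewrite /ga subrr -[1%:C]/(1 : C) -[0%:C]/(0 : C) mul1r mul0r add0r.
  have conv (x : C) (r t : R) : N (z0 - x) < r -> N (z - x) < r -> 0 <= t <= 1 -> N (ga t - x) < r.
    move=> h1 h2 /andP[t0 t1].
    have -> : ga t - x = (1 - t)%:C * (z0 - x) + t%:C * (z - x).
      by rewrite /ga realCB -[1%:C]/(1 : C); ring.
    apply: le_lt_trans (modulusD _ _) _; rewrite !modulusM !modulus_posreal ?subr_ge0 //.
    have [->|tn0] := eqVneq t 0; first by lra.
    have tp : 0 < t by rewrite lt_def tn0.
    nra.
  have gaD t : 0 <= t <= 1 -> N (ga t) < 1.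
    by move=> t01; rewrite -[ga t]subr0; apply: conv => //; rewrite subr0.
  have gad t : 0 <= t <= 1 -> N (ga t - zeta) < d by move=> t01; exact: conv.
  rewrite -{1}ga1; apply: (@segment_sign R (fun t => s * Im (c * f (ga t)))); last by rewrite ga0.
    move=> t t01 e e0; have c0 : 0 < N c by rewrite modulus_gt0.
    have [y y0 hy] := holo_cont (fhol (gaD t t01)) (divr_gt0 e0 c0).
    have W0 : 0 < N (z - z0) + 1 by rewrite ltr_wpDl ?modulus_ge0.
    exists (y / (N (z - z0) + 1)); first exact: divr_gt0.
    move=> s' s'01 st; rewrite -mulrBr normrM s1 mul1r.
    have -> : Im (c * f (ga s')) - Im (c * f (ga t)) = Im (c * (f (ga s') - f (ga t))).
      by case: c (f (ga s')) (f (ga t)) => p q [u v] [u' v'] /=; ring.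
    rewrite (le_lt_trans (normIm_le_modulus _)) // modulusM mulrC -ltr_pdivlMr //.
    apply: hy; have -> : ga s' - ga t = (s' - t)%:C * (z - z0) by rewrite /ga !realCB; ring.
    rewrite modulusM modulus_real; move: st; rewrite ltr_pdivlMr //.
    by apply: le_lt_trans; rewrite ler_wpM2l // lerDl.
  by move=> t t01; rewrite mulf_neq0 // Im0 ?gaD ?gad.
have [neg|pos|eq0] := ltgtP (Im (c * f z0)) 0.
- by right; apply: key; rewrite ?normrN ?normr1 //; lra.
- by left; apply: key; rewrite ?normr1 //; lra.
- by have := Im0 z0 z01 z0d; rewrite eq0 eqxx.
Qed.

(** Far points towards the same end are joined by a segment along which [s * Im (c * _)] stays
    large, contradicting the crosscut. *)
Lemma strip_side_unique (s : R) zeta1 zeta2 : `|s| = 1 -> N zeta1 = 1 -> N zeta2 = 1 ->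
  F zeta1 = None -> F zeta2 = None -> side_near s zeta1 -> side_near s zeta2 ->
  zeta1 = zeta2.
Proof.
move=> s1 z1 z2 F1 F2 [x1 x10 h1] [x2 x20 h2]; apply/eqP; apply: contraT => z12.
have c0 : 0 < N c by rewrite modulus_gt0.
have [n [M [e [e0 seg M1 M2]]]] := crosscut omitted_infinity z1 z2 z12 F1 F2.
have pick zeta x : N zeta = 1 -> F zeta = None -> 0 < x ->
    (forall z, N z < 1 -> N (z - zeta) < x -> 0 < s * Im (c * f z)) ->
    exists z, [/\ N z < 1, N (z - zeta) < e & N c * n%:R < s * Im (c * f z)].
  move=> zz Fz x0 hx; have [d d0 hd] := large_near (N c * n%:R) zz Fz.
  have m0 : 0 < Num.min (Num.min d x) e by rewrite !lt_min d0 x0.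
  have [z z_1] := disk_near zz m0; rewrite !lt_min => /andP[/andP[zd zx] ze].
  exists z; split => //; have := hd z z_1 zd; have := hx z z_1 zx => pos.
  by rewrite -[`|_|]mul1r -s1 -normrM gtr0_norm.
have [y1 [y11 y1e y1u]] := pick _ _ z1 F1 x10 h1.
have [y2 [y21 y2e y2u]] := pick _ _ z2 F2 x20 h2.
have := seg (f y1) (f y2); rewrite !disk_inverseK // => H.
have := M2 _ y2e; rewrite ltNge => /negP[]; apply/ltW/H; last exact: M1.
move=> t t01; split; first by apply: cvx => //; [exists y1|exists y2].
rewrite /sphere_near; have [t0 t1] := andP t01.
rewrite -(ltr_pM2l c0) -modulusM; apply: lt_le_trans (normIm_le_modulus _).
have sE (x : R) : `|x| = `|s * x| by rewrite normrM s1 mul1r.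
rewrite Im_line sE; apply: lt_le_trans (ler_norm _).
rewrite mulrDr !(mulrCA s).
have [->|tn0] := eqVneq t 0; first by lra.
have tp : 0 < t by rewrite lt_def tn0.
nra.
Qed.

Lemma strip_end_exists (s : R) : `|s| = 1 ->
  exists zeta, [/\ N zeta = 1, F zeta = None & forall x, 0 < x ->
    exists z, [/\ N z < 1, N (z - zeta) < x & 0 < s * Im (c * f z)]].
Proof.
move=> s1; have c0 : 0 < N c by rewrite modulus_gt0.
have ss : s * s = 1 by rewrite -expr2 -real_normK ?num_real // s1 expr1n.
apply: (@infinite_value_exists (fun w => 0 < s * Im (c * w))) => M.
pose m := `|M| * N c + 1; have m0 : 0 < m by rewrite ltr_wpDl // mulr_ge0 // modulus_ge0.
pose w : C := (0 +i* (s * m)) / c.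
have cw : c * w = 0 +i* (s * m) by rewrite /w mulrC divfK.
exists w; first by apply/O_strip; rewrite cw.
rewrite cw /= mulrA ss mul1r; split => //.
rewrite (le_lt_trans (ler_norm M)) // -(ltr_pM2l c0) -modulusM cw.
have -> : N (0 +i* (s * m)) = m.
  by rewrite /modulus /= expr0n add0r sqrtr_sqr normrM s1 mul1r gtr0_norm.
by rewrite /m; lra.
Qed.

Lemma strip_ends : exists zeta1 zeta2, [/\ N zeta1 = 1, N zeta2 = 1, zeta1 != zeta2,
  F zeta1 = None /\ F zeta2 = None &
  forall zeta, N zeta = 1 -> F zeta = None -> zeta = zeta1 \/ zeta = zeta2].
Proof.
have n1 : `|1 : R| = 1 by rewrite normr1.
have nN1 : `|- 1 : R| = 1 by rewrite normrN normr1.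
have side (s : R) zeta : N zeta = 1 -> F zeta = None ->
    (forall x, 0 < x -> exists z, [/\ N z < 1, N (z - zeta) < x & 0 < s * Im (c * f z)]) ->
    ~ side_near (- s) zeta.
  move=> z1 Fz h [d d0 hd]; have [z [zz zd pos]] := h d d0.
  by have := hd z zz zd; rewrite mulNr; lra.
have [za [a1 Fa ha]] := strip_end_exists n1.
have [zb [b_1 Fb hb]] := strip_end_exists nN1.
have sa : side_near 1 za.
  by have [|/(side _ _ a1 Fa ha)] := strip_end_side a1 Fa.
have sb : side_near (-1) zb.
  by have [/= sb|//] := strip_end_side b_1 Fb; case: (side _ _ b_1 Fb hb); rewrite opprK.
exists za, zb; split => //.
  by apply/eqP => E; apply: (side _ _ a1 Fa ha); rewrite E.
move=> zeta z1 Fz; have [s|s] := strip_end_side z1 Fz.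
  by left; exact: strip_side_unique n1 z1 a1 Fz Fa s sa.
by right; exact: strip_side_unique nN1 z1 b_1 Fz Fb s sb.
Qed.

End Strip.
End BoundaryBehaviour.

(** * Halfplanes, strips and sectors *)

Section SpecialDomains.
Variable R : realType.
Local Notation C := (CC R).
Local Notation N := (@modulus R).
Local Notation Re := complex.Re.

(** The squares differ by [1 + 2 * Re y]; equality is the perpendicular bisector of 0 and -1. *)
Lemma modulus_lt_one_add (y : C) : (N y < N (1 + y)) = (0 < 1 + 2 * Re y).
Proof.
rewrite -(@ltr_pXn2r _ 2) ?nnegrE ?modulus_ge0 //.
have -> : N (1 + y) ^+ 2 = N y ^+ 2 + (1 + 2 * Re y).
  by rewrite !modulus_sq; case: y => p q /=; ring.
by rewrite ltrDl.
Qed.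

Lemma modulus_eq_one_add (y : C) : (N (y / (1 + y)) == 1) = (1 + 2 * Re y == 0).
Proof.
have E : N (1 + y) ^+ 2 = N y ^+ 2 + (1 + 2 * Re y).
  by rewrite !modulus_sq; case: y => p q /=; ring.
(* At the pole [y = -1] the quotient is 0 by convention and [1 + 2 * Re y = -1], so both sides are
   false. *)
have [y1|y1] := eqVneq (1 + y) 0.
  have -> : y = -1 by apply/eqP; rewrite -addr_eq0 addrC y1.
  rewrite addrN invr0 mulr0 modulus0 eq_sym oner_eq0; apply/esym/negbTE.
  by rewrite ReN /=; apply/eqP; lra.
have D0 : N (1 + y) != 0 by rewrite modulus_eq0.
rewrite modulusM modulusV; apply/eqP/eqP => [h|h].
  have : N y = N (1 + y) by rewrite -[LHS](divfK D0) h mul1r.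
  by move=> e; rewrite -e in E; lra.
rewrite h addr0 in E; have -> : N y = N (1 + y); last by rewrite divff.
by apply/eqP; rewrite eq_sym -(@eqrXn2 _ 2) ?modulus_ge0 // E.
Qed.

Lemma sector_cone (v : C) (theta alpha : R) : cone_at (sector v theta alpha : C -> Prop) v.
Proof.
move=> r _ r0 [s [t [s0 tb ->]]]; exists (r * s), t; split => //; first exact: mulr_gt0.
by rewrite [v + s%:C * _]addrC addrK realCM mulrA.
Qed.

Lemma sector_vertex (v : C) (theta alpha : R) : ~ sector v theta alpha v.
Proof.
move=> [r [t [r0 _ E]]]; have : r%:C * cis t = 0 by apply: (addrI v); rewrite addr0 -E.
move/eqP; rewrite -modulus_eq0 modulusM modulus_cis mulr1 modulus_posreal ?(ltW r0) //.
by rewrite gt_eqF.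
Qed.

(** Along the bisector, [c * N (w - v) <= Re (e * (w - v))] with [c = cos (alpha / 2) > 0]. Adding
    this at two opposite points of a line cancels the linear term on the right, while the left side
    grows. *)
Lemma sector_no_line (A : C -> Prop) (v : C) (theta alpha : R) (d : C) : 0 < alpha < pi ->
  (forall w, A w <-> sector v theta alpha w) -> A 0 -> d != 0 ->
  recession A d -> recession A (- d) -> False.
Proof.
move=> /andP[al0 al1] AE A0 d0 rd rd'.
pose e : C := (cis (theta + alpha / 2))^*; pose c : R := cos (alpha / 2).
have p0 := @pi_gt0 R.
have c0 : 0 < c by apply: cos_gt0_pihalf; apply/andP; split; lra.
have dN : 0 < N d by rewrite modulus_gt0.
have bound w : A w -> c * N (w - v) <= Re (e * (w - v)).
  move=> /AE[r [t [r0 /andP[t1 t2] ->]]].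
  rewrite [v + _]addrC addrK -/(cis t) modulusM modulus_cis mulr1 modulus_posreal ?(ltW r0) //.
  rewrite mulrCA ReZ Re_mul_cis mulrC ler_wpM2l ?(ltW r0) //.
  set x := t - _; have xa : `|x| < alpha / 2 by rewrite /x ltr_norml; apply/andP; split; lra.
  have -> : cos x = cos `|x|.
    by have [x0|x0] := ger0P x; rewrite // cosN.
  apply/ltW; rewrite ltr_cos // in_itv /=; apply/andP; split; rewrite ?normr_ge0 //; lra.
have line s : A (s%:C * d).
  have [s0|s0] := leP 0 s; first by have := rd 0 s A0 s0; rewrite add0r.
  have := rd' 0 (- s) A0; rewrite add0r realCN mulrNN; apply.
  by rewrite oppr_ge0 ltW.
pose s := (`|Re (e * v)| + c * N v + 1) / (c * N d).
have cd : 0 < c * N d by rewrite mulr_gt0.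
have num0 : 0 < `|Re (e * v)| + c * N v + 1.
  by rewrite ltr_wpDl // addr_ge0 // mulr_ge0 ?modulus_ge0 // ltW.
have s0 : 0 < s by rewrite /s divr_gt0.
have sE : s * (c * N d) = `|Re (e * v)| + c * N v + 1 by rewrite /s divfK // gt_eqF.
have := bound _ (line s); have := bound _ (line (- s)).
have key (q : R) : `|q| = s -> c * (s * N d - N v) <= c * N (q%:C * d - v).
  move=> qs; rewrite ler_pM2l // (le_trans _ (modulusBr _ _)) // modulusM modulus_real qs.
  by rewrite lexx.
have := key s (gtr0_norm s0); have := key (- s); rewrite normrN (gtr0_norm s0) => /(_ erefl).
rewrite !mulrBr !ReB ![e * (_%:C * _)]mulrCA !ReZ mulNr.
have := ler_norm (- Re (e * v)); rewrite normrN => h1 h2 h3 h4 h5.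
have : s * (c * N d) = c * (s * N d) by ring.
lra.
Qed.

Lemma halfplane_cone (c u : C) (b : R) :
  Re (c * u) = b -> cone_at (halfplane c b : C -> Prop) u.
Proof.
move=> <- r w r0; rewrite /halfplane /= mulrDr ReD mulrCA ReZ mulrBr ReB => h.
by rewrite ltrDl mulr_gt0 // subr_gt0.
Qed.

Lemma strip_not_cone (A : C -> Prop) (c u : C) (b1 b2 : R) : c != 0 ->
  (forall w, A w <-> b1 < Re (c * w) < b2) ->
  (forall z, A z -> exists2 e, 0 < e & forall w, N (w - z) < e -> A w) ->
  A 0 -> ~ cone_at A u.
Proof.
move=> c0 AE Aop A0 cone.
have [w Aw ne] : exists2 w, A w & Re (c * w) != Re (c * u).
  have [X0|X0] := eqVneq (Re (c * u)) 0; last first.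
    by exists 0 => //; rewrite mulr0 /= eq_sym.
  have [e e0 he] := Aop 0 A0; have cN : 0 < N c by rewrite modulus_gt0.
  pose r := e / (2 * N c); have r0 : 0 < r by rewrite /r divr_gt0 // mulr_gt0.
  exists (r%:C * c^*).
    apply: he; rewrite subr0 modulusM modulus_conj modulus_posreal ?(ltW r0) //.
    have -> : r * N c = e / 2 by rewrite /r; field; rewrite gt_eqF.
    by lra.
  rewrite X0 mulrCA ReZ mul_conj /=; rewrite mulf_neq0 ?gt_eqF ?exprn_gt0 //.
set D := Re (c * w) - Re (c * u); have D0 : D != 0 by rewrite subr_eq0.
have all r : 0 < r -> b1 < Re (c * u) + r * D < b2.
  move=> r0; have /AE := cone r w r0 Aw.
  by rewrite mulrDr ReD mulrCA ReZ mulrBr ReB.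
have /andP[u1 u2] := all 1 ltr01.
(* Passing from ratio 1 to ratio [r] moves [Re (c * _)] by exactly the width [b2 - b1], too far for
   an open strip. *)
pose r := 1 + (b2 - b1) / `|D|.
have q0 : 0 < (b2 - b1) / `|D| by rewrite divr_gt0 ?normr_gt0 //; lra.
have r0 : 0 < r by rewrite /r; lra.
have /andP[u3 u4] := all r r0.
have E : r * D = D + (b2 - b1) / `|D| * D by rewrite /r; ring.
have [Dn|Dp|D00] := ltgtP D 0; last by rewrite D00 eqxx in D0.
  have Q : (b2 - b1) / `|D| * D = - (b2 - b1) by rewrite ltr0_norm // invrN mulrN mulNr divfK.
  by rewrite Q in E; lra.
have Q : (b2 - b1) / `|D| * D = b2 - b1 by rewrite gtr0_norm // divfK.
by rewrite Q in E; lra.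
Qed.

(** If [derive1 f] were not differentiable at 0, its derivative there would be the default 0 and
    [taylor2 f] would vanish. *)
Lemma taylor2_derivative (f : C -> C) : taylor2 f != 0 ->
  has_derivative (derive1 f) 0 (2 * taylor2 f).
Proof.
move=> a0; have n2 : 2 != 0 :> C by rewrite pnatr_eq0.
have -> : 2 * taylor2 f = derive1 (derive1 f) 0 by rewrite /taylor2 mulrC divfK.
apply: derivable_has_derivative; apply: contrapT => ncv.
move/negP: a0; apply; rewrite /taylor2 /derive1n /= derive1E.
have -> : 'D_1 (derive1 f) (0 : C) = 0 by exact: (dvgP ncv).
by rewrite mul0r.
Qed.

Lemma convex_set_segment (A : set C) (u v : C) (t : R) :
  convex_set (A : set (convex_lmodType C)) -> A u -> A v -> 0 <= t <= 1 ->
  A ((1 - t)%:C * u + t%:C * v).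
Proof.
move=> cA Au Av /andP[t0 t1].
have t0' : (0 : R[i]) <= t%:C by rewrite ler0c.
have t1' : t%:C <= (1 : R[i]) by rewrite -[1]/(1%:C) lecR.
have := cA v u (Itv01 t0' t1') (mem_set Av) (mem_set Au).
rewrite inE /conv /=; suff -> : (1 - t)%:C * u + t%:C * v = t%:C *: v + (1 - t%:C) *: u by [].
by rewrite realCB addrC.
Qed.

Lemma not_bounded_modulus (A : set C) : ~ bounded_set A ->
  forall M : R, exists2 w, A w & M < N w.
Proof.
move=> nb M; apply: contrapT => h; apply: nb; exists M%:C.
split; first by apply/complex_realP; exists M.
move=> x Mx w Aw /=; apply: le_trans (ltW Mx); rewrite norm_leE leNgt.
by apply/negP => lt; apply: h; exists w.
Qed.

End SpecialDomains.

(** * Counting the unimodular boundary points *)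

Unset Implicit Arguments.

Theorem theorem2p3 (R : realType) (f : CC R -> CC R)
    (f_conformal : conformal_on_disk f)
    (f_onto : unbounded_convex_domain (f @` disk))
    (f0 : f 0 = 0) (df0 : derive1 f 0 = 1) (a2_neq0 : taylor2 f != 0) :
  (forall z : CC R, disk z ->
     1 + taylor2 f * f z != 0 /\
     `|taylor2 f * star (taylor2 f) (Some (f z))| < 1) /\
  (forall F : CC R -> sphere R, spherical_extension f F ->
     unimodular_points f F !=set0 /\
     [/\ (* (i) *)
         ~ halfplane_mapping f -> ~ sector_mapping f -> ~ strip_mapping f ->
         exists zeta : CC R,
           unimodular_points f F = [set zeta] /\ F zeta = None,
         (* (ii) *)
         nonsymmetric_strip_mapping f ->
         exists zeta1 zeta2 : CC R,
           [/\ zeta1 != zeta2, unimodular_points f F = [set zeta1; zeta2],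
               F zeta1 = None & F zeta2 = None],
         (* (iii) *)
         forall v : CC R, sector_mapping_with_vertex f v ->
         exists zeta1 zeta2 : CC R,
           [/\ zeta1 != zeta2, unimodular_points f F = [set zeta1; zeta2],
               F zeta1 = Some v & F zeta2 = None]
       & (* (iv) *)
         halfplane_mapping f -> circle `<=` unimodular_points f F]).
Proof.
have [fdif finj0] := f_conformal; have [Oop _ Ocvx Ounb] := f_onto.
set a := taylor2 f in a2_neq0 *; pose g : CC R -> CC R := derive1 f; pose O := image f.
have OE w : O w <-> (f @` disk) w.
  by split=> -[z z1 <-]; exists z => //; apply/diskE.
have finj z w : modulus z < 1 -> modulus w < 1 -> f z = f w -> z = w.
  by move=> /diskE z1 /diskE w1; apply: finj0; exact: mem_set.
have fder z : modulus z < 1 -> has_derivative f z (g z).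
  by move=> /diskE z1; apply: derivable_has_derivative; exact: fdif.
have dg0 : has_derivative g 0 (2 * a) by exact: taylor2_derivative.
have O_open z : O z -> exists2 e, 0 < e & forall w, modulus (w - z) < e -> O w.
  move=> /OE; move/open_modulusP: Oop => h /h[e e0 he]; exists e => // w /he.
  by move/OE.
have cvx u v (t : R) : O u -> O v -> 0 <= t <= 1 -> O ((1 - t)%:C * u + t%:C * v).
  by move=> /OE Ou /OE Ov t01; apply/OE; exact: convex_set_segment.
have O0 : O 0 by exists 0; rewrite ?modulus0.
have half := image_half_plane finj fder f0 df0 dg0 cvx.
have unb (M : R) : exists2 w, O w & M < modulus w.
  by have [w /OE Ow Mw] := not_bounded_modulus Ounb M; exists w.
split=> [z /diskE z1|F [FD Fcont]].
  have Oz : O (f z) by exists z.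
  have h := half _ Oz; rewrite /star.
  have nz : 1 + a * f z != 0.
    by rewrite -modulus_gt0 (le_lt_trans (modulus_ge0 (a * f z))) // modulus_lt_one_add.
  split => //; rewrite -[1]/(1%:C) norm_ltE mulrA modulusM modulusV.
  by rewrite ltr_pdivrMr ?modulus_gt0 // mul1r modulus_lt_one_add.
have Fdisk z : modulus z < 1 -> F z = Some (f z).
  by move=> /diskE z1; apply: FD; exact: mem_set.
(* Unimodular points are those over infinity, where [star] is [a^-1], and those over critical finite
   boundary points. *)
have uniE zeta : modulus zeta = 1 ->
    (unimodular_points f F zeta <->
     F zeta = None \/ exists2 u, F zeta = Some u & 1 + 2 * complex.Re (a * u) = 0).
  move=> z1; rewrite /unimodular_points /= -/a; have cz : circle zeta by apply/circleE.
  have normEq y : `|y| = 1 <-> modulus y = 1 by rewrite -[`|y| = 1]/(circle y) circleE.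
  split=> [[_ /normEq]|h].
    case: (F zeta) => [u|] /=; last by left.
    by rewrite mulrA => /eqP; rewrite modulus_eq_one_add => /eqP h; right; exists u.
  split=> //; apply/normEq; case: h => [->|[u -> h]] /=.
    by rewrite divff // modulus1.
  by rewrite mulrA; apply/eqP; rewrite modulus_eq_one_add h.
have uni1 zeta : unimodular_points f F zeta -> modulus zeta = 1.
  by move=> [/circleE].
have crit_cone zeta u : modulus zeta = 1 -> F zeta = Some u ->
    1 + 2 * complex.Re (a * u) = 0 -> cone_at O u.
  move=> z1 Fz; apply: (critical_vertex_cone finj fder f0 df0 dg0 cvx) => w t Ow t01.
  apply: open_convex_adherent => //.
  exact: boundary_value_adherent Fdisk Fcont _ _ z1 Fz.
(* Unboundedness yields a point over infinity, which is unimodular in every case. *)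
have [zi [zi1 Fzi _]] : exists zeta, [/\ modulus zeta = 1, F zeta = None &
    forall d, 0 < d -> exists z, [/\ modulus z < 1, modulus (z - zeta) < d & True]].
  apply: (infinite_value_exists Fdisk Fcont (Q := fun=> True)) => M.
  by have [w Ow Mw] := unb M; exists w.
have zi_uni : unimodular_points f F zi by apply/uniE => //; left.
have [d d1 rd] := unbounded_recession O_open cvx O0 unb.
have inf_unique := @infinite_value_unique R f g a F finj fder f0 a2_neq0 O_open cvx half Fdisk Fcont d.
have fin_unique := @finite_value_unique R f g a F finj fder f0 a2_neq0 cvx half Fdisk Fcont.
have image_eq (A : set (CC R)) : (forall w, O w <-> A w) -> f @` disk = A.
  by move=> h; apply/seteqP; split=> w; [move/OE/h|move/h/OE].
split; first by exists zi.
split.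
- move=> nhalf nsector nstrip; exists zi; split => //; apply/seteqP; split=> [zeta uz|_ ->] //=.
  have z1 := uni1 _ uz; case/(uniE _ z1): uz => [Fz|[u Fz crit]].
    (* Two points over infinity would force [- d] to be a recession direction as well, hence a line
       in the image and a strip or halfplane. *)
    apply: (inf_unique zeta zi) => // rd'.
    have [[b1 [b2 [b12 h]]]|[b h]] := line_recession_classification O_open cvx O0 a2_neq0 half d1 rd rd'.
      by apply: nstrip; exists a, b1, b2; split => //; exact: image_eq.
    by apply: nhalf; exists a, b; split => //; exact: image_eq.
  have [h|[theta [alpha [al h]]]] := cone_classification O_open cvx O0 a2_neq0 half
      (crit_cone _ _ z1 Fz crit) crit.
    by case: nhalf; exists a, (- (1 / 2)); split => //; exact: image_eq.
  by case: nsector; exists u, theta, alpha; split => //; exact: image_eq.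
- move=> [c [b1 [b2 [c0 b12 h _]]]].
  have OS w : O w <-> b1 < complex.Re (c * w) < b2 by rewrite OE h.
  have [za [zb [a1 b_1 ab [Fa Fb] all]]] :=
    strip_ends finj fder f0 a2_neq0 cvx half Fdisk Fcont c0 OS.
  exists za, zb; split => //; apply/seteqP; split=> [zeta uz|_ [->|->]].
  + have z1 := uni1 _ uz; case/(uniE _ z1): uz => [Fz|[u Fz crit]].
      by have [->|->] := all _ z1 Fz; [left|right].
    (* A critical finite boundary value would make the strip a cone. *)
    by case: (strip_not_cone c0 OS O_open O0 (crit_cone _ _ z1 Fz crit)).
  + by apply/uniE => //; left.
  + by apply/uniE => //; left.
- move=> v [theta [alpha [al h]]].
  have OS w : O w <-> sector v theta alpha w by rewrite OE h.
  have vcone : cone_at O v.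
    by move=> r w r0 /OS Sw; apply/OS; exact: sector_cone.
  have vcrit := cone_vertex_critical finj fder f0 df0 dg0 vcone.
  have noline y : y != 0 -> recession O y -> ~ recession O (- y).
    by move=> y0 r1 r2; exact: (sector_no_line al OS O0 y0 r1 r2).
  have nOv : ~ O v by move/OS; exact: sector_vertex.
  have vadh : adherent O v.
    move=> e e0; pose r := e / (2 * (modulus v + 1)).
    have v0 : 0 < modulus v + 1 by rewrite ltr_wpDl ?modulus_ge0.
    have r0 : 0 < r by rewrite /r divr_gt0 // mulr_gt0.
    exists (v + r%:C * (0 - v)); first exact: vcone.
    rewrite addrC addKr sub0r modulusM modulusN modulus_posreal ?(ltW r0) //.
    have : r * (modulus v + 1) = e / 2 by rewrite /r; field; rewrite gt_eqF.
    by lra.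
  have [zv zv1 Fzv] := boundary_value_exists Fdisk Fcont vadh nOv.
  have dn0 : d != 0 by rewrite -modulus_gt0 d1.
  exists zv, zi; split => //.
    by apply/eqP => E; move: Fzi; rewrite -E Fzv.
  apply/seteqP; split=> [zeta uz|_ [->|->]] //.
    have z1 := uni1 _ uz; case/(uniE _ z1): uz => [Fz|[u Fz crit]].
      by right; apply: (inf_unique zeta zi) => //; exact: noline.
    have uv : u = v.
      (* Two distinct vertices would give opposite recession directions, hence a line in the
         sector. *)
      apply/eqP; apply: contraT => uv.
      have ucone := crit_cone _ _ z1 Fz crit.
      have r1 := two_cones_recession ucone vcone; have r2 := two_cones_recession vcone ucone.
      have vu0 : v - u != 0 by rewrite subr_eq0 eq_sym.
      by case: (noline _ vu0 r1); rewrite opprB.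
    by left; apply: (fin_unique zeta zv v) => //; rewrite Fz uv.
  by apply/uniE => //; right; exists v.
(* Every finite boundary value lies on the edge, and a halfplane is a cone about each point of its
   edge. *)
- move=> [c [b [c0 h]]] zeta /circleE z1; apply/uniE => //.
  case Fz : (F zeta) => [u|]; [right; exists u => //|by left].
  have OH w : O w <-> b < complex.Re (c * w) by rewrite OE h.
  have nOu := boundary_value_omitted finj fder Fdisk Fcont z1 Fz.
  have adh := boundary_value_adherent Fdisk Fcont z1 Fz.
  have cN : 0 < modulus c by rewrite modulus_gt0.
  have cu : complex.Re (c * u) = b.
    apply/le_anti/andP; split; first by rewrite leNgt; apply/negP => /OH.
    apply/ler_addgt0Pr => e e0; have [w /OH Ow wu] := adh _ (divr_gt0 e0 cN).
    rewrite ltr_pdivlMr // mulrC -modulusM mulrBr in wu.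
    have := Re_le_modulus (c * w - c * u); rewrite ReB; lra.
  apply: (cone_vertex_critical finj fder f0 df0 dg0) => r w r0 /OH Hw.
  by apply/OH; exact: (halfplane_cone cu r0 Hw).
Qed.
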